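(* Let $\mathcal{D}=(\nabla,C,A,B)$ be a time-dependent covariant derivation operator on a manifold $M$, let $(t,p_0)\in\mathbb{R}\times M$, and let $v_0,w_0\in \mathrm{T}_{p_0}M$. For small $\varepsilon\in\mathbb{R}$ consider: - $\gamma_1(s)$, the geodesic of $\mathcal{D}$ with initial conditions $\gamma_1(t)=p_0$ and $\gamma_1'(t)=v_0$. Let $p_1=\gamma_1(t+\varepsilon)$ and let $v_1,w_1\in \mathrm{T}_{p_1}M$ be the parallel transports of $v_0$ and $w_0$ along $\gamma_1$ to $p_1$. - $\gamma_2(s)$, the geodesic of $\mathcal{D}$ such that $\gamma_2(t+\varepsilon)=p_1$ and $\gamma_2'(t+\varepsilon)=w_1$. Let $p_2=\gamma_2(t+2\varepsilon)$ and let $v_2,w_2\in \mathrm{T}_{p_2}M$ be the parallel transports of $v_1$ and $w_1$ along $\gamma_2$ to $p_2$. - $\gamma_3(s)$, the geodesic of $\mathcal{D}$ such that $\gamma_3(t+2\varepsilon)=p_2$ and $\gamma_3'(t+2\varepsilon)=v_2$. Let $p_3=\gamma_3(t+\varepsilon)$ and let $w_3\in \mathrm{T}_{p_3}M$ be the parallel transport of $w_2$ along $\gamma_3$ to $p_3$. - $\gamma_4(s)$, the geodesic of $\mathcal{D}$ such that $\gamma_4(t+\varepsilon)=p_3$ and $\gamma_4'(t+\varepsilon)=w_3$. Let $p_4=\gamma_4(t)$. Then, defining $c(\varepsilon)=p_4$ for small $\varepsilon$, $c$ is a smooth path that satisfies: - $c(0)=p_0$, - $c'(0)=0$, - in coordinates,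 $\frac12c''(0)$ has components $$-(\Gamma_{ij}^k-\Gamma_{ji}^k)\,v^iw^j-(A_i^k-B_i^k)(v^i-w^i),$$ where $\Gamma_{ij}^k,A_i^k,B_i^k$ are evaluated at $(t,p_0)$ and $v^i,w^i$ are the components of $v_0,w_0$.
   Context: All manifolds and maps are smooth. A time-dependent object on $M$ is a smooth family of such objects parametrized by $t\in\mathbb{R}$. A time-dependent covariant derivation operator $\mathcal{D}=(\nabla,C,A,B)$ on $M$ consists of a time-dependent connection $\nabla={}^t\nabla$ on $M$ (a smooth family of linear connections on $\mathrm{T}M$, with Christoffel symbols $\Gamma_{ij}^k(t,x)$, with $\nabla_{\partial/\partial x^i}\frac{\partial}{\partial x^j}=\Gamma_{ij}^k\frac{\partial}{\partial x^k}$), a time-dependent vector field $C$, and time-dependent endomorphisms $A,B$ of $\mathrm{T}M$ (components $A_i^k(t,x)$, $B_i^k(t,x)$). It acts on time-dependent vector fields by $\mathcal{D}_XY=\dot Y+\nabla_XY+C+A(X)+B(Y)$, where $\dot Y$ is the time derivative at a fixed point of $M$. For a path $\gamma$ in $M$ and a vector field $w$ along $\gamma$, define $\mathcal{D}_tw=\nabla_tw+C+A(\gamma')+B(w)$, where $\nabla_tw$ has components $\dot w^k+\Gamma_{ij}^k\dot\gamma^iw^j$, and $\Gamma,A,B,C$ are all evaluated at $(s,\gamma(s))$ when the parameter of the path is $s$. The field $w$ is parallel along $\gamma$ if $\mathcal{D}_tw=0$, i.e. $\dot w^k+\Gamma_{ij}^k\dot\gamma^iw^j+C^k+A_i^k\dot\gamma^i+B_i^kw^i=0$.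 The parallel transport of a vector $u\in \mathrm{T}_{\gamma(s_0)}M$ along $\gamma$ from $\gamma(s_0)$ to $\gamma(s_1)$ is $w(s_1)$, where $w$ is the parallel vector field along $\gamma$ with $w(s_0)=u$. A path $\gamma$ is a geodesic of $\mathcal{D}$ if $\mathcal{D}_t\gamma'=0$, i.e. $\ddot\gamma^k+\Gamma_{ij}^k\dot\gamma^i\dot\gamma^j+C^k+(A_i^k+B_i^k)\dot\gamma^i=0$. When $c'(0)=0$, the second derivative $c''(0)$ is regarded as a tangent vector at $c(0)$, with components $(c^k)''(0)$ in any coordinate chart. *)

(* Defs.v *)
From HB Require Import structures.
From mathcomp Require Import all_boot all_order all_algebra.
From mathcomp Require Import all_classical all_reals all_analysis.

Set Implicit Arguments.
Unset Strict Implicit.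
Unset Printing Implicit Defensive.

Import Order.TTheory GRing.Theory Num.Theory.
Import numFieldNormedType.Exports.

Local Open Scope ring_scope.
Local Open Scope classical_set_scope.

Section Smooth.
Context {R : realType} {V W : normedModType R}.

(* Meant for open U and finite-dimensional V, where asking for all directional
   derivatives of order <= k to be differentiable or continuous is the usual
   notion of class C^k. *)
Fixpoint Ck_on (k : nat) (U : set V) (f : V -> W) : Prop :=
  if k is k'.+1 then
    (forall x, U x -> differentiable f x) /\ forall v, Ck_on k' U ('D_v f)
  else forall x, U x -> {for x, continuous f}.

Definition smooth_at (x : V) (f : V -> W) : Prop :=
  exists2 U : set V, open_nbhs x U & forall k, Ck_on k U f.

Lemma smooth_at_differentiable x f : smooth_at x f -> differentiable f x.
Proof. by case=> U [_ Ux] /(_ 1%N) [+ _]; apply. Qed.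

End Smooth.

Lemma near_diff_comp {R : realType} {U V W : normedModType R}
    (h : U -> W) (f : U -> V) (g : V -> W) (x u : U) (y : V) :
  f x = y -> differentiable h x -> differentiable f x -> differentiable g y ->
  {near x, h =1 g \o f} -> 'd h x u = 'd g y ('d f x u).
Proof.
move=> <- dh df dg hgf.
rewrite -(deriveE _ dh) (near_eq_derive _ hgf) (deriveE _ (differentiable_comp df dg)).
exact: (congr1 (@^~ u) (diff_comp df dg)).
Qed.

(* The atlas is not required to be maximal: any smooth atlas, in particular the
   maximal one, is allowed. The values of [chart i] and [ichart i] outside
   [cdom i] and its image are irrelevant. *)
Record manifold (R : realType) (n : nat) := Manifold {
  carrier :> topologicalType;
  mfd_hausdorff : hausdorff_space carrier;
  mfd_second_countable : @second_countable carrier;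
  cidx : Type;
  cdom : cidx -> set carrier;
  chart : cidx -> carrier -> 'rV[R]_n;
  ichart : cidx -> 'rV[R]_n -> carrier;
  cdom_open : forall i, open (cdom i);
  chart_open : forall i, open (chart i @` cdom i);
  chartK : forall i p, cdom i p -> ichart i (chart i p) = p;
  chart_continuous : forall i p, cdom i p -> {for p, continuous (chart i)};
  ichart_continuous : forall i p, cdom i p ->
    {for chart i p, continuous (ichart i)};
  cdom_cover : forall p, exists i, cdom i p;
  transition_smooth : forall i j p, cdom i p -> cdom j p ->
    smooth_at (chart i p) (chart j \o ichart i)
}.
Arguments cidx {R n} M : rename.
Arguments cdom {R n M} i _ : rename.
Arguments chart {R n M} i _ : rename.
Arguments ichart {R n M} i _ : rename.

Section Tangent.
Context {R : realType} {n : nat} (M : manifold R n).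
Implicit Types (i j : cidx M) (p q : M).

Definition transition i j : 'rV[R]_n -> 'rV[R]_n := chart j \o ichart i.

(* A tangent vector at p is the family of its components in the charts around p,
   related by the differentials of the transition maps. The components in the
   other charts are set to 0, so that two tangent vectors at p are equal as soon
   as their components in the charts around p are. *)
Local Notation tcomponents := (cidx M -> 'rV[R]_n).

Definition tangent_at p : pred tcomponents := fun v => `[<
  (forall i, ~ cdom i p -> v i = 0) /\
  (forall i j, cdom i p -> cdom j p ->
    v j = 'd (transition i j) (chart i p) (v i)) >].

Lemma tangent_at_submod_closed p : GRing.subsemimod_closed (tangent_at p).
Proof.
split; first split.
- by apply/asboolP; split=> // i j _ _; rewrite linear0.
- move=> u v /asboolP[u0 ul] /asboolP[v0 vl]; apply/asboolP; split.
    by move=> i ip; rewrite [LHS](_ : _ = u i + v i)// u0// v0// addr0.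
  move=> i j ip jp; rewrite [LHS](_ : _ = u j + v j)//.
  by rewrite (ul _ _ ip jp) (vl _ _ ip jp) -linearD.
- move=> a v /asboolP[v0 vl]; apply/asboolP; split.
    by move=> i ip; rewrite [LHS](_ : _ = a *: v i)// v0// scaler0.
  move=> i j ip jp; rewrite [LHS](_ : _ = a *: v j)//.
  by rewrite (vl _ _ ip jp) -linearZ.
Qed.

HB.instance Definition _ p :=
  GRing.isSubmodClosed.Build R tcomponents (tangent_at p)
    (tangent_at_submod_closed p).

Record tangent p := Tangent {
  tcomp :> tcomponents;
  tcompP : tcomp \in tangent_at p
}.

HB.instance Definition _ p := [isSub for @tcomp p].
HB.instance Definition _ p := [Choice of tangent p by <:].
HB.instance Definition _ p := [SubChoice_isSubLmodule of tangent p by <:].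

Lemma near_transition i j k p : cdom i p -> cdom j p ->
  \forall x \near chart i p,
    transition i k x = (transition j k \o transition i j) x.
Proof.
move=> ip jp.
have : \forall x \near chart i p, cdom j (ichart i x).
  have ic : ichart i @ chart i p --> p.
    by rewrite -[X in _ --> X](chartK ip); exact: (ichart_continuous ip).
  by apply: ic; apply: open_nbhs_nbhs; split => //; exact: cdom_open.
by apply: filterS => x jx; rewrite /transition /= chartK.
Qed.

Lemma diff_transition i j k p (u : 'rV[R]_n) :
  cdom i p -> cdom j p -> cdom k p ->
  'd (transition i k) (chart i p) u =
  'd (transition j k) (chart j p) ('d (transition i j) (chart i p) u).
Proof.
move=> ip jp kp.
apply: near_diff_comp.
- by rewrite /transition /= chartK.
- exact: smooth_at_differentiable (transition_smooth ip kp).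
- exact: smooth_at_differentiable (transition_smooth ip jp).
- exact: smooth_at_differentiable (transition_smooth jp kp).
- exact: near_transition.
Qed.

Definition chart_vector_comp i p (u : 'rV[R]_n) : tcomponents := fun j =>
  if `[< cdom i p /\ cdom j p >] then 'd (transition i j) (chart i p) u else 0.

Lemma chart_vectorP i p u : chart_vector_comp i p u \in tangent_at p.
Proof.
apply/asboolP; split=> [j jp|j k jp kp]; rewrite /chart_vector_comp.
  by case: asboolP => // -[].
case: asboolP => [[ip _]|nip]; last first.
  by case: asboolP => [[ip _]|_]; [case: nip|rewrite linear0].
by case: asboolP => [_|[]//]; exact: diff_transition.
Qed.

(* The tangent vector at p with components u in the chart i; 0 if p is outside
   the domain of i. *)
Definition chart_vector i p (u : 'rV[R]_n) : tangent p :=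
  Tangent (chart_vectorP i p u).

(* The coordinate field d/dx^a of the chart i, extended by 0. *)
Definition coord_field i (a : 'I_n) : forall p, tangent p :=
  fun p => chart_vector i p (delta_mx 0 a).

Definition section_smooth_at p (Y : forall q, tangent q) : Prop :=
  forall i, cdom i p -> smooth_at (chart i p) (fun x => Y (ichart i x) i).

Definition fun_smooth_at p (f : M -> R) : Prop :=
  forall i, cdom i p -> smooth_at (chart i p) (f \o ichart i).

(* Smoothness in (t, x) of a component, read in the chart i, of a time-dependent
   object on M. *)
Definition td_smooth_at i (t : R) p {W : normedModType R} (F : R -> M -> W) :
    Prop :=
  smooth_at (t, chart i p) (fun z => F z.1 (ichart i z.2)).

Definition christoffel_of
    (nabla : R -> forall p, tangent p -> (forall q, tangent q) -> tangent p)
    (i : cidx M) (a b k : 'I_n) (t : R) (p : M) : R :=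
  nabla t p (coord_field i a p) (coord_field i b) i 0 k.

(* nabla t p X Y is the covariant derivative at p, at time t, of the vector field
   Y along X : T_pM; only its values for Y smooth near p matter. It depends only
   on the germ of Y at p: if Y and Z agree on an open neighbourhood of p with
   indicator f, then f Y = f Z and nabla_leibniz applies to both sides. *)
Record td_connection := TdConnection {
  nabla :> R -> forall p, tangent p -> (forall q, tangent q) -> tangent p;
  nabla_linear : forall t p Y, section_smooth_at p Y ->
    linear (fun X : tangent p => nabla t X Y);
  nabla_add : forall t p (X : tangent p) Y Z,
    section_smooth_at p Y -> section_smooth_at p Z ->
    nabla t X (fun q => Y q + Z q) = nabla t X Y + nabla t X Z;
  nabla_leibniz : forall t p (X : tangent p) (f : M -> R) Y i,
    fun_smooth_at p f -> section_smooth_at p Y -> cdom i p ->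
    nabla t X (fun q => f q *: Y q) =
      'd (f \o ichart i) (chart i p) (X i) *: Y p + f p *: nabla t X Y;
  nabla_smooth : forall t p i a b k, cdom i p ->
    td_smooth_at i t p (christoffel_of nabla i a b k)
}.

Record td_vector_field := TdVectorField {
  tdv :> R -> forall p, tangent p;
  tdv_smooth : forall t p i, cdom i p ->
    td_smooth_at i t p (fun s q => tdv s q i)
}.

Record td_endomorphism := TdEndomorphism {
  tde :> R -> forall p, {linear tangent p -> tangent p};
  tde_smooth : forall t p i a, cdom i p ->
    td_smooth_at i t p (fun s q => tde s q (coord_field i a q) i)
}.

Record derivation_operator := DerivationOperator {
  opN : td_connection;
  opC : td_vector_field;
  opA : td_endomorphism;
  opB : td_endomorphism
}.

End Tangent.
Arguments tangent {R n M} p.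
Arguments td_connection {R n} M.
Arguments td_vector_field {R n} M.
Arguments td_endomorphism {R n} M.
Arguments derivation_operator {R n} M.

Section Operator.
Context {R : realType} {n : nat} {M : manifold R n} (D : derivation_operator M).
Local Notation tcomponents := (cidx M -> 'rV[R]_n).
Implicit Types (i : cidx M) (p : M) (a b k : 'I_n) (t s : R).

Definition Gamma i a b k t p : R := christoffel_of (opN D) i a b k t p.

Definition Ccomp i k t p : R := opC D t p i 0 k.

Definition Acomp i a k t p : R := opA D t p (coord_field i a p) i 0 k.

Definition Bcomp i a k t p : R := opB D t p (coord_field i a p) i 0 k.

Definition path_smooth_at s (g : R -> M) : Prop :=
  {for s, continuous g} /\
  forall i, cdom i (g s) -> smooth_at s (chart i \o g).

Definition velocity (g : R -> M) (s : R) : tcomponents := fun i =>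
  if `[< cdom i (g s) >] then derive1 (chart i \o g) s else 0.

(* A vector field along g, on the open interval J. It is given through its
   components because T_(g s)M depends on s. *)
Definition field_along (J : set R) (g : R -> M) (w : R -> tcomponents) : Prop :=
  forall s, J s -> w s \in tangent_at (g s) /\
    forall i, cdom i (g s) -> smooth_at s (fun r => w r i).

Definition nablat (g : R -> M) (w : R -> tcomponents) i k s : R :=
  derive1 (fun r => w r i 0 k) s +
  \sum_a \sum_b Gamma i a b k s (g s) * velocity g s i 0 a * w s i 0 b.

Definition Dt (g : R -> M) (w : R -> tcomponents) i k s : R :=
  nablat g w i k s + Ccomp i k s (g s)
  + \sum_a Acomp i a k s (g s) * velocity g s i 0 a
  + \sum_a Bcomp i a k s (g s) * w s i 0 a.

Definition Dt_zero (J : set R) (g : R -> M) (w : R -> tcomponents) : Prop :=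
  forall s i k, J s -> cdom i (g s) -> Dt g w i k s = 0.

Definition parallel (J : set R) (g : R -> M) (w : R -> tcomponents) : Prop :=
  field_along J g w /\ Dt_zero J g w.

Definition parallel_transport (J : set R) (g : R -> M) (s0 s1 : R)
    (u u' : tcomponents) : Prop :=
  exists w, [/\ parallel J g w, w s0 = u & w s1 = u'].

Definition geodesic (J : set R) (g : R -> M) : Prop :=
  (forall s, J s -> path_smooth_at s g) /\ Dt_zero J g (velocity g).

(* The solution of the geodesic equation with initial conditions (p, u) at s0, on
   some open interval containing s0 and s1 (in either order). *)
Record geodesic_arc (s0 s1 : R) (p : M) (u : tcomponents)
    (J : set R) (g : R -> M) : Prop := GeodesicArc {
  arc_open : open J;
  arc_interval : is_interval J;
  arc_start : J s0;
  arc_end : J s1;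
  arc_geodesic : geodesic J g;
  arc_point : g s0 = p;
  arc_velocity : velocity g s0 = u
}.

(* p4 is an endpoint of the construction with step e: it is possible that no
   such p4 exists, when one of the geodesics is not defined for long enough. *)
Definition quadrilateral (t : R) (p0 : M) (v0 w0 : tangent p0) (e : R) (p4 : M) :
    Prop :=
  exists (J1 J2 J3 J4 : set R) (g1 g2 g3 g4 : R -> M)
         (v1 w1 v2 w2 w3 : tcomponents),
  [/\ [/\ geodesic_arc t (t + e) p0 v0 J1 g1,
          parallel_transport J1 g1 t (t + e) v0 v1 &
          parallel_transport J1 g1 t (t + e) w0 w1],
      [/\ geodesic_arc (t + e) (t + 2 * e) (g1 (t + e)) w1 J2 g2,
          parallel_transport J2 g2 (t + e) (t + 2 * e) v1 v2 &
          parallel_transport J2 g2 (t + e) (t + 2 * e) w1 w2],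
      geodesic_arc (t + 2 * e) (t + e) (g2 (t + 2 * e)) v2 J3 g3 /\
        parallel_transport J3 g3 (t + 2 * e) (t + e) w2 w3,
      geodesic_arc (t + e) t (g3 (t + e)) w3 J4 g4 &
      g4 t = p4].

End Operator.

(* Main.v *)
Require Import Defs.
From HB Require Import structures.
From mathcomp Require Import all_boot all_order all_algebra.
From mathcomp Require Import all_classical all_reals all_analysis.
From mathcomp Require Import ring lra.

Import Order.TTheory GRing.Theory Num.Theory.
Import numFieldNormedType.Exports.

Local Open Scope ring_scope.
Local Open Scope classical_set_scope.

Set Implicit Arguments.
Unset Strict Implicit.
Unset Printing Implicit Defensive.

(** In a chart, a geodesic x of velocity y and a vector u parallel along it solve
an autonomous system z' = X z for the state z = (s, x, y, u), so by uniqueness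
the construction is the composite of the flows of X for the times e, e, -e, -e,
with y and u exchanged between two stages. If Z e is the integral curve of e *: X
starting at z0 e, then (Z, om), where om solves the variational equation along Z,
is a family of the same kind for the tangent map of X, and the derivative of
Z e 1 in e is X (Z e 1) + om e 1; by induction Z e 1 is smooth in e. For
zeta e = Phi (eta e) (sg * e), with Phi the flow of X and sg = 1 or -1, this gives
zeta' = sg X + eta' and, for the positions, x_zeta'' = x_eta'' + 2 sg y_eta' + X_y
at e = 0, where X_y is the velocity component of X. Over the four stages this adds
up to c'(0) = 0 and c''(0) = 2 (a(v, w) - a(w, v)),
where a(y, u) is the derivative of a vector u transported with velocity y. *)

(** * Calculus of maps of class C^k *)

(** Turning the flow time [e] into a factor of the field puts all the curves on the fixed interval
    [0, 1] and makes [e] an ordinary parameter, of either sign; differentiation is then always along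
    a curve of initial states. Passing to the tangent map costs one derivative of the field and
    doubles the space, which is why the induction runs over all spaces and all smooth fields at
    once.

    The geodesics of [quadrilateral] live on arbitrary open intervals and satisfy their equation in
    every chart. Two bridges lead from there to the flow in one chart: the covariance of [Dt], by
    which solving in one chart is enough, and a uniqueness argument on the manifold, by which a
    given geodesic stays in the chart as long as the local solution does.

    The stages start alternately near (t, x0, v, w) and (t, x0, w, v), so two local flows serve the
    four stages. The second derivative is never transformed from one chart to another: the endpoint
    being unique, the curve constructed in another chart coincides with the first one near 0. *)

Definition smooth_on {R : realType} {V W : normedModType R} (U : set V)
  (f : V -> W) := forall k, Ck_on k U f.

Section Ck.
Context {R : realType}.
Implicit Types (V W E : normedModType R).

Lemma open_near V (U : set V) x : open U -> U x -> \forall y \near x, U y.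
Proof. by move=> oU Ux; apply: open_nbhs_nbhs. Qed.

(** [Ck_on] asks for differentiability and not only for directional derivatives, so both have to
    pass to a function with the same germ. The first-order expansion does so, and its linear part is
    unique. *)
Lemma near_eq_diff V W (f g : V -> W) x :
  (\forall y \near x, f y = g y) -> differentiable f x ->
  differentiable g x /\ 'd g x = 'd f x :> (V -> W).
Proof.
move=> fg df; have fgx : f x = g x by exact: nbhs_singleton fg.
have [dc df'] := (diff_locallyP x f).1 df.
have E : g \o shift x = cst (g x) + 'd f x +o_ 0 id.
  apply/eqaddoP => e e0; move/eqaddoP: df' => /(_ e e0) h.
  have fg' : \forall h \near (0 : V), f (h + x) = g (h + x).
    move: fg; rewrite (near_shift (0 : V) x).
    by apply: filterS => z /=; rewrite subr0.
  near=> y; rewrite !fctE/= -fgx -(_ : f (y + x) = g (y + x)); first by near: y.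
  by near: y.
have E' : 'd g x = 'd f x :> (V -> W) by apply: (diff_unique dc E).
split; last exact: E'.
by apply/diff_locallyP; rewrite E'.
Unshelve. all: by end_near. Qed.

(** Once scaling is registered as bilinear, the product rule for [a x *: b x] follows from the
    differential of a bilinear map. *)
Lemma scale_is_bilinear W :
  bilinear_for
    (GRing.Scale.Law.clone _ _ *:%R _) (GRing.Scale.Law.clone _ _ *:%R _)
    (@GRing.scale R W).
Proof.
split=> [u'|u] a x y /=; first by rewrite scalerDl scalerA.
by rewrite scalerDr !scalerA mulrC.
Qed.
HB.instance Definition _ W := bilinear_isBilinear.Build R R W W _ _
  (@GRing.scale R W) (scale_is_bilinear W).

Lemma is_diff_scale V W (a : V -> R) (b : V -> W) x :
  differentiable a x -> differentiable b x ->
  is_diff x (fun y => a y *: b y) (fun v => a x *: 'd b x v + 'd a x v *: b x).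
Proof.
move=> da db.
have sc : continuous (fun p : R * W => p.1 *: p.2) by exact: scale_continuous.
have ds := differentiable_bilin (f := @GRing.scale R W) (a x, b x) sc.
have dp := differentiable_pair da db.
apply: DiffDef; first exact: (differentiable_comp dp ds).
rewrite [LHS](diff_comp dp ds) diff_pair// funeqE => v /=.
by rewrite (diff_bilin (f := @GRing.scale R W) _ sc).
Qed.

Lemma eq_diff_derive V W (f : V -> W) x v df :
  is_diff x f df -> 'D_v f x = df v.
Proof. by case=> d <-; rewrite deriveE. Qed.

(** The closure properties below compute a derivative only at the points of [U]; this lemma turns
    such a pointwise formula into membership in the class. *)
Lemma Ck_on_eq V W k (U : set V) (f g : V -> W) : open U ->
  (forall x, U x -> f x = g x) -> Ck_on k U f -> Ck_on k U g.
Proof.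
move=> oU; elim: k f g => [|k IH] f g fg /=.
  move=> cf x Ux; have := cf x Ux; rewrite /prop_for /continuous_at (fg _ Ux).
  apply: cvg_trans; apply: near_eq_cvg.
  by apply: filterS (open_near oU Ux) => y /fg.
have nfg x : U x -> \forall y \near x, f y = g y.
  by move=> Ux; apply: filterS (open_near oU Ux) => y /fg.
move=> [df Df]; split=> [x Ux|v].
  by have [] := near_eq_diff (nfg x Ux) (df x Ux).
apply: IH (Df v) => x Ux.
have [dg e] := near_eq_diff (nfg x Ux) (df x Ux).
exact: (etrans (deriveE _ (df x Ux))
  (etrans (esym (congr1 (@^~ v) e)) (esym (deriveE _ dg)))).
Qed.

Lemma Ck_on_sub V W k (U U' : set V) (f : V -> W) :
  U' `<=` U -> Ck_on k U f -> Ck_on k U' f.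
Proof.
move=> UU; elim: k f => [|k IH] f /=; first by move=> h x /UU/h.
by move=> [df Df]; split=> [x /UU/df//|v]; apply: IH.
Qed.

Lemma Ck_onW V W k (U : set V) (f : V -> W) : Ck_on k.+1 U f -> Ck_on k U f.
Proof.
elim: k f => [|k IH] f; first by move=> [df _] x /df /differentiable_continuous.
by move=> [df Df]; split=> // v; exact: IH.
Qed.

Lemma Ck_on_cst V W k (U : set V) (a : W) : Ck_on k U (cst a : V -> W).
Proof.
elim: k a => [|k IH] a /=; first by move=> x _; exact: cst_continuous.
split=> [x _|v]; first exact: differentiable_cst.
rewrite (_ : 'D_v _ = cst 0); first exact: IH.
by rewrite funeqE => x; rewrite derive_cst.
Qed.

Lemma Ck_onD V W k (U : set V) (f g : V -> W) : open U ->
  Ck_on k U f -> Ck_on k U g -> Ck_on k U (fun x => f x + g x).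
Proof.
move=> oU; elim: k f g => [|k IH] f g /=.
  by move=> cf cg x Ux; apply: cvgD; [exact: cf|exact: cg].
move=> [df Df] [dg Dg]; split=> [x Ux|v].
  by apply: differentiableD; [exact: df|exact: dg].
apply: (Ck_on_eq oU) (IH _ _ (Df v) (Dg v)) => x Ux /=.
by rewrite deriveD//; apply: diff_derivable; [exact: df|exact: dg].
Qed.

Lemma Ck_on_sum V W k (U : set V) I (r : seq I) (P : pred I) (f : I -> V -> W) :
  open U -> (forall i, P i -> Ck_on k U (f i)) ->
  Ck_on k U (fun x => \sum_(i <- r | P i) f i x).
Proof.
move=> oU h; elim: r => [|i r IH].
  by rewrite (_ : (fun x => _) = cst 0); [exact: Ck_on_cst|rewrite funeqE => x; rewrite big_nil].
case Pi : (P i); last first.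
  by rewrite (_ : (fun x => _) = (fun x => \sum_(i <- r | P i) f i x))// funeqE => x; rewrite big_cons Pi.
rewrite (_ : (fun x => _) = (fun x => f i x + \sum_(i <- r | P i) f i x)).
  by apply: Ck_onD => //; exact: h.
by rewrite funeqE => x; rewrite big_cons Pi.
Qed.

Lemma Ck_on_scale V W k (U : set V) (a : V -> R) (b : V -> W) : open U ->
  Ck_on k U a -> Ck_on k U b -> Ck_on k U (fun x => a x *: b x).
Proof.
move=> oU; elim: k a b => [|k IH] a b ka kb.
  by move=> x Ux; apply: cvgZ; [exact: ka|exact: kb].
have [[da Da] [db Db]] := (ka, kb).
have dd x Ux := is_diff_scale (da x Ux) (db x Ux).
split=> [x Ux|v]; first by case: (dd x Ux).
apply: (Ck_on_eq oU) (_ : Ck_on k U (fun x => a x *: 'D_v b x + 'D_v a x *: b x)).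
  move=> x Ux; rewrite (eq_diff_derive _ (dd x Ux)).
  by rewrite (deriveE _ (da x Ux)) (deriveE _ (db x Ux)).
apply: Ck_onD oU _ _; first exact: IH (Ck_onW ka) (Db v).
exact: IH (Da v) (Ck_onW kb).
Qed.

Lemma Ck_on_postlin V W E k (U : set V) (f : V -> W) (l : {linear W -> E}) :
  continuous l -> open U -> Ck_on k U f -> Ck_on k U (fun x => l (f x)).
Proof.
move=> cl oU; elim: k f => [|k IH] f.
  by move=> cf x Ux; apply: continuous_comp; [exact: cf|exact: cl].
move=> [df Df]; have dl y : differentiable l y := linear_differentiable y cl.
split=> [x Ux|v]; first exact: (differentiable_comp (df x Ux)).
apply: (Ck_on_eq oU) (IH _ (Df v)) => x Ux.
have dfx := df x Ux.
rewrite [RHS]deriveE; last exact: (differentiable_comp dfx).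
by rewrite (diff_comp dfx (dl _)) /= (diff_lin _ cl) (deriveE _ dfx).
Qed.

Lemma Ck_on_prelin V W E k (U : set W) (f : W -> E) (l : {linear V -> W}) :
  continuous l -> open U -> Ck_on k U f -> Ck_on k (l @^-1` U) (fun x => f (l x)).
Proof.
move=> cl oU; have oU' : open (l @^-1` U).
  by apply: open_comp => // x _; exact: cl.
elim: k f => [|k IH] f.
  by move=> cf x Ux; apply: continuous_comp; [exact: cl|exact: cf].
move=> [df Df]; have dl y : differentiable l y := linear_differentiable y cl.
split=> [x Ux|v]; first exact: (differentiable_comp (dl x) (df _ Ux)).
apply: (Ck_on_eq oU') (IH _ (Df (l v))) => x Ux.
have dfx := df _ Ux.
rewrite [RHS]deriveE; last exact: (differentiable_comp (dl _) dfx).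
by rewrite (diff_comp (dl x) dfx) /= (diff_lin _ cl) (deriveE _ dfx).
Qed.

Lemma Ck_on_lin V W k (U : set V) (l : {linear V -> W}) :
  continuous l -> Ck_on k U l.
Proof.
move=> cl; case: k => [|k]; first by move=> x _; exact: cl.
split=> [x _|v]; first exact: linear_differentiable.
rewrite (_ : 'D_v l = cst (l v)); first exact: Ck_on_cst.
rewrite funeqE => x; rewrite deriveE; first by rewrite (diff_lin _ cl).
exact: linear_differentiable.
Qed.

Lemma Ck_on_pair V W E k (U : set V) (f : V -> W) (g : V -> E) : open U ->
  Ck_on k U f -> Ck_on k U g -> Ck_on k U (fun x => (f x, g x)).
Proof.
move=> oU; elim: k f g => [|k IH] f g.
  by move=> cf cg x Ux; apply: cvg_pair; [exact: cf|exact: cg].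
move=> [df Df] [dg Dg]; split=> [x Ux|v].
  by apply: differentiable_pair; [exact: df|exact: dg].
apply: (Ck_on_eq oU) (IH _ _ (Df v) (Dg v)) => x Ux.
have [dfx dgx] := (df x Ux, dg x Ux).
rewrite [RHS]deriveE; last exact: differentiable_pair.
by rewrite (diff_pair dfx dgx) (deriveE _ dfx) (deriveE _ dgx).
Qed.

End Ck.

(* A finite basis of V with its dual family. Closed balls are then compact, but
   assuming it is simpler, V being always a product of copies of R and 'rV[R]_n. *)
Record coordinates (R : realType) (V : normedModType R) := Coordinates {
  cindex : finType;
  cfun : cindex -> {linear V -> R^o};
  cvec : cindex -> V;
  cfun_continuous : forall i, continuous (cfun i);
  cfunE : forall x, x = \sum_i (cfun i x : R) *: cvec i;
  cball_compact : forall r : R, compact [set x : V | `|x| <= r]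
}.
Arguments cindex {R V} _.
Arguments cfun {R V} _ _.
Arguments cvec {R V} _ _.

Definition linear_map (R : realType) (V W : lmodType R) (f : V -> W)
    (fl : linear f) : {linear V -> W} :=
  HB.pack f (GRing.isLinear.Build R V W _ f fl).

Section Coordinates.
Context {R : realType}.
Implicit Types (V W E : normedModType R).

Lemma continuous_fst V W : continuous (@fst V W).
Proof. by move=> x; exact: cvg_fst. Qed.
Lemma continuous_snd V W : continuous (@snd V W).
Proof. by move=> x; exact: cvg_snd. Qed.

Program Definition real_coordinates : coordinates R :=
  @Coordinates R R unit (fun=> (idfun : {linear R^o -> R^o})) (fun=> 1) _ _ _.
Next Obligation. by move=> i x; exact: cvg_id. Qed.
Next Obligation. by move=> x; rewrite big_const cardT/= enumT unlock/= addr0 /GRing.scale/= mulr1. Qed.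
Next Obligation.
move=> r; rewrite (_ : [set x | _] = `[-r, r]%classic); first exact: segment_compact.
by apply/seteqP; split=> x /=; rewrite in_itv/= ler_norml.
Qed.

Lemma row_coord_linear n (i : 'I_n) : linear (fun v : 'rV[R]_n => v 0 i : R^o).
Proof. by move=> a u v; rewrite !mxE. Qed.

Program Definition row_coordinates n : coordinates 'rV[R]_n :=
  @Coordinates R 'rV[R]_n 'I_n (fun i => linear_map (@row_coord_linear n i))
    (fun i => delta_mx 0 i) _ _ _.
Next Obligation. by move=> n i /= x; exact: coord_continuous. Qed.
Next Obligation. by move=> n x; exact: row_sum_delta. Qed.
Next Obligation.
move=> n r; apply: bounded_closed_compact.
  exists r; split; first exact: num_real.
  by move=> y ry x /= /le_trans; apply; exact: ltW.
rewrite (_ : [set _ | _] = (fun x : 'rV[R]_n => `|x|) @^-1` [set y | y <= r]) //.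
by apply: preimage_closed; [move=> x _; exact: norm_continuous|exact: closed_le].
Qed.

Program Definition prod_coordinates V W (cV : coordinates V) (cW : coordinates W) :
    coordinates (V * W)%type :=
  @Coordinates R (V * W)%type (cindex cV + cindex cW)%type
   (fun i => match i with inl i => cfun cV i \o fst | inr i => cfun cW i \o snd end)
   (fun i => match i with inl i => (cvec cV i, 0) | inr i => (0, cvec cW i) end) _ _ _.
Next Obligation.
move=> V W cV cW [] i x /=; apply: continuous_comp.
- exact: continuous_fst.
- exact: cfun_continuous.
- exact: continuous_snd.
- exact: cfun_continuous.
Qed.
Next Obligation.
move=> V W cV cW [x y]; rewrite big_sumType/=.
rewrite [in LHS](cfunE cV x) [in LHS](cfunE cW y).
have sp (I : finType) (f : I -> V * W) : \sum_i f i = (\sum_i (f i).1, \sum_i (f i).2).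
  by rewrite -!(raddf_sum fst, raddf_sum snd); case: (\sum_i _).
rewrite !sp/=; congr pair.
  by rewrite [X in _ = _ + X]big1 ?addr0// => i _; rewrite scaler0.
by rewrite [X in _ = X + _]big1 ?add0r// => i _; rewrite scaler0.
Qed.
Next Obligation.
move=> V W cV cW r.
rewrite (_ : [set _ | _] = [set x | `|x| <= r] `*` [set x | `|x| <= r]).
  by apply: compact_setX; exact: cball_compact.
by apply/seteqP; split=> -[x y] /=; rewrite prod_normE/= ge_max => /andP.
Qed.

(** [Ck_on] controls derivatives in fixed directions only. Expanding in the basis reduces a
    direction that varies with the point to finitely many fixed ones. *)
Lemma derive_cfun V W (cV : coordinates V) (f : V -> W) x v : differentiable f x ->
  'D_v f x = \sum_i (cfun cV i v : R) *: 'D_(cvec cV i) f x.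
Proof.
move=> df; rewrite (deriveE _ df) {1}(cfunE cV v) linear_sum; apply: eq_bigr => i _.
by rewrite linearZ/= (deriveE _ df).
Qed.

(** Together with [norm_le_cfun], this makes the norm equivalent to the sum of the absolute values
    of the coordinates, so that estimates can be proved on real functions. The summand 1 keeps the
    constants positive when there are no coordinates. *)
Lemma cfun_bounded V (cV : coordinates V) : exists2 C : R, 0 < C &
  forall v, \sum_i `|cfun cV i v| <= C * `|v|.
Proof.
have h i : exists C : R, 0 < C /\ forall v, `|cfun cV i v| <= C * `|v|.
  have [C C0 h] := linear_lipschitz (@cfun_continuous _ _ cV i).
  by exists C.
pose C i := xget 1 [set C : R | 0 < C /\ forall v, `|cfun cV i v| <= C * `|v|].
have C0 i : 0 < C i /\ forall v, `|cfun cV i v| <= C i * `|v|.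
  by rewrite /C; case: xgetP => // /(_ _) h'; have [x xP] := h i; case: (h' x).
exists (1 + \sum_i C i).
  by rewrite ltr_pwDl// sumr_ge0// => i _; rewrite ltW//; case: (C0 i).
move=> v; rewrite mulrDl mul1r mulr_suml -[X in X <= _]add0r lerD//.
by apply: ler_sum => i _; case: (C0 i).
Qed.

Lemma norm_le_cfun V (cV : coordinates V) : exists2 C : R, 0 < C &
  forall v, `|v| <= C * \sum_i `|cfun cV i v|.
Proof.
exists (1 + \sum_i `|cvec cV i|); first by rewrite ltr_pwDl// sumr_ge0.
move=> v; rewrite {1}(cfunE cV v) (le_trans (ler_norm_sum _ _ _))// mulr_sumr.
apply: ler_sum => i _; rewrite normrZ mulrC ler_wpM2r//.
by rewrite (bigD1 i)//= addrCA lerDl addr_ge0// sumr_ge0.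
Qed.

Lemma Ck_on_comp V W E (cW : coordinates W) k (U : set V) (U' : set W)
  (f : V -> W) (g : W -> E) : open U -> open U' -> (forall x, U x -> U' (f x)) ->
  Ck_on k U f -> Ck_on k U' g -> Ck_on k U (g \o f).
Proof.
move=> oU oU' fU; elim: k f g fU => [|k IH] f g fU kf kg.
  by move=> x Ux; apply: continuous_comp; [exact: kf|exact: kg (fU _ Ux)].
have [[df Df] [dg Dg]] := (kf, kg).
split=> [x Ux|v]; first exact: differentiable_comp (df x Ux) (dg _ (fU _ Ux)).
(* In the chain rule the direction ['D_v f x] moves with [x]; in coordinates the derivative becomes
   a sum of products to which the induction hypothesis applies. *)
apply: (Ck_on_eq oU) (_ : Ck_on k U (fun x => \sum_i (cfun cW i ('D_v f x) : R) *: 'D_(cvec cW i) g (f x))).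
  move=> x Ux; have [dfx dgx] := (df x Ux, dg _ (fU _ Ux)).
  rewrite -(derive_cfun cW _ dgx) [RHS]deriveE; last exact: differentiable_comp.
  by rewrite (diff_comp dfx dgx)/= (deriveE _ dgx) (deriveE _ dfx).
apply: Ck_on_sum => // i _; apply: Ck_on_scale => //.
  by apply: Ck_on_postlin => //; [exact: cfun_continuous|exact: Df].
exact: IH fU (Ck_onW kf) (Dg _).
Qed.

(** For a vector field [X], an integral curve (z, w) of this field on [V * V] is an integral curve z
    of [X] with a solution w of the variational equation along it. *)
Definition tangent_map V W (X : V -> W) (z : V * V) : W * W := (X z.1, 'D_(z.2) X z.1).

Lemma Ck_on_tangent_map V W (cV : coordinates V) k (U : set V) (X : V -> W) : open U ->
  Ck_on k.+1 U X -> Ck_on k (U `*` setT) (tangent_map X).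
Proof.
move=> oU kX.
have e : U `*` @setT V = fst @^-1` U by apply/seteqP; split=> -[] //= ? ? [].
have oU' : open (U `*` @setT V).
  by rewrite e; apply: open_comp => // x _; exact: continuous_fst.
apply: Ck_on_pair => //.
  by rewrite e; apply: (Ck_on_prelin (l := fst)) => //; [exact: continuous_fst|exact: Ck_onW].
apply: (Ck_on_eq oU') (_ : Ck_on k _ (fun z => \sum_i (cfun cV i z.2 : R) *: 'D_(cvec cV i) X z.1)).
  move=> x [Ux _]; rewrite -derive_cfun//; exact: kX.1.
apply: Ck_on_sum => // i _; apply: Ck_on_scale => //.
  have cl : continuous (cfun cV i \o snd : {linear (V * V)%type -> R^o}).
    by move=> x; apply: continuous_comp; [exact: continuous_snd|exact: cfun_continuous].
  exact: Ck_on_lin cl.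
rewrite e.
exact: (Ck_on_prelin (l := fst) (@continuous_fst _ _) oU (kX.2 (cvec cV i))).
Qed.

End Coordinates.

(** * Ordinary differential equations *)

Section MeanValue.
Context {R : realType}.
Implicit Types (V W : normedModType R).

Lemma is_derive_postlin V W (l : {linear V -> W}) (g : R -> V) (x : R) (dg : V) :
  continuous l -> is_derive x 1 g dg -> is_derive x 1 (l \o g) (l dg).
Proof.
move=> cl [dgx <-]; apply: DeriveDef.
  apply/derivable1_diffP; apply: differentiable_comp.
    exact/derivable1_diffP.
  exact: linear_differentiable.
have dfg : differentiable g x by apply/derivable1_diffP.
have dl := linear_differentiable (g x) cl.
rewrite deriveE; last exact: differentiable_comp.
by rewrite (diff_comp dfg dl)/= (diff_lin _ cl) (deriveE _ dfg).
Qed.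

Lemma is_derive_affine V (a b x : R) (g : R -> V) (dg : V) :
  is_derive (a * x + b) 1 g dg -> is_derive x 1 (fun s => g (a * s + b)) (a *: dg).
Proof.
move=> [/derivable1_diffP dg' <-].
have da : is_derive x 1 (fun s : R => a * s + b) a.
  have := @is_deriveD _ _ _ (a *: id) (cst b) x 1 a 0 _ _; rewrite addr0; apply.
  by have := @is_deriveZ _ _ _ id a x 1 1 _; rewrite /GRing.scale/= mulr1; apply; exact: is_derive_id.
have [/derivable1_diffP da1 da2] := da.
have dc := differentiable_comp da1 dg'.
apply: DeriveDef; first exact/derivable1_diffP.
rewrite (deriveE _ dc) (diff_comp da1 dg')/= -(deriveE _ da1) da2.
rewrite (deriveE _ dg') -(linearZ_LR ('d g (a * x + b))).
by congr ('d g _ _); rewrite /GRing.scale/= mulr1.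
Qed.

Lemma is_derive_continuous V (g : R -> V) (x : R) (dg : V) :
  is_derive x 1 g dg -> {for x, continuous g}.
Proof. by move=> [/derivable1_diffP /differentiable_continuous]. Qed.

(** Both [h + g] and [h - g] have a nonnegative derivative, hence are nondecreasing. *)
Lemma le_increment (g h dg dh : R -> R) (a b : R) : a <= b ->
  {within `[a, b], continuous g} -> {within `[a, b], continuous h} ->
  (forall x, a < x < b -> is_derive x 1 g (dg x)) ->
  (forall x, a < x < b -> is_derive x 1 h (dh x)) ->
  (forall x, a < x < b -> `|dg x| <= dh x) ->
  `|g b - g a| <= h b - h a.
Proof.
move=> ab cg ch Dg Dh gh.
have key (s : R) : s = 1 \/ s = -1 -> h a + s * g a <= h b + s * g b.
  move=> s1; have Df x : x \in `]a, b[%R -> is_derive x 1 (h + s *: g) (dh x + s * dg x).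
    by rewrite in_itv => xab; have ? := Dg x xab; have ? := Dh x xab; exact: is_deriveD.
  have c0 : {within `[a, b], continuous h + s *: g}.
    move=> x; apply: continuousD; first exact: ch.
    by apply: continuousZr; exact: cg.
  have d0 x : x \in `]a, b[%R -> 0 <= (h + s *: g)^`() x.
    move=> xab; rewrite derive1E; have [_ ->] := Df x xab.
    rewrite in_itv/= in xab; have := gh x xab; rewrite ler_norml.
    by case: s1 => ->; lra.
  apply: (@ger0_derive1_le_cc _ (h + s *: g) a b _ d0 c0) (ab).
  - by move=> x xab; have [] := Df x xab.
  - by rewrite in_itv/= lexx ab.
  - by rewrite in_itv/= lexx ab.
have := key 1 (or_introl erefl); have := key (-1) (or_intror erefl).
rewrite ler_norml; lra.
Qed.

(** A mean value inequality whose constant depends only on the space, obtained coordinate by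
    coordinate. *)
Lemma le_increment_vec V (cV : coordinates V) : exists2 C : R, 0 < C &
  forall (g dg : R -> V) (h dh : R -> R) (a b : R), a <= b ->
  {within `[a, b], continuous g} -> {within `[a, b], continuous h} ->
  (forall x, a < x < b -> is_derive x 1 g (dg x)) ->
  (forall x, a < x < b -> is_derive x 1 h (dh x)) ->
  (forall x, a < x < b -> `|dg x| <= dh x) ->
  `|g b - g a| <= C * (h b - h a).
Proof.
have [C C0 hC] := norm_le_cfun cV.
have [D D0 hD] := cfun_bounded cV.
(* Each coordinate grows by at most [D] times the increment of [h]; [C] converts the sum over the
   coordinates back to the norm. *)
exists (C * (1 + #|cindex cV|%:R * D)).
  by rewrite mulr_gt0// ltr_pwDl// mulr_ge0// ltW.
move=> g dg h dh a b ab cg ch Dg Dh gh.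
have hab : 0 <= h b - h a.
  have : `|(cst 0 : R -> R) b - (cst 0 : R -> R) a| <= h b - h a.
    apply: (@le_increment (cst 0) h (cst 0) dh) => // x.
    - exact: cst_continuous.
    - by move=> xab; rewrite normr0 (le_trans _ (gh x xab)).
  by rewrite /= subr0 normr0.
rewrite (le_trans (hC _))// -mulrA ler_pM2l//.
apply: (@le_trans _ _ (\sum_(i : cindex cV) D * (h b - h a))); last first.
  by rewrite sumr_const mulrDl mul1r -mulrA mulr_natl lerDr.
apply: ler_sum => i _; rewrite linearB/=.
have cg' : {within `[a, b], continuous (cfun cV i \o g)}.
  by move=> x; exact: (continuous_comp (cg x) (@cfun_continuous _ _ cV i (g x))).
have := @le_increment (cfun cV i \o g) (D *: h) (cfun cV i \o dg) (D *: dh) a b ab cg' _ _ _ _.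
rewrite /= mulrBr; apply.
- by move=> x; apply: continuousZr; exact: ch.
- by move=> x xab; apply: is_derive_postlin; [exact: cfun_continuous|exact: Dg].
- by move=> x xab; have := Dh x xab; exact: is_deriveZ.
- move=> x xab; rewrite (@le_trans _ _ (D * `|dg x|))//.
    by rewrite (le_trans _ (hD _))// (bigD1 i)//= lerDl sumr_ge0.
  by rewrite ler_pM2l// gh.
Qed.

End MeanValue.

(** * Primitives of continuous functions on the whole line *)

Section Primitive.
Context {R : realType}.
Implicit Types (V W : normedModType R).

Lemma eq_of_is_derive (g h dg : R -> R) (T : R) :
  (forall x : R, `|x| < T -> is_derive x 1 g (dg x)) ->
  (forall x : R, `|x| < T -> is_derive x 1 h (dg x)) ->
  g 0 = h 0 -> forall x, `|x| < T -> g x = h x.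
Proof.
move=> Dg Dh gh0 x xT.
have Dgh (y : R) : `|y| < T -> is_derive y 1 (g - h) 0.
  by move=> yT; rewrite -(subrr (dg y)); have ? := Dg y yT; have ? := Dh y yT; exact: is_deriveB.
have cgh a b : `|a| < T -> `|b| < T -> {within `[a, b], continuous g - h}.
  move=> aT bT; apply: continuous_in_subspaceT => y; rewrite inE/= in_itv/= => yab.
  apply: is_derive_continuous (Dgh y _); move: aT bT yab; rewrite !ltr_norml.
  by move=> /andP[? ?] /andP[? ?] /andP[? ?]; apply/andP; split; lra.
have key a b : a <= b -> `|a| < T -> `|b| < T -> (g - h) b = (g - h) a.
  move=> ab aT bT; apply/subr0_eq/eqP; rewrite -normr_le0.
  have := @le_increment _ (g - h) (cst 0) (cst 0) (cst 0) a b ab (cgh _ _ aT bT).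
  rewrite /= subrr; apply; last by move=> *; rewrite normr0.
  - by move=> y; exact: cst_continuous.
  - move=> y /andP[ay yb]; apply: Dgh; move: aT bT; rewrite !ltr_norml.
    by move=> /andP[? ?] /andP[? ?]; apply/andP; split; lra.
have T0 : `|0 : R| < T by rewrite normr0 (le_lt_trans _ xT).
apply/subr0_eq; rewrite -[RHS](subrr (h 0)) -{1}gh0.
by case: (lerP 0 x) => [x0|/ltW x0]; [exact: key|exact/esym/key].
Qed.

Lemma local_primitive (f : R -> R) (T : R) : continuous f ->
  exists F : R -> R, F 0 = 0 /\ forall x : R, `|x| < T -> is_derive x 1 F (f x).
Proof.
move=> cf; pose F (x : R) := (\int[lebesgue_measure]_(t in `[(- T)%R, x]) f t)%R.
exists (fun x => F x - F 0); split; first by rewrite subrr.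
move=> x; rewrite ltr_norml => /andP[Tx xT].
have fi : lebesgue_measure.-integrable `[- T, T] (EFin \o f).
  apply: continuous_compact_integrable; first exact: segment_compact.
  exact: continuous_subspaceT.
have [] := @continuous_FTC1_closed _ f (- T) x T xT fi Tx (cf x).
rewrite derive1E => dF eF; rewrite -(subr0 (f x)); apply: is_deriveB.
by apply: DeriveDef.
Qed.

Lemma primitive (f : R -> R) : continuous f ->
  exists F : R -> R, F 0 = 0 /\ forall x : R, is_derive x 1 F (f x).
Proof.
move=> cf; have [G HG] := choice (fun T => local_primitive T cf).
(* The radius varies with the point. Near [x] this is nevertheless a single primitive, because two
   local primitives that vanish at 0 agree on their common interval. *)
exists (fun x => G (`|x| + 1) x); split; first by rewrite (HG _).1.
move=> x; have xx : `|x| < `|x| + 1 by rewrite ltrDl.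
apply: near_eq_is_derive ((HG (`|x| + 1)).2 x xx).
have : \forall y \near x, `|y| < `|x| + 1.
  have := @norm_continuous _ _ x => /cvgr_lt; apply; exact: xx.
apply: filterS => y yx.
apply: (@eq_of_is_derive _ _ f (Num.min (`|x| + 1) (`|y| + 1))).
- by move=> z; rewrite lt_min => /andP[? ?]; apply: (HG _).2.
- by move=> z; rewrite lt_min => /andP[? ?]; apply: (HG _).2.
- by rewrite !(HG _).1.
- by rewrite lt_min yx/= ltrDl.
Qed.

Lemma primitive_vec V (cV : coordinates V) (f : R -> V) (v : V) : continuous f ->
  exists F : R -> V, F 0 = v /\ forall x : R, is_derive x 1 F (f x).
Proof.
move=> cf.
have h i : exists F : R -> R, F 0 = 0 /\ forall x : R, is_derive x 1 F (cfun cV i (f x)).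
  apply: primitive => x; apply: continuous_comp; [exact: cf|exact: cfun_continuous].
have [G HG] := choice h.
have Dsum (s : seq (cindex cV)) (x : R) : is_derive x 1 (fun y => \sum_(i <- s) G i y *: cvec cV i)
   (\sum_(i <- s) (cfun cV i (f x) : R) *: cvec cV i).
  elim: s => [|i s IH].
    rewrite big_nil (_ : (fun _ => _) = cst 0); first exact: is_derive_cst.
    by rewrite funeqE => y; rewrite big_nil.
  rewrite big_cons (_ : (fun _ => _) = (fun y => G i y *: cvec cV i) \+ (fun y => \sum_(i <- s) G i y *: cvec cV i)); last first.
    by rewrite funeqE => y; rewrite big_cons.
  apply: is_deriveD.
  have lZ : linear (fun r : R^o => r *: cvec cV i).
    by move=> a u w; rewrite scalerDl scalerA.
  apply: (@is_derive_postlin _ _ _ (linear_map lZ)) ((HG i).2 x).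
  by move=> y; apply: cvgZr_tmp; exact: cvg_id.
exists (fun x => v + \sum_i G i x *: cvec cV i); split.
  by rewrite big1 ?addr0// => i _; rewrite (HG i).1 scale0r.
move=> x; rewrite [f x](cfunE cV) -[X in is_derive _ _ _ X]add0r.
by apply: is_deriveD; exact: Dsum.
Qed.

End Primitive.

(** * Picard iteration for a globally Lipschitz field *)

Section Picard.
Context {R : realType}.
Implicit Types (V W : normedModType R).

Lemma le_of_eq (x y : R) : x = y -> x <= y.
Proof. by move=> ->. Qed.

Lemma geometric_limit (u : nat -> R) (B : R) :
  (forall j, `|u j.+1 - u j| <= B / 2 ^+ j) ->
  exists l : R, forall j, `|u j - l| <= 2 * B / 2 ^+ j.
Proof.
(* w and v are monotone and enclose the limit. *)
move=> h; pose w j := u j - 2 * B / 2 ^+ j; pose v j := u j + 2 * B / 2 ^+ j.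
have e j : 2 * B / 2 ^+ j.+1 = B / 2 ^+ j.
  by rewrite exprS invfM mulrACA divff// mul1r.
have wS j : w j <= w j.+1.
  by rewrite /w e; have := h j; rewrite ler_norml => /andP[]; rewrite -mulrA; lra.
have vS j : v j.+1 <= v j.
  by rewrite /v e; have := h j; rewrite ler_norml => /andP[]; rewrite -mulrA; lra.
have wm j k : (j <= k)%N -> w j <= w k.
  move=> jk; rewrite -(subnKC jk); elim: (k - j)%N => [|m IH]; first by rewrite addn0.
  by rewrite addnS (le_trans IH).
have vm j k : (j <= k)%N -> v k <= v j.
  move=> jk; rewrite -(subnKC jk); elim: (k - j)%N => [|m IH]; first by rewrite addn0.
  by rewrite addnS (le_trans _ IH).
have B0 : 0 <= B by have := h 0%N; rewrite expr0 divr1; apply: le_trans.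
have wv j k : w j <= v k.
  rewrite (le_trans (wm j (maxn j k) _)) ?leq_maxl// (le_trans _ (vm k (maxn j k) _)) ?leq_maxr//.
  rewrite /w /v; have : 0 <= 2 * B / 2 ^+ maxn j k by rewrite !mulr_ge0// invr_ge0 exprn_ge0.
  lra.
have ne : has_sup (range w).
  split; first by exists (w 0%N); exists 0%N.
  by exists (v 0%N) => _ [j _ <-].
exists (sup (range w)) => j; rewrite ler_distl; apply/andP; split.
  by rewrite lerBlDr; apply: ge_sup => [|_ [k _ <-]]; [exact: ne.1|exact: wv].
by rewrite -lerBlDr; apply: (ub_le_sup ne.2); exists j.
Qed.

(* For b = 2KL, this makes the Picard iteration of an L-Lipschitz field contract
   by 1/2 on the whole line in the norm weighted by exp (- b |s|). *)
Lemma expR_increment_le V (cV : coordinates V) : exists2 K : R, 0 < K &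
  forall (g dg : R -> V) (a b : R), 0 <= a -> 0 < b -> g 0 = 0 ->
  (forall s : R, is_derive s 1 g (dg s)) ->
  (forall s, `|dg s| <= a * expR (b * `|s|)) ->
  forall s, `|g s| <= K * (a / b) * expR (b * `|s|).
Proof.
have [K K0 hK] := le_increment_vec cV.
exists K => // g dg a b a0 b0.
wlog suff key : g dg / g 0 = 0 ->
  (forall s : R, is_derive s 1 g (dg s)) ->
  (forall s, `|dg s| <= a * expR (b * `|s|)) ->
  forall s, 0 <= s -> `|g s| <= K * (a / b) * expR (b * `|s|).
  move=> g0 Dg hdg s; case: (lerP 0 s) => [s0|/ltW s0]; first exact: key Dg hdg _ s0.
  have := key (g \o -%R) (fun s => - dg (- s)) _ _ _ (- s).
  rewrite /= opprK normrN; apply.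
  - by rewrite oppr0.
  - move=> x; have := is_derive_affine (a := -1) (b := 0) (x := x) (g := g) (dg := dg (- x)).
    rewrite scaleN1r (_ : (fun s => _) = g \o -%R) ?mulN1r ?addr0; first by apply; exact: Dg.
    by rewrite funeqE => y; rewrite mulN1r addr0.
  - by move=> x; rewrite normrN (le_trans (hdg _))// normrN.
  - by rewrite oppr_ge0.
move=> g0 Dg hdg s s0.
have Dh (x : R) : is_derive x 1 (fun s => (a / b) * expR (b * s)) (a * expR (b * x)).
  have d1 : is_derive x 1 ( *%R b) b.
    by have := @is_deriveZ _ _ _ id b x 1 1 _; rewrite /GRing.scale/= mulr1; apply; exact: is_derive_id.
  have d2 := is_derive1_comp (is_derive_expR (b * x)) d1.
  have := is_deriveZ (a / b) d2.
  rewrite /GRing.scale/= (_ : a / b * _ = a * expR (b * x)) //.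
  by field; exact: lt0r_neq0.
have := hK g dg _ (fun s => a * expR (b * s)) 0 s s0 _ _ _ (fun x _ => Dh x) _.
rewrite g0 subr0 mulr0 expR0 mulr1 => h.
rewrite -mulrA (ger0_norm s0); apply: le_trans (h _ _ _ _) _.
- by apply: continuous_subspaceT => x; exact: is_derive_continuous (Dg x).
- by apply: continuous_subspaceT => x; exact: is_derive_continuous (Dh x).
- by move=> x /andP[x0 _]; rewrite (le_trans (hdg _))// gtr0_norm.
- by rewrite ler_pM2l// lerBlDr lerDl divr_ge0// ltW.
Qed.

Lemma continuous_lipschitz_field V (f : R -> V -> V) (L : R) (Z : R -> V) :
  (forall z, continuous (f ^~ z)) ->
  (forall s z z', `|f s z - f s z'| <= L * `|z - z'|) ->
  continuous Z -> continuous (fun s => f s (Z s)).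
Proof.
move=> cf lf cZ s; apply/cvgrPdist_le => /= e e0.
have e1 : 0 < e / 2 by rewrite divr_gt0.
have L1 : 0 < 1 + `|L| by rewrite ltr_pwDl.
have e2 : 0 < e / 2 / (1 + `|L|) by rewrite divr_gt0.
have /cvgrPdist_le /(_ _ e1) h1 := cf (Z s) s.
have /cvgrPdist_le /(_ _ e2) h2 := cZ s.
near=> t.
rewrite -(subrKA (f t (Z s))) (le_trans (ler_normD _ _))// [leRHS]splitr lerD//.
  by near: t.
rewrite (le_trans (lf _ _ _))//.
have : `|Z s - Z t| <= e / 2 / (1 + `|L|) by near: t.
rewrite ler_pdivlMr// mulrC; apply: le_trans; rewrite ler_wpM2r//.
by rewrite (le_trans (ler_norm L))// lerDr.
Unshelve. all: by end_near. Qed.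

Lemma geometric_limit_vec V (cV : coordinates V) : exists2 K : R, 0 < K &
  forall (u : nat -> R -> V) (E : R -> R),
  (forall j s, `|u j.+1 s - u j s| <= E s / 2 ^+ j) ->
  exists Z : R -> V, forall j s, `|u j s - Z s| <= K * E s / 2 ^+ j.
Proof.
have [D D0 hD] := cfun_bounded cV.
exists (1 + \sum_i 2 * D * `|cvec cV i|).
  by rewrite ltr_pwDl// sumr_ge0// => i _; rewrite !mulr_ge0// ltW.
move=> u E hu.
have E0 s : 0 <= E s by have := hu 0%N s; rewrite expr0 divr1; apply: le_trans.
have h (p : cindex cV * R) : exists l : R,
    forall j, `|cfun cV p.1 (u j p.2) - l| <= 2 * (D * E p.2) / 2 ^+ j.
  apply: geometric_limit => j; rewrite -linearB/= (@le_trans _ _ (D * `|u j.+1 p.2 - u j p.2|))//.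
    by rewrite (le_trans _ (hD _))// (bigD1 p.1)//= lerDl sumr_ge0.
  by rewrite -mulrA ler_pM2l// hu.
have [l hl] := choice h.
exists (fun s => \sum_i l (i, s) *: cvec cV i) => j s.
rewrite {1}(cfunE cV (u j s)) -sumrB (le_trans (ler_norm_sum _ _ _))//.
rewrite mulrDl [X in _ <= X]mulrDl mul1r -[leLHS]add0r lerD//; first by rewrite mulr_ge0// invr_ge0 exprn_ge0.
rewrite !mulr_suml; apply: ler_sum => i _; rewrite -scalerBl normrZ.
have := hl (i, s) j => /= /(ler_wpM2r (normr_ge0 (cvec cV i))) /le_trans; apply.
by apply: le_of_eq; ring.
Qed.

(** The Lipschitz constant and the bound at [z0] are uniform in time, so the iterates exist on the
    whole line and converge in the weighted norm without any shrinking of the interval. *)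
Lemma picard V (cV : coordinates V) (f : R -> V -> V) (z0 : V) (L M : R) :
  (forall z, continuous (f ^~ z)) ->
  (forall s z z', `|f s z - f s z'| <= L * `|z - z'|) ->
  (forall s, `|f s z0| <= M) ->
  exists Z : R -> V, Z 0 = z0 /\ forall s : R, is_derive s 1 Z (f s (Z s)).
Proof.
move=> cf lf0 Mf.
wlog L0 : L lf0 / 0 < L.
  move=> /(_ (1 + `|L|)); apply; last by rewrite ltr_pwDl.
  move=> s z z'; rewrite (le_trans (lf0 s z z'))// ler_wpM2r//.
  by rewrite (le_trans (ler_norm L))// lerDr.
have [K K0 hK] := expR_increment_le cV.
have [K' K'0 hK'] := geometric_limit_vec cV.
have M0 : 0 <= M by rewrite (le_trans _ (Mf 0)).
(* The primitive is made a total operation, with an arbitrary value if [g] is not continuous, so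
   that the iterates can be defined before their continuity is known. *)
have prim (g : R -> V) : exists F : R -> V, continuous g ->
    F 0 = z0 /\ forall s : R, is_derive s 1 F (g s).
  have [cg|ncg] := pselect (continuous g); last by exists g.
  by have [F hF] := primitive_vec cV z0 cg; exists F.
have [P hP] := choice prim.
have [u [uz uS]] : exists u : nat -> R -> V, u 0%N = cst z0 /\
    forall j, u j.+1 = P (fun s => f s (u j s)).
  by exists (fix u j := if j is k.+1 then P (fun s => f s (u k s)) else (cst z0 : R -> V)).
have cu j : continuous (u j).
  elim: j => [|j IH]; first by rewrite uz; exact: cst_continuous.
  rewrite uS => s; have [_ Du] := hP _ (continuous_lipschitz_field cf lf0 IH).
  exact: is_derive_continuous (Du s).
have Du j (s : R) : is_derive s 1 (u j.+1) (f s (u j s)).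
  by rewrite uS; exact: (hP _ (continuous_lipschitz_field cf lf0 (cu j))).2.
pose b := 2 * K * L; have b0 : 0 < b by rewrite !mulr_gt0.
have Kn := lt0r_neq0 K0; have Ln := lt0r_neq0 L0.
have p2 j : 2 ^+ j != 0 :> R by rewrite expf_neq0.
pose e (s : R) := expR (b * `|s|).
have e1 (s : R) : 1 <= e s by rewrite -expR0 ler_expR mulr_ge0// ltW.
have u0 j : u j 0 = z0 by case: j => [|j]; [rewrite uz|rewrite uS; exact: (hP _ (continuous_lipschitz_field cf lf0 (cu j))).1].
have u00 i j : (u i - u j) 0 = 0 by rewrite -[LHS]/(u i 0 - u j 0) !u0 subrr.
have DB g h (dg dh : R -> V) : (forall s : R, is_derive s 1 g (dg s)) ->
   (forall s : R, is_derive s 1 h (dh s)) -> forall s : R, is_derive s 1 (g - h) (dg s - dh s).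
  by move=> Dg Dh s; exact: is_deriveB.
(* The first increment has derivative [f s z0], bounded by [M]; each further one gains the factor
   [K * L / b], which is 1/2. *)
have step j (s : R) : `|u j.+1 s - u j s| <= K * (M / b) * e s / 2 ^+ j.
  elim: j s => [|j IH] s.
    have Du0 (t : R) : is_derive t 1 (u 1%N) (f t z0) by have := Du 0%N t; rewrite uz.
    rewrite expr0 divr1; apply: (hK (u 1%N - u 0%N) (fun s => f s z0 - 0)) => //.
    - by apply: DB Du0 _ => t; rewrite uz; exact: is_derive_cst.
    - by move=> t; rewrite subr0 (le_trans (Mf t))// ler_peMr//; exact: e1.
  have -> : K * (M / b) * e s / 2 ^+ j.+1 = K * (L * (K * (M / b) / 2 ^+ j) / b) * e s.
    by rewrite exprS /b; field; rewrite p2 Kn Ln.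
  apply: (hK (u j.+2 - u j.+1) (fun s => f s (u j.+1 s) - f s (u j s))) => //.
  - by rewrite !mulr_ge0// ?invr_ge0 ?exprn_ge0// ltW.
  - move=> t; rewrite (le_trans (lf0 _ _ _))// -[leRHS]mulrA ler_pM2l//.
    by rewrite (le_trans (IH t))// mulrAC.
have [Z hZ] := hK' u _ step.
pose B := K' * (K * (M / b)).
have {}hZ j s : `|u j s - Z s| <= B * e s / 2 ^+ j by rewrite (le_trans (hZ j s))// /B !mulrA.
have cvg0 (C x : R) : (forall j, x <= C / 2 ^+ j) -> x <= 0.
  move=> h; have : (fun j => C * (2^-1) ^+ j) @ \oo --> C * 0.
    by apply: cvgMr; apply: cvg_expr; rewrite ger0_norm ?invr_ge0// invf_lt1// ltr1n.
  rewrite mulr0 => cv; apply: (ler_cvg_to (cvg_cst x) cv).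
  by apply: nearW => j; rewrite exprVn.
have cZ : continuous Z.
  move=> s; apply/cvgrPdist_le => /= eps eps0.
  (* [Q] bounds the weight for all times up to [|s| + 1]; the convergence is uniform there, so one
     continuous iterate controls [Z] near [s]. *)
  pose Q := B * expR (b * (`|s| + 1)).
  have Q0 : 0 <= Q by rewrite !mulr_ge0 ?expR_ge0// ?invr_ge0 ltW.
  have cq : (fun j => Q * (2^-1) ^+ j) @ \oo --> Q * 0.
    by apply: cvgMr; apply: cvg_expr; rewrite ger0_norm ?invr_ge0// invf_lt1// ltr1n.
  rewrite mulr0 in cq; have e3 : 0 < eps / 3 by rewrite divr_gt0.
  have [j _ /(_ j (leqnn j)) /= hj] : \forall j \near \oo, Q * (2^-1) ^+ j < eps / 3.
    by move/cvgr_lt: cq; apply.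
  have /cvgrPdist_le /(_ _ e3) h := cu j s.
  have st (t : R) : `|t| <= `|s| + 1 -> `|u j t - Z t| <= eps / 3.
    move=> ts; rewrite (le_trans (hZ j t))// (le_trans _ (ltW hj))// exprVn ler_wpM2r//.
    rewrite ler_wpM2l ?ler_expR ?ler_pM2l//.
    by rewrite !mulr_ge0// ?invr_ge0 ltW.
  have ns : \forall t \near s, `|t| <= `|s| + 1.
    by have := @norm_continuous _ _ s => /cvgr_le; apply; rewrite ltrDl.
  near=> t.
  have h1 : `|u j s - Z s| <= eps / 3 by rewrite st// lerDl.
  have h2 : `|u j t - Z t| <= eps / 3 by apply: st; near: t.
  have h3 : `|u j s - u j t| <= eps / 3 by near: t.
  have -> : Z s - Z t = (u j s - u j t) - (u j s - Z s) + (u j t - Z t).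
    by rewrite opprB [_ + (Z s - _)]addrC !subrKA.
  rewrite (le_trans (ler_normD _ _))// (le_trans (lerD (ler_normB _ _) (lexx _)))//.
  lra.
have [G0 DG] := hP _ (continuous_lipschitz_field cf lf0 cZ).
set G := P _ in G0 DG.
(* [G] is the Picard image of the limit. Both [G] and [Z] are within a multiple of 2^-j of the
   iterate [u j.+1]: the former by one contraction step, the latter by the rate of convergence. *)
have GZ : G = Z.
  rewrite funeqE => s; apply/subr0_eq/eqP; rewrite -normr_le0.
  apply: (cvg0 (K * (L * B / b) * e s + B * e s)) => j.
  rewrite -(subrKA (u j.+1 s)).
  rewrite (le_trans (ler_normD _ _))// mulrDl lerD//; last first.
    rewrite (le_trans (hZ _ _))// ler_wpM2l//.
      by rewrite !mulr_ge0 ?expR_ge0// ?invr_ge0 ltW.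
    by rewrite lef_pV2 ?posrE ?exprn_gt0// ler_eXn2l// ltr1n.
  have -> : K * (L * B / b) * e s / 2 ^+ j = K * (L * (B / 2 ^+ j) / b) * e s.
    by rewrite /b; field; rewrite p2 Kn Ln.
  apply: (hK (G - u j.+1) (fun s => f s (Z s) - f s (u j s))) => //.
  - by rewrite !mulr_ge0// ?invr_ge0 ?exprn_ge0// ltW.
  - by rewrite -[LHS]/(G 0 - u _ 0) u0 G0 subrr.
  - move=> t; rewrite (le_trans (lf0 _ _ _))// -[leRHS]mulrA ler_pM2l// distrC.
    by rewrite (le_trans (hZ _ t))// mulrAC.
by exists G; split => // s; rewrite {2}GZ.
Unshelve. all: by end_near. Qed.

End Picard.

(** * Gronwall's inequality *)

Section Gronwall.
Context {R : realType}.
Implicit Types (V W : normedModType R).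

Lemma sqr_sum_le (I : finType) (x : I -> R) :
  (\sum_i x i) ^+ 2 <= #|I|%:R * \sum_i x i ^+ 2.
Proof.
rewrite expr2 mulr_suml.
apply: (@le_trans _ _ (\sum_i \sum_j (x i ^+ 2 + x j ^+ 2) / 2)).
  apply: ler_sum => i _; rewrite mulr_sumr; apply: ler_sum => j _.
  by have := sqr_ge0 (x i - x j); rewrite sqrrB; lra.
under eq_bigr => i _ do rewrite -mulr_suml big_split/= sumr_const.
rewrite -mulr_suml big_split/= sumr_const sumrMnl mulr_natl.
set A := (\sum_i _) *+ _; lra.
Qed.

(** As the interval has length at most 1, [K] depends on [L] and the space only. The bound is linear
    in [eta]: a forcing term of second order gives an error of second order, which is what
    differentiability in the parameter requires. *)
Lemma gronwall V (cV : coordinates V) (L : R) : 0 <= L ->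
  exists2 K : R, 0 < K & forall (d dd : R -> V) (a b eta : R),
  a <= b -> b <= a + 1 -> 0 <= eta ->
  {within `[a, b], continuous d} ->
  (forall x : R, a < x < b -> is_derive x 1 d (dd x)) ->
  (forall x : R, a < x < b -> `|dd x| <= L * `|d x| + eta) ->
  `|d b| <= K * (`|d a| + eta).
Proof.
move=> L0.
have [C C0 hC] := norm_le_cfun cV.
have [D D0 hD] := cfun_bounded cV.
(* The norm of V need not be differentiable: the estimate is made on N. *)
pose N (v : V) := \sum_i (cfun cV i v : R) ^+ 2.
have N0 v : 0 <= N v by rewrite sumr_ge0// => i _; rewrite sqr_ge0.
pose m : R := 1 + #|cindex cV|%:R.
have m1 : 1 <= m by rewrite lerDl.
have NV v : `|v| ^+ 2 <= C ^+ 2 * m * N v.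
  rewrite (@le_trans _ _ ((C * \sum_i `|cfun cV i v|) ^+ 2))//.
    by rewrite ler_sqr ?nnegrE// mulr_ge0// ?sumr_ge0// ltW.
  rewrite exprMn -mulrA ler_pM2l ?exprn_gt0// (le_trans (sqr_sum_le _))//.
  under eq_bigr do rewrite real_normK ?num_real//.
  by rewrite -/(N v) ler_wpM2r// lerDr.
have VN v : N v <= D ^+ 2 * `|v| ^+ 2.
  rewrite -exprMn (@le_trans _ _ ((\sum_i `|cfun cV i v|) ^+ 2))//; last first.
    by rewrite ler_sqr ?nnegrE ?hD// ?sumr_ge0// mulr_ge0// ltW.
  rewrite expr2 mulr_suml; apply: ler_sum => i _.
  rewrite -real_normK ?num_real// expr2 ler_wpM2l//.
  by rewrite (bigD1 i)//= lerDl sumr_ge0.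
(* [L'] and [eta'] come from (L|d| + eta)^2 <= 2 L^2 |d|^2 + 2 eta^2, with [VN] and [NV] converting
   between the squared norm and [N]. *)
pose L' := 2 * D ^+ 2 * L ^+ 2 * (C ^+ 2 * m).
have L'0 : 0 <= L' by rewrite !mulr_ge0 ?exprn_ge0// ?(ltW C0)// ?(ltW D0)// (le_trans _ m1).
pose G := C ^+ 2 * m * (expR (1 + L') * (2 * D ^+ 2)).
have G0 : 0 <= G.
  by rewrite !mulr_ge0 ?expR_ge0 ?exprn_ge0// ?(ltW C0)// ?(ltW D0)// (le_trans _ m1).
exists (1 + G); first by rewrite ltr_pwDl.
move=> d dd a b eta ab ba eta0 cd Dd hd.
pose eta' := 2 * D ^+ 2 * eta ^+ 2.
have eta'0 : 0 <= eta' by rewrite !mulr_ge0 ?exprn_ge0// ltW.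
have hN x : a < x < b -> N (dd x) <= L' * N (d x) + eta'.
  move=> xab; rewrite (le_trans (VN _))//.
  have h : `|dd x| ^+ 2 <= (L * `|d x| + eta) ^+ 2.
    by rewrite ler_sqr ?nnegrE ?hd// addr_ge0// mulr_ge0.
  have h2 : (L * `|d x| + eta) ^+ 2 <= 2 * L ^+ 2 * (C ^+ 2 * m * N (d x)) + 2 * eta ^+ 2.
    have := sqr_ge0 (L * `|d x| - eta).
    have := ler_wpM2l (exprn_ge0 2 L0) (NV (d x)).
    by rewrite sqrrB sqrrD !exprMn; lra.
  have := ler_wpM2l (exprn_ge0 2 (ltW D0)) (le_trans h h2).
  by move=> /le_trans; apply; apply: le_of_eq; rewrite /L' /eta'; ring.
have DN (x : R) : a < x < b -> is_derive x 1 (N \o d)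
    (\sum_i 2 * (cfun cV i (d x) : R) * (cfun cV i (dd x) : R)).
  move=> xab; rewrite /N /comp.
  elim: (index_enum _) => [|i s IH].
    rewrite big_nil (_ : (fun _ => _) = cst 0); first exact: is_derive_cst.
    by rewrite funeqE => y; rewrite big_nil.
  rewrite big_cons (_ : (fun _ => _) = (fun y => (cfun cV i (d y) : R) ^+ 2) \+
      (fun y => \sum_(i <- s) (cfun cV i (d y) : R) ^+ 2)); last first.
    by rewrite funeqE => y; rewrite big_cons.
  apply: is_deriveD.
  have := is_derive_postlin (@cfun_continuous _ _ cV i) (Dd x xab).
  rewrite /comp => Di; have := is_deriveX 2 Di.
  by rewrite /GRing.scale/= expr1 -mulr_natl.
(* The derivative of [N \o d] is at most N d + N dd <= (1 + L') N d + eta'. The exponential factor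
   absorbs the first term and the subtracted linear term the second, so [h] is nonincreasing. *)
pose h (x : R) := expR (- (1 + L') * (x - a)) * N (d x) - eta' * (x - a).
have Dh (x : R) : a < x < b -> is_derive x 1 h
   (expR (- (1 + L') * (x - a)) * (- (1 + L') * N (d x) +
     \sum_i 2 * (cfun cV i (d x) : R) * (cfun cV i (dd x) : R)) - eta').
  move=> xab; have DNx := DN x xab.
  have D1 k : is_derive x 1 (fun y => k * (y - a)) k.
    have := @is_derive_affine _ _ k (- k * a) x id 1 (is_derive_id _ _).
    rewrite /GRing.scale/= mulr1; rewrite (_ : (fun _ => _) = (fun y => k * (y - a)))//.
    by rewrite funeqE => y; ring.
  have D2 := @is_derive1_comp _ expR (fun y => - (1 + L') * (y - a)) x _ _ (is_derive_expR _) (D1 _).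
  have := is_deriveB (is_deriveM D2 DNx) (D1 eta').
  rewrite /h; congr is_derive; rewrite /GRing.scale/=; congr (_ - _); ring.
have hba : h b <= h a.
  have ch : {within `[a, b], continuous h}.
    have cN : continuous N.
      move=> v; have : Ck_on 0 setT N; last by apply.
      apply: Ck_on_sum => [|i _]; first exact: openT.
      apply: (@Ck_on_eq _ _ _ 0 setT (fun v => (cfun cV i v : R) *: (cfun cV i v : R))).
      - exact: openT.
      - by move=> y _; rewrite expr2.
      - by apply: Ck_on_scale => [|y _|y _]; [exact: openT|exact: cfun_continuous|exact: cfun_continuous].
    have cl k : continuous (fun y : R => k * (y - a)).
      by move=> y; apply: cvgMr; apply: cvgB; [exact: cvg_id|exact: cvg_cst].
    have cE : continuous (fun y : R => expR (- (1 + L') * (y - a))).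
      by move=> y; apply: continuous_comp; [exact: cl|exact: continuous_expR].
    have cE' := continuous_subspaceT (A := `[a, b]) cE.
    have cl' := continuous_subspaceT (A := `[a, b]) (cl eta').
    move=> x; apply: (cvgB (f := fun y : subspace `[a, b] => expR (- (1 + L') * (y - a)) * N (d y))
      (g := fun y : subspace `[a, b] => eta' * (y - a))).
      apply: (cvgM (f := fun y : subspace `[a, b] => expR (- (1 + L') * (y - a)))
        (g := fun y : subspace `[a, b] => N (d y))).
        exact: (cE' x).
      exact: (continuous_comp (cd x) (cN (d x))).
    exact: (cl' x).
  apply: (@ler0_derive1_le_cc _ h a b _ _ ch b a) (ab).
  - by move=> x; rewrite in_itv/= => xab; have [] := Dh x xab.
  - move=> x; rewrite in_itv/= => xab; rewrite derive1E; have [_ ->] := Dh x xab.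
    have xa : 0 <= x - a by case/andP: xab; lra.
    have E1 : expR (- (1 + L') * (x - a)) <= 1.
      by rewrite -expR0 ler_expR mulNr oppr_le0 mulr_ge0// addr_ge0.
    have h1 : - (1 + L') * N (d x) + \sum_i 2 * (cfun cV i (d x) : R) * (cfun cV i (dd x) : R) <= eta'.
      have := hN x xab.
      have : \sum_i 2 * (cfun cV i (d x) : R) * (cfun cV i (dd x) : R) <= N (d x) + N (dd x).
        rewrite -big_split/=; apply: ler_sum => i _.
        by have := sqr_ge0 ((cfun cV i (d x) : R) - cfun cV i (dd x)); rewrite sqrrB; lra.
      lra.
    rewrite subr_le0 (le_trans (ler_wpM2l (expR_ge0 _) h1))//.
    by rewrite ler_piMl.
  - by rewrite in_itv/= lexx ab.
  - by rewrite in_itv/= lexx ab.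
have key : N (d b) <= expR (1 + L') * (N (d a) + eta').
  move: hba; rewrite /h subrr !mulr0 expR0 mul1r subr0 => hba.
  have h1 : expR (- (1 + L')) * N (d b) <= N (d a) + eta'.
    have ba0 : 0 <= b - a <= 1 by lra.
    have h2 : expR (- (1 + L')) <= expR (- (1 + L') * (b - a)).
      rewrite ler_expR -[leLHS]mulr1 ler_nM2l; first by case/andP: ba0.
      by rewrite oppr_lt0 ltr_pwDl.
    have := ler_wpM2r (N0 (d b)) h2.
    have : eta' * (b - a) <= eta' by rewrite ler_piMr//; case/andP: ba0.
    lra.
  rewrite -(ler_pM2l (expR_gt0 (- (1 + L')))) mulrA -expRD addNr expR0 mul1r.
  exact: h1.
have : `|d b| ^+ 2 <= G * (`|d a| + eta) ^+ 2.
  rewrite (le_trans (NV _))// /G -[leRHS]mulrA ler_wpM2l//.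
    by rewrite !mulr_ge0 ?exprn_ge0// ?(ltW C0)// (le_trans _ m1).
  rewrite (le_trans key)// -[leRHS]mulrA ler_wpM2l ?expR_ge0// /eta' .
  have := VN (d a); have : 0 <= D ^+ 2 * (`|d a| * eta) by rewrite !mulr_ge0 ?exprn_ge0// ltW.
  have : 0 <= D ^+ 2 * `|d a| ^+ 2 by rewrite !mulr_ge0 ?exprn_ge0// ltW.
  rewrite sqrrD; lra.
(* The estimate is on squares; replacing [G] by a perfect square that dominates it avoids a square
   root in the constant. *)
have GG : G <= (1 + G) ^+ 2 by rewrite sqrrD; have := sqr_ge0 G; lra.
move=> /le_trans /(_ (ler_wpM2r (sqr_ge0 _) GG)).
rewrite -exprMn ler_sqr ?nnegrE// mulr_ge0// addr_ge0//.
Qed.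

End Gronwall.

(** * Smooth dependence on a parameter *)

Section CompactBounds.
Context {R : realType}.
Implicit Types (V W : normedModType R).

Definition is_convex V (K : set V) := forall z z' (s : R),
  K z -> K z' -> 0 <= s <= 1 -> K (z + s *: (z' - z)).

Lemma is_derive_comp V W (X : V -> W) (g : R -> V) (s : R) (dg : V) :
  differentiable X (g s) -> is_derive s 1 g dg ->
  is_derive s 1 (fun t => X (g t)) ('D_dg X (g s)).
Proof.
move=> dX [/derivable1_diffP dg' <-].
have dc := differentiable_comp dg' dX.
apply: DeriveDef; first exact/derivable1_diffP.
by rewrite (deriveE _ dc) (diff_comp dg' dX)/= (deriveE _ dX) (deriveE _ dg').
Qed.

Lemma is_derive_pair V W (f : R -> V) (g : R -> W) (s : R) (df : V) (dg : W) :
  is_derive s 1 f df -> is_derive s 1 g dg -> is_derive s 1 (fun t => (f t, g t)) (df, dg).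
Proof.
move=> [/derivable1_diffP df' <-] [/derivable1_diffP dg' <-].
have dp := differentiable_pair df' dg'.
apply: DeriveDef; first exact/derivable1_diffP.
by rewrite (deriveE _ dp) (diff_pair df' dg') (deriveE _ df') (deriveE _ dg').
Qed.

Lemma is_derive_segment V (z v : V) (s : R) : is_derive s 1 (fun t => z + t *: v) v.
Proof.
have lZ : linear (fun r : R^o => r *: v) by move=> a u w; rewrite scalerDl scalerA.
have cZ : continuous (linear_map lZ).
  by move=> y; apply: cvgZr_tmp; exact: cvg_id.
have D1 := is_derive_postlin (l := linear_map lZ) (x := s) cZ (is_derive_id _ _).
rewrite /comp/= scale1r in D1.
by have := is_deriveD (is_derive_cst z s 1) D1; rewrite add0r.
Qed.

Lemma continuous_bounded V W (K : set V) (f : V -> W) :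
  compact K -> (forall z, K z -> {for z, continuous f}) ->
  exists2 B : R, 0 < B & forall z, K z -> `|f z| <= B.
Proof.
move=> cK cf.
have : compact (f @` K).
  apply: continuous_compact => //; apply: continuous_in_subspaceT => z /[!inE] Kz.
  exact: cf.
move=> /compact_bounded[M [_ hM]]; exists (1 + `|M|); first by rewrite ltr_pwDl.
move=> z Kz; apply: (hM (1 + `|M|)); last by exists z.
by rewrite (le_lt_trans (ler_norm M))// ltrDr.
Qed.

Lemma derivative_bounded V W (cV : coordinates V) (U K : set V) (X : V -> W) :
  compact K -> K `<=` U -> Ck_on 1 U X ->
  exists2 L : R, 0 < L & forall z v, K z -> `|'D_v X z| <= L * `|v|.
Proof.
move=> cK KU [dX DX].
have h i : exists B : R, 0 < B /\ forall z, K z -> `|'D_(cvec cV i) X z| <= B.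
  have [B B0 hB] := continuous_bounded cK (fun z Kz => DX (cvec cV i) z (KU _ Kz)).
  by exists B.
have [B hB] := choice h.
have [D D0 hD] := cfun_bounded cV.
have SB0 : 0 <= \sum_i B i by rewrite sumr_ge0// => i _; rewrite ltW// (hB i).1.
exists (D * (1 + \sum_i B i)); first by rewrite mulr_gt0// ltr_pwDl.
move=> z v Kz; rewrite (derive_cfun cV _ (dX _ (KU _ Kz))).
rewrite (le_trans (ler_norm_sum _ _ _))//.
rewrite (@le_trans _ _ ((\sum_i `|cfun cV i v|) * (1 + \sum_i B i)))//.
  rewrite mulr_suml; apply: ler_sum => i _; rewrite normrZ ler_wpM2l//.
  rewrite (le_trans ((hB i).2 _ Kz))// (bigD1 i)//= addrCA lerDl addr_ge0// sumr_ge0//.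
  by move=> j _; rewrite ltW// (hB j).1.
by rewrite [leRHS]mulrAC ler_wpM2r// addr_ge0.
Qed.

Lemma lipschitz_on_compact V W (cV : coordinates V) (cW : coordinates W)
    (U K : set V) (X : V -> W) :
  compact K -> is_convex K -> K `<=` U -> Ck_on 1 U X ->
  exists2 L : R, 0 < L & forall z z', K z -> K z' -> `|X z' - X z| <= L * `|z' - z|.
Proof.
move=> cK vK KU kX.
have [L L0 hL] := derivative_bounded cV cK KU kX.
have [C C0 hC] := le_increment_vec cW.
exists (C * L); first exact: mulr_gt0.
move=> z z' Kz Kz'; set v := z' - z.
have Kp (s : R) : 0 <= s <= 1 -> K (z + s *: v) by exact: vK.
have Dg (s : R) : 0 <= s <= 1 -> is_derive s 1 (fun t => X (z + t *: v)) ('D_v X (z + s *: v)).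
  move=> s01; apply: is_derive_comp; last exact: is_derive_segment.
  exact: kX.1 (KU _ (Kp _ s01)).
have Dh (s : R) : is_derive s 1 (fun t : R => 0 + t *: (L * `|v|)) (L * `|v|) by exact: is_derive_segment.
have zv : z + v = z' by rewrite addrC subrK.
have := hC (fun t => X (z + t *: v)) (fun s => 'D_v X (z + s *: v)) _ (fun=> L * `|v|) 0 1 ler01 _ _ _ (fun s _ => Dh s) _.
rewrite /= !scale1r !scale0r !addr0 !add0r zv subr0 mulrA; apply.
- apply: continuous_in_subspaceT => s; rewrite inE/= in_itv/= => s01.
  exact: is_derive_continuous (Dg s s01).
- by apply: continuous_subspaceT => s; exact: is_derive_continuous (Dh s).
- by move=> s /andP[s0 s1]; apply: Dg; rewrite !ltW.
- by move=> s /andP[s0 s1]; apply: hL; apply: Kp; rewrite !ltW.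
Qed.

(** The mean value inequality is applied on the segment to t |-> X (z + t v) - t D_v X z, whose
    derivative is small because the basis derivatives of [X] are Lipschitz on [K]. *)
Lemma taylor_on_compact V W (cV : coordinates V) (cW : coordinates W)
    (U K : set V) (X : V -> W) :
  compact K -> is_convex K -> K `<=` U -> Ck_on 2 U X ->
  exists2 L : R, 0 < L & forall z z', K z -> K z' ->
    `|X z' - X z - 'D_(z' - z) X z| <= L * `|z' - z| ^+ 2.
Proof.
move=> cK vK KU [dX kX].
have h i : exists B : R, 0 < B /\ forall z z', K z -> K z' ->
    `|'D_(cvec cV i) X z' - 'D_(cvec cV i) X z| <= B * `|z' - z|.
  have [B B0 hB] := lipschitz_on_compact cV cW cK vK KU (kX (cvec cV i)).
  by exists B.
have [B hB] := choice h.
have [D D0 hD] := cfun_bounded cV.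
have SB0 : 0 <= \sum_i B i by rewrite sumr_ge0// => i _; rewrite ltW// (hB i).1.
have [C C0 hC] := le_increment_vec cW.
pose L := D * (1 + \sum_i B i).
have L0 : 0 < L by rewrite mulr_gt0// ltr_pwDl.
exists (C * L); first exact: mulr_gt0.
move=> z z' Kz Kz'; set v := z' - z.
have Kp (s : R) : 0 <= s <= 1 -> K (z + s *: v) by exact: vK.
have DD y y' : K y -> K y' -> `|'D_v X y' - 'D_v X y| <= L * `|v| * `|y' - y|.
  move=> Ky Ky'; rewrite (derive_cfun cV _ (dX _ (KU _ Ky))) (derive_cfun cV _ (dX _ (KU _ Ky'))).
  rewrite -sumrB (le_trans (ler_norm_sum _ _ _))//.
  rewrite (@le_trans _ _ ((\sum_i `|cfun cV i v|) * ((1 + \sum_i B i) * `|y' - y|)))//.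
    rewrite mulr_suml; apply: ler_sum => i _; rewrite -scalerBr normrZ ler_wpM2l//.
    rewrite (le_trans ((hB i).2 _ _ Ky Ky'))// ler_wpM2r// (bigD1 i)//= addrCA lerDl addr_ge0// sumr_ge0//.
    by move=> j _; rewrite ltW// (hB j).1.
  rewrite mulrA ler_wpM2r// /L [leRHS]mulrAC ler_wpM2r//.
  by rewrite addr_ge0.
have Dg (s : R) : 0 <= s <= 1 -> is_derive s 1 (fun t => X (z + t *: v) - (0 + t *: 'D_v X z)) ('D_v X (z + s *: v) - 'D_v X z).
  move=> s01; apply: is_deriveB; last exact: is_derive_segment.
  apply: is_derive_comp; last exact: is_derive_segment.
  exact: dX (KU _ (Kp _ s01)).
have Dh (s : R) : is_derive s 1 (fun t : R => 0 + t *: (L * `|v| ^+ 2)) (L * `|v| ^+ 2) by exact: is_derive_segment.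
have zv : z + v = z' by rewrite addrC subrK.
have := hC (fun t => X (z + t *: v) - (0 + t *: 'D_v X z)) (fun s => 'D_v X (z + s *: v) - 'D_v X z) _ (fun=> L * `|v| ^+ 2) 0 1 ler01 _ _ _ (fun s _ => Dh s) _.
rewrite /= !scale1r !scale0r !addr0 !add0r zv !subr0 mulrA addrAC; apply.
- apply: continuous_in_subspaceT => s; rewrite inE/= in_itv/= => s01.
  exact: is_derive_continuous (Dg s s01).
- by apply: continuous_subspaceT => s; exact: is_derive_continuous (Dh s).
- by move=> s /andP[s0 s1]; apply: Dg; rewrite !ltW.
- move=> s /andP[s0 s1]; rewrite (le_trans (DD _ _ Kz (Kp s _)))//; first by rewrite !ltW.
  rewrite [z + _]addrC addrK normrZ expr2 [leRHS]mulrA ler_wpM2l//.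
    by rewrite mulr_ge0// ltW.
  by rewrite ler_piMl// gtr0_norm// ltW.
Qed.

End CompactBounds.

(** * Differentiating a flow in the time parameter *)

Section FlowFamily.
Context {R : realType}.
Implicit Types (V W : normedModType R).

Lemma scaler_linear V (l : V) : linear (fun r : R^o => r *: l).
Proof. by move=> a u w; rewrite scalerDl scalerA. Qed.

(** The form in which a Gronwall estimate between two members of a family yields a derivative. *)
Lemma is_derive_leP V (f : R -> V) (x : R) (l : V) : is_derive x 1 f l <->
  forall eps, 0 < eps -> \forall h \near x, `|f h - f x - (h - x) *: l| <= eps * `|h - x|.
Proof.
split.
  move=> [/derivable1_diffP df <-] eps eps0.
  have [_ /eqaddoP /(_ _ eps0) H] := (diff_locallyP x f).1 df.
  have : \forall y \near (0 : R),
    `|(f \o shift x - (cst (f x) + 'd f x)) y| <= eps * `|y| by exact: H.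
  rewrite (near_shift x (0 : R)); apply: filterS => h /=.
  rewrite sub0r !fctE/= subrK opprD addrA => /(le_trans _); apply.
  apply: le_of_eq; congr `|_ - _|.
  by rewrite (deriveE _ df) -(linearZ_LR ('d f x)); congr ('d f x _); rewrite /GRing.scale/= mulr1.
move=> H; pose df := linear_map (@scaler_linear V l).
have dc : continuous df by move=> y; apply: cvgZr_tmp; exact: cvg_id.
have E : f \o shift x = cst (f x) + df +o_ (0 : R) id.
  apply/eqaddoP => eps eps0; have := H eps eps0.
  rewrite (near_shift (0 : R) x); apply: filterS => h /=.
  by rewrite subr0 !fctE/= opprD addrA addrK.
have E' : 'd f x = df :> (R -> V) by apply: (diff_unique dc E).
have dfx : differentiable f x by apply/diff_locallyP; rewrite E'.
apply: DeriveDef; first exact/derivable1_diffP.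
by rewrite (deriveE _ dfx) [LHS](congr1 (@^~ 1) E')/= scale1r.
Qed.

Lemma is_derive_scaler V (a : R -> R) (b : R -> V) (x da : R) (db : V) :
  is_derive x 1 a da -> is_derive x 1 b db ->
  is_derive x 1 (fun s => a s *: b s) (a x *: db + da *: b x).
Proof.
move=> [/derivable1_diffP Da <-] [/derivable1_diffP Db <-].
have D := is_diff_scale Da Db.
apply: DeriveDef; first by apply/derivable1_diffP; case: D.
by rewrite (eq_diff_derive _ D) (deriveE _ Da) (deriveE _ Db).
Qed.

(** Freezing the time outside [0, 1] extends a field known along a curve on [0, 1] to all times, as
    [picard] requires. *)
Definition clamp (s : R) : R := Num.max 0 (Num.min s 1).

Lemma clamp_id s : 0 <= s <= 1 -> clamp s = s.
Proof. by move=> /andP[s0 s1]; rewrite /clamp (min_idPl s1) (max_idPr s0). Qed.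

Lemma clamp01 s : 0 <= clamp s <= 1.
Proof. by rewrite /clamp le_max lexx/= ge_max ler01 ge_min lexx orbT. Qed.

Lemma continuous_clamp : continuous clamp.
Proof.
move=> s.
have h0 : {for s, continuous (cst (0 : R) : R -> R)} by exact: cst_continuous.
have h1 : {for s, continuous (cst (1 : R) : R -> R)} by exact: cst_continuous.
have hid : {for s, continuous (id : R -> R)} by exact: cvg_id.
have h2 : {for s, continuous ((id : R -> R) \min cst 1)} by apply: continuous_min.
have : {for s, continuous ((cst 0 : R -> R) \max ((id : R -> R) \min cst 1))}.
  by apply: continuous_max.
by [].
Qed.

(** The equation is linear in the unknown and its coefficients are bounded along the compact set
    [K], so the field is globally Lipschitz once the time is clamped. *)
Lemma variational_solution V (cV : coordinates V) (U K : set V) (X : V -> V)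
   (Z : R -> V) (e : R) (w : V) :
  compact K -> K `<=` U -> Ck_on 1 U X -> continuous Z ->
  (forall s, 0 <= s <= 1 -> K (Z s)) ->
  exists om : R -> V, [/\ om 0 = w, continuous om &
    forall s : R, 0 < s < 1 -> is_derive s 1 om (e *: 'D_(om s) X (Z s))].
Proof.
move=> cK KU kX cZ ZK.
have [L L0 hL] := derivative_bounded cV cK KU kX.
have ZK' s : K (Z (clamp s)) by apply: ZK; exact: clamp01.
have dX s : differentiable X (Z (clamp s)) by apply: kX.1; exact: KU.
have [|||om [om0 Dom]] := @picard _ V cV (fun s w => e *: 'D_w X (Z (clamp s))) w (`|e| * L) (`|e| * (L * `|w|)).
- move=> z s; apply: cvgZl_tmp.
  apply: (continuous_comp (f := Z \o clamp) (g := 'D_z X)).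
    by apply: continuous_comp; [exact: continuous_clamp|exact: cZ].
  exact: kX.2 (KU _ (ZK' s)).
- move=> s z z'; rewrite -scalerBr normrZ -mulrA ler_wpM2l//.
  rewrite (_ : _ - _ = 'D_(z - z') X (Z (clamp s))); first exact: hL.
  by rewrite !(deriveE _ (dX s)) linearB.
- by move=> s; rewrite normrZ ler_wpM2l// hL.
exists om; split => //.
  by move=> s; exact: is_derive_continuous (Dom s).
by move=> s /andP[s0 s1]; have := Dom s; rewrite clamp_id// !ltW.
Qed.

(* Z e is the integral curve of e *: X starting at z0 e, so that Z e 1 is the
   flow of X for the time e applied to z0 e. *)
Record flow_family V (U : set V) (X : V -> V) (J : set R) (z0 : R -> V)
    (Z : R -> R -> V) : Prop := FlowFamily {
  ff_start : forall e, J e -> Z e 0 = z0 e;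
  ff_continuous : forall e, J e -> continuous (Z e);
  ff_derive : forall e s : R, J e -> 0 < s < 1 -> is_derive s 1 (Z e) (e *: X (Z e s));
  ff_compact : forall e, J e -> exists K : set V, [/\ compact K, is_convex K, K `<=` U &
    \forall h \near e, forall s, 0 <= s <= 1 -> K (Z h s)]
}.

(** The difference Z h - Z e, corrected by h - e times the expected derivative, satisfies a linear
    differential inequality with forcing of order |h - e|^2, so Gronwall bounds it. The pair (Z, om)
    is again a flow family, which makes the lemma iterable. *)
Lemma flow_family_derive V (cV : coordinates V) (U : set V) (X : V -> V) (J : set R)
   (z0 : R -> V) (Z : R -> R -> V) :
  open U -> Ck_on 2 U X -> open J -> Ck_on 1 J z0 -> flow_family U X J z0 Z ->
  exists om : R -> R -> V,
    flow_family (U `*` setT) (tangent_map X) J (fun e => (z0 e, 'D_1 z0 e))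
      (fun e s => (Z e s, om e s)) /\
    forall e : R, J e -> is_derive e 1 (fun h => Z h 1) (X (Z e 1) + om e 1).
Proof.
move=> oU kX oJ kz fZ.
have kX1 := Ck_onW kX.
have om_ex e : exists om : R -> V, J e -> [/\ om 0 = 'D_1 z0 e, continuous om &
    forall s : R, 0 < s < 1 -> is_derive s 1 om (e *: 'D_(om s) X (Z e s))].
  have [Je|nJe] := pselect (J e); last by exists (cst 0).
  have [K [cK _ KU /nbhs_singleton hK]] := ff_compact fZ Je.
  have [om hom] := variational_solution cV e ('D_1 z0 e) cK KU kX1 (ff_continuous fZ Je) hK.
  by exists om.
have [om hom] := choice om_ex.
have JE (e : R) : J e -> \forall h \near e, J h /\ `|h| <= `|e| + 1.
  move=> Je; near=> h; split; near: h; first exact: open_nbhs_nbhs.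
  by have := @norm_continuous _ _ e => /cvgr_le; apply; rewrite ltrDl.
have cZ1 h s : J h -> 0 <= s -> {within `[0, s], continuous (Z h)}.
  by move=> Jh s0; apply: continuous_subspaceT; exact: (ff_continuous fZ Jh).
have com h s : J h -> 0 <= s -> {within `[0, s], continuous (om h)}.
  by move=> Jh s0; apply: continuous_subspaceT; have [] := hom _ Jh.
exists om; split.
  split.
  - by move=> e Je; rewrite (ff_start fZ Je); have [->] := hom _ Je.
  - move=> e Je s; apply: cvg_pair; first exact: (ff_continuous fZ Je).
    by have [_ h _] := hom _ Je; exact: h.
  - move=> e s Je s01; apply: is_derive_pair; first exact: (ff_derive fZ Je s01).
    by have [_ _ h] := hom _ Je; exact: h.
  move=> e Je; have [K [cK vK KU hK]] := ff_compact fZ Je.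
  have [L L0 hL] := derivative_bounded cV cK KU kX1.
  have E0 : 0 <= (`|e| + 1) * L by rewrite mulr_ge0 ?addr_ge0// ltW.
  have [G G0 hG] := gronwall cV E0.
  (* Gronwall with no forcing bounds [om h] by [G] times its initial value, and continuity of
     ['D_1 z0] bounds the latter for [h] near [e]; the added 1 is the margin. *)
  exists (K `*` [set w | `|w| <= G * (`|'D_1 z0 e| + 1)]); split.
  - by apply: compact_setX => //; exact: cball_compact.
  - move=> [a b] [a' b'] s [/= Ka hb] [/= Ka' hb'] s01; split; first exact: vK.
    rewrite /= (_ : b + s *: (b' - b) = (1 - s) *: b + s *: b'); last first.
      by rewrite scalerBr scalerBl scale1r addrA addrAC.
    rewrite (le_trans (ler_normD _ _))// !normrZ; case/andP: s01 => s0 s1.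
    rewrite (ger0_norm s0) ger0_norm ?subr_ge0//.
    have := ler_wpM2l s0 hb'; have : (1 - s) * `|b| <= (1 - s) * (G * (`|'D_1 z0 e| + 1)).
      by rewrite ler_wpM2l ?subr_ge0.
    lra.
  - by move=> [a b] [/= /KU].
  have cz : {for e, continuous (fun h => `|'D_1 z0 h|)}.
    by apply: continuous_comp; [exact: kz.2|exact: norm_continuous].
  have nz : \forall h \near e, `|'D_1 z0 h| <= `|'D_1 z0 e| + 1.
    by move/cvgr_le: cz; apply; rewrite ltrDl.
  near=> h => s /andP[s0 s1].
  have hKh : forall s, 0 <= s <= 1 -> K (Z h s) by near: h.
  have [Jh hE] : J h /\ `|h| <= `|e| + 1 by near: h; exact: JE.
  have nzh : `|'D_1 z0 h| <= `|'D_1 z0 e| + 1 by near: h.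
  split; first by apply: hKh; rewrite s0.
  have [om0 com' Dom] := hom _ Jh.
  have s1' : s <= 0 + 1 by rewrite add0r.
  have D1 (x : R) : 0 < x < s -> is_derive x 1 (om h) (h *: 'D_(om h x) X (Z h x)).
    by move=> /andP[x0 xs]; apply: Dom; rewrite x0 (lt_le_trans xs).
  have D2 x : 0 < x < s ->
      `|h *: 'D_(om h x) X (Z h x)| <= (`|e| + 1) * L * `|om h x| + 0.
    move=> /andP[x0 xs]; rewrite addr0 normrZ -mulrA.
    apply: ler_pM => //; apply: hL; apply: hKh.
    by rewrite ltW// (le_trans (ltW xs)).
  have := hG _ _ _ _ _ s0 s1' (lexx 0) (com _ _ Jh s0) D1 D2.
  by rewrite addr0 om0 => /le_trans; apply; rewrite ler_pM2l.
move=> e Je; have [K [cK vK KU hK]] := ff_compact fZ Je.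
have [L1 L10 hL1] := derivative_bounded cV cK KU kX1.
have [L2 L20 hL2] := lipschitz_on_compact cV cV cK vK KU kX1.
have [C C0 hC] := taylor_on_compact cV cV cK vK KU kX.
have [M M0 hM] : exists2 B : R, 0 < B & forall z, K z -> `|X z| <= B.
  apply: continuous_bounded => // z Kz; exact: (Ck_onW kX1) z (KU _ Kz).
pose E : R := `|e| + 1; have E0 : 0 <= E by rewrite addr_ge0.
pose L := L1 + L2; have L0 : 0 <= L by rewrite addr_ge0// ltW.
have [G G0 hG] := gronwall cV (mulr_ge0 E0 L0).
pose v0 := 'D_1 z0 e.
have Dz : is_derive e 1 z0 v0.
  by apply: DeriveDef => //; apply/derivable1_diffP; exact: kz.1.
have hKe := nbhs_singleton hK.
have [om0 com' Dom] := hom _ Je.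
(* [P] is a Lipschitz constant of Z h s in [h] at [e]: [|v0| + 1] comes from the starting points and
   [M] from the change of the factor of the field. *)
pose P := G * (`|v0| + 1 + M).
have P0 : 0 <= P by rewrite mulr_ge0 ?addr_ge0// ltW.
(* The coefficient of |h - e|^2 in the forcing: the Taylor remainder of [X] and the product of h - e
   with the increment of [X]. *)
pose Q := E * C * P ^+ 2 + L * P.
have Q0 : 0 <= Q.
  by rewrite addr_ge0 ?(mulr_ge0 L0 P0)// mulr_ge0 ?exprn_ge0// mulr_ge0// ltW.
apply/is_derive_leP => eps eps0.
(* [eps1] gives half of the error to the starting points, [eps2] half to the forcing; the 1 in the
   latter guards against a vanishing [Q]. *)
have eps1 : 0 < eps / (2 * G) by rewrite divr_gt0// mulr_gt0.
have eps2 : 0 < eps / (2 * (G * Q + 1)).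
  by rewrite divr_gt0// mulr_gt0// ltr_wpDl// mulr_ge0// ltW.
have n0 : \forall h \near e, `|h - e| <= eps / (2 * (G * Q + 1)).
  have : (fun h => h - e) @ e --> e - e by apply: cvgB; [exact: cvg_id|exact: cvg_cst].
  rewrite subrr => /cvgr0_norm_le; exact.
near=> h.
have hKh : forall s, 0 <= s <= 1 -> K (Z h s) by near: h.
have [Jh hE] : J h /\ `|h| <= E by near: h; exact: JE.
have z1 : `|z0 h - z0 e - (h - e) *: v0| <= 1 * `|h - e|.
  by near: h; move/is_derive_leP: Dz; apply.
have z2 : `|z0 h - z0 e - (h - e) *: v0| <= eps / (2 * G) * `|h - e|.
  by near: h; move/is_derive_leP: Dz; apply.
have he : `|h - e| <= eps / (2 * (G * Q + 1)) by near: h.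
have z3 : `|z0 h - z0 e| <= (`|v0| + 1) * `|h - e|.
  rewrite -[X in `|X|](subrK ((h - e) *: v0)) (le_trans (ler_normD _ _))//.
  by rewrite normrZ mulrDl mul1r addrC [_ * `|v0|]mulrC lerD2l; rewrite mul1r in z1.
have cB (f g : R -> V) s : {within `[0, s], continuous f} -> {within `[0, s], continuous g} ->
    {within `[0, s], continuous (fun s => f s - g s)}.
  by move=> cf cg x; exact: (cvgB (cf x) (cg x)).
have stepA s : 0 <= s <= 1 -> `|Z h s - Z e s| <= P * `|h - e|.
  move=> /andP[s0 s1].
  have s1' : s <= 0 + 1 by rewrite add0r.
  have M1 : 0 <= M * `|h - e| by rewrite mulr_ge0// ltW.
  have D1 (x : R) : 0 < x < s -> is_derive x 1 (fun s => Z h s - Z e s)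
      (h *: X (Z h x) - e *: X (Z e x)).
    move=> /andP[x0 xs]; have x01 : 0 < x < 1 by rewrite x0 (lt_le_trans xs).
    by apply: is_deriveB; [exact: (ff_derive fZ Jh)|exact: (ff_derive fZ Je)].
  have D2 x : 0 < x < s -> `|h *: X (Z h x) - e *: X (Z e x)| <=
      E * L * `|Z h x - Z e x| + M * `|h - e|.
    move=> /andP[x0 xs]; have x01 : 0 <= x <= 1 by rewrite ltW// (le_trans (ltW xs)).
    have -> : h *: X (Z h x) - e *: X (Z e x) =
       h *: (X (Z h x) - X (Z e x)) + (h - e) *: X (Z e x).
      by rewrite scalerBr scalerBl subrKA.
    rewrite (le_trans (ler_normD _ _))// !normrZ lerD//.
      rewrite -mulrA ler_pM// (le_trans (hL2 _ _ (hKe _ x01) (hKh _ x01)))//.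
      by rewrite ler_wpM2r// lerDr ltW.
    by rewrite mulrC ler_wpM2r//; apply: hM; exact: hKe.
  have := hG _ _ _ _ _ s0 s1' M1 (cB _ _ _ (cZ1 _ _ Jh s0) (cZ1 _ _ Je s0)) D1 D2.
  move=> /le_trans; apply; rewrite /P -mulrA ler_pM2l// mulrDl lerD2r.
  by rewrite (ff_start fZ Jh) (ff_start fZ Je).
(* [W] is the expected derivative in the parameter: the first term is the effect of the change of
   time, the second that of the change of starting point. *)
pose W s := s *: X (Z e s) + om e s.
have DW (x : R) : 0 < x < 1 -> is_derive x 1 W (X (Z e x) + e *: 'D_(W x) X (Z e x)).
  move=> x01; have x01' : 0 <= x <= 1 by case/andP: x01 => ? ?; rewrite !ltW.
  have dX : differentiable X (Z e x) by apply: kX1.1; exact: KU (hKe _ x01').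
  have D1 := is_derive_comp dX (ff_derive fZ Je x01).
  have := is_deriveD (is_derive_scaler (is_derive_id x 1) D1) (Dom x x01).
  rewrite scale1r; congr is_derive.
  rewrite /W !(deriveE _ dX) linearD linearZ [in RHS]linearZ/= scalerDr.
  by rewrite [in RHS]scalerA [e * x]mulrC -scalerA addrA [X (Z e x) + _]addrC.
have cW : {within `[0, 1], continuous W}.
  apply: continuous_in_subspaceT => s; rewrite inE/= in_itv/= => s01.
  apply: cvgD; last exact: com'.
  apply: cvgZ; first exact: cvg_id.
  apply: (continuous_comp (f := Z e) (g := X)); first exact: (ff_continuous fZ Je).
  exact: (Ck_onW kX1) _ (KU _ (hKe _ s01)).
have eta0 : 0 <= Q * `|h - e| ^+ 2 by rewrite mulr_ge0 ?exprn_ge0.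
have D1 (x : R) : 0 < x < 1 -> is_derive x 1 (fun s => (Z h s - Z e s) - (h - e) *: W s)
    (h *: X (Z h x) - e *: X (Z e x) - (h - e) *: (X (Z e x) + e *: 'D_(W x) X (Z e x))).
  move=> x01; apply: is_deriveB.
    by apply: is_deriveB; [exact: (ff_derive fZ Jh)|exact: (ff_derive fZ Je)].
  by have DWx := DW x x01; exact: is_deriveZ.
have D2 x : 0 < x < 1 -> `|h *: X (Z h x) - e *: X (Z e x) -
     (h - e) *: (X (Z e x) + e *: 'D_(W x) X (Z e x))| <=
    E * L * `|(Z h x - Z e x) - (h - e) *: W x| + Q * `|h - e| ^+ 2.
  move=> /andP[x0 x1]; have x01 : 0 <= x <= 1 by rewrite !ltW.
  have dX : differentiable X (Z e x) by apply: kX1.1; exact: KU (hKe _ x01).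
  have [Ka Kb] := (hKh _ x01, hKe _ x01).
  (* With r the differential of [X] applied to the difference of the curves, the three terms are the
     Taylor remainder, a linear term in the quantity being estimated, and a product of two
     first-order differences. *)
  have lin3 (p q r w : V) : h *: p - e *: q - (h - e) *: (q + e *: w) =
      e *: (p - q - r) + e *: (r - (h - e) *: w) + (h - e) *: (p - q).
    transitivity (h *: (p - q) - (h - e) *: (e *: w)).
      rewrite scalerDr opprD addrA scalerBr; congr (_ - _).
      by rewrite -addrA -opprD -scalerDl [e + _]addrC subrK.
    rewrite -scalerDr subrKA [e *: (_ - _)]scalerBr addrAC -scalerDl [e + _]addrC subrK.
    by congr (_ - _); rewrite !scalerA mulrC.
  rewrite (lin3 _ _ ('D_(Z h x - Z e x) X (Z e x))).
  have -> : 'D_(Z h x - Z e x) X (Z e x) - (h - e) *: 'D_(W x) X (Z e x) =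
     'D_(Z h x - Z e x - (h - e) *: W x) X (Z e x).
    by rewrite !(deriveE _ dX) -linearZ_LR -linearB.
  have eE : `|e| <= E by rewrite lerDl.
  have LL1 : L1 <= L by rewrite lerDl ltW.
  have LL2 : L2 <= L by rewrite lerDr ltW.
  have t1 : `|e *: (X (Z h x) - X (Z e x) - 'D_(Z h x - Z e x) X (Z e x))| <=
      E * C * P ^+ 2 * `|h - e| ^+ 2.
    rewrite normrZ -[_ * P ^+ 2 * _]mulrA -exprMn -[leRHS]mulrA.
    rewrite ler_pM// (le_trans (hC _ _ Kb Ka))// ler_pM2l//.
    have p0 : 0 <= P * `|h - e| by rewrite mulr_ge0.
    by apply: lerXn2r; [rewrite nnegrE|rewrite nnegrE|exact: stepA].
  have t2 : `|e *: 'D_(Z h x - Z e x - (h - e) *: W x) X (Z e x)| <=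
      E * L * `|Z h x - Z e x - (h - e) *: W x|.
    by rewrite normrZ -mulrA ler_pM// (le_trans (hL1 _ _ Kb))// ler_wpM2r.
  have t3 : `|(h - e) *: (X (Z h x) - X (Z e x))| <= L * P * `|h - e| ^+ 2.
    rewrite normrZ expr2 mulrA mulrC ler_wpM2r// -mulrA (le_trans (hL2 _ _ Kb Ka))//.
    by rewrite ler_pM// ?stepA// ltW.
  rewrite (le_trans (ler_normD _ _))// /Q [(_ + L * P) * _]mulrDl addrA lerD//.
  by rewrite [leRHS]addrC (le_trans (ler_normD _ _))// lerD.
have c1 : {within `[0, 1], continuous (fun s => (Z h s - Z e s) - (h - e) *: W s)}.
  apply: (cB); first exact: (cB _ _ _ (cZ1 _ _ Jh ler01) (cZ1 _ _ Je ler01)).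
  by move=> x; apply: cvgZl_tmp; exact: cW x.
have l01 : 1 <= 0 + 1 :> R by rewrite add0r.
have := hG _ _ _ _ _ ler01 l01 eta0 c1 D1 D2.
rewrite /W !(ff_start fZ Jh, ff_start fZ Je) om0 scale0r add0r scale1r => /le_trans; apply.
have G2 : G * `|z0 h - z0 e - (h - e) *: v0| <= eps / 2 * `|h - e|.
  have := ler_wpM2l (ltW G0) z2; rewrite (_ : G * (_ * _) = eps / 2 * `|h - e|)//.
  by field; exact: lt0r_neq0.
have G3 : G * (Q * `|h - e| ^+ 2) <= eps / 2 * `|h - e|.
  rewrite expr2 !mulrA ler_wpM2r//.
  have h1 := ler_wpM2l (mulr_ge0 (ltW G0) Q0) he.
  rewrite (le_trans h1)//.
  have GQ : 0 <= G * Q by rewrite mulr_ge0// ltW.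
  have GQ1 : 0 < G * Q + 1 by rewrite ltr_wpDl.
  have -> : G * Q * (eps / (2 * (G * Q + 1))) = eps / 2 * (G * Q / (G * Q + 1)).
    by field; exact: lt0r_neq0.
  by rewrite ler_piMr ?divr_ge0 ?ltW// ltr_pdivrMr// mul1r ltrDl.
by rewrite mulrDr; have := splitr eps; lra.
Unshelve. all: by end_near. Qed.

End FlowFamily.

Section FlowSmooth.
Context {R : realType}.
Implicit Types (V W : normedModType R).

(** On the line, the derivative in direction [v] is [v] times the derivative in direction 1. *)
Lemma Ck_on_curve V k (J : set R) (f df : R -> V) : open J ->
  (forall e : R, J e -> is_derive e 1 f (df e)) -> Ck_on k J df -> Ck_on k.+1 J f.
Proof.
move=> oJ Df kdf; have dif e : J e -> differentiable f e.
  by move=> Je; apply/derivable1_diffP; have [] := Df e Je.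
split=> // v; apply: (Ck_on_eq oJ) (_ : Ck_on k J (fun e => cst v e *: df e)).
  move=> e Je; rewrite /= (deriveE _ (dif e Je)).
  have [_ <-] := Df e Je; rewrite (deriveE _ (dif e Je)).
  by rewrite -(linearZ_LR ('d f e)); congr ('d f e _); rewrite /GRing.scale/= mulr1.
by apply: Ck_on_scale => //; exact: Ck_on_cst.
Qed.

Lemma flow_family_in V (U : set V) (X : V -> V) (J : set R) (z0 : R -> V)
   (Z : R -> R -> V) e s : flow_family U X J z0 Z -> J e -> 0 <= s <= 1 -> U (Z e s).
Proof.
move=> fZ Je s01; have [K [_ _ KU /nbhs_singleton h]] := ff_compact fZ Je.
exact: KU (h _ s01).
Qed.

Lemma open_setXT V W (U : set V) : open U -> open (U `*` @setT W).
Proof.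
move=> oU; rewrite (_ : _ `*` _ = fst @^-1` U).
  by apply: open_comp => // x _; exact: continuous_fst.
by apply/seteqP; split=> -[] //= ? ? [].
Qed.

Lemma smooth_on_tangent_map V (cV : coordinates V) (U : set V) (X : V -> V) :
  open U -> smooth_on U X -> smooth_on (U `*` setT) (tangent_map X).
Proof. by move=> oU sX k; apply: Ck_on_tangent_map => //; exact: sX. Qed.

Lemma smooth_on_derive1 V (J : set R) (z : R -> V) : open J -> smooth_on J z ->
  smooth_on J (fun e => (z e, 'D_1 z e)).
Proof.
by move=> oJ sz k; apply: Ck_on_pair oJ (sz k) _; exact: (sz k.+1).2.
Qed.

Lemma flow_family_smooth V (cV : coordinates V) (U : set V) (X : V -> V)
   (J : set R) (z0 : R -> V) (Z : R -> R -> V) :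
  open U -> smooth_on U X -> open J -> smooth_on J z0 -> flow_family U X J z0 Z ->
  smooth_on J (fun e => Z e 1).
Proof.
(* The derivative of Z e 1 in e is X (Z e 1) + om e 1, where (Z, om) is a flow
   family of the tangent map of X. *)
move=> + + + + + k.
elim: k V cV U X z0 Z => [|k IH] V cV U X z0 Z oU sX oJ sz fZ.
  have [om [_ D]] := flow_family_derive cV oU (sX 2) oJ (sz 1) fZ.
  by move=> e Je; exact: is_derive_continuous (D e Je).
have [om [fT D]] := flow_family_derive cV oU (sX 2) oJ (sz 1) fZ.
have kZ := IH _ cV _ _ _ _ oU sX oJ sz fZ.
have kT := IH _ (prod_coordinates cV cV) _ _ _ _ (open_setXT oU)
  (smooth_on_tangent_map cV oU sX) oJ (smooth_on_derive1 oJ sz) fT.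
apply: Ck_on_curve D _ => //; apply: Ck_onD => //.
  apply: (Ck_on_comp cV) (sX k) => // e Je; apply: flow_family_in fZ Je _.
  by rewrite ler01 lexx.
exact: (Ck_on_postlin (l := snd) (@continuous_snd _ _ _) oJ kT).
Qed.

(** Two applications of [flow_family_derive], to Z and then to (Z, om) as a family of the tangent
    map; the derivative of [om] is the second component of the latter. *)
Lemma flow_family_second_order V (cV : coordinates V) (U : set V) (X : V -> V)
   (J : set R) (z0 : R -> V) (Z : R -> R -> V) :
  open U -> smooth_on U X -> open J -> smooth_on J z0 -> flow_family U X J z0 Z ->
  J 0 -> exists om : R -> V,
    [/\ (forall e : R, J e -> is_derive e 1 (fun h => Z h 1) (X (Z e 1) + om e)),
        Z 0 1 = z0 0, om 0 = 'D_1 z0 0 &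
        is_derive (0 : R) 1 om ('D_('D_1 z0 0) X (z0 0) + 'D_1 ('D_1 z0) 0)].
Proof.
move=> oU sX oJ sz fZ J0.
(* At parameter 0 the field is multiplied by 0, so every family is constant there and its value at
   time 1 is its initial value. *)
have const W (U' : set W) (Y : W -> W) z1 Z1 (cW : coordinates W) :
    flow_family U' Y J z1 Z1 -> Z1 0 1 = z1 0.
  move=> f1; have [C C0 hC] := le_increment_vec cW.
  have := hC (Z1 0) (fun s => 0 *: Y (Z1 0 s)) (cst 0) (cst 0) 0 1 ler01 _ _ _ _ _.
  rewrite (ff_start f1 J0) subrr mulr0 => h; apply/subr0_eq/eqP; rewrite -normr_le0; apply: h.
  - by apply: continuous_subspaceT; exact: (ff_continuous f1 J0).
  - by apply: continuous_subspaceT => x; exact: cst_continuous.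
  - by move=> x x01; exact: (ff_derive f1 J0 x01).
  - by move=> x _; rewrite scale0r normr0.
have [om [fT D]] := flow_family_derive cV oU (sX 2) oJ (sz 1) fZ.
have cVV := prod_coordinates cV cV.
have sT := smooth_on_tangent_map cV oU sX.
have sz' := smooth_on_derive1 oJ sz.
have [om2 [fTT D2]] := flow_family_derive cVV (open_setXT oU) (sT 2) oJ (sz' 1) fT.
have Z0 := const _ _ _ _ _ cV fZ.
have [_ om0] := const _ _ _ _ _ cVV fT.
have [_ _ om20] := const _ _ _ _ _ (prod_coordinates cVV cVV) fTT.
exists (fun e => om e 1); split => //.
have := is_derive_postlin (l := snd) (@continuous_snd _ _ _) (D2 0 J0).
rewrite om20 Z0 om0 /tangent_map/=; congr is_derive; congr (_ + _).
have dz := (sz 1).1 0 J0; have ddz : differentiable ('D_1 z0) 0 := ((sz 2).2 1).1 0 J0.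
by rewrite (deriveE _ (differentiable_pair dz ddz)) (diff_pair dz ddz) (deriveE _ ddz).
Qed.

End FlowSmooth.

(** * Local flows of a field on an open set *)

Section LocalFlow.
Context {R : realType} {V : normedModType R}.

(** The radial retraction onto the closed ball of radius [r]; it is 2-Lipschitz for any norm. *)
Definition retract (r : R) (w : V) : V := (r / Num.max r `|w|) *: w.

Lemma retract_id r w : 0 < r -> `|w| <= r -> retract r w = w.
Proof. by move=> r0 wr; rewrite /retract (max_idPl wr) divff ?scale1r// lt0r_neq0. Qed.

Lemma norm_retract r w : 0 < r -> `|retract r w| <= r.
Proof.
move=> r0; have m0 : 0 < Num.max r `|w| by rewrite lt_max r0.
rewrite /retract normrZ (ger0_norm (divr_ge0 (ltW r0) (ltW m0))).
by rewrite mulrAC ler_pdivrMr// ler_pM2l// le_max lexx orbT.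
Qed.

Lemma retract_lipschitz r w w' : 0 < r -> `|retract r w - retract r w'| <= 2 * `|w - w'|.
Proof.
move=> r0; rewrite /retract.
set m := Num.max r `|w|; set m' := Num.max r `|w'|.
have m0 : 0 < m by rewrite lt_max r0.
have m'0 : 0 < m' by rewrite lt_max r0.
have rm : r <= m by rewrite le_max lexx.
have wm' : `|w'| <= m' by rewrite le_max lexx orbT.
have mm : `|m' - m| <= `|w - w'|.
  have h1 : `|w'| <= `|w| + `|w - w'| by rewrite -lerBlDl distrC lerB_dist.
  have h2 : `|w| <= `|w'| + `|w - w'| by rewrite -lerBlDl lerB_dist.
  have h0 : 0 <= `|w - w'| by [].
  by rewrite ler_norml; apply/andP; split; rewrite ?lerBlDr ?lerBrDr /m /m' /Num.max; do 2 case: ifP; lra.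
(* One term is due to the change of the vector, the other to the change of the scaling factor; each
   has norm at most |w - w'|. *)
have -> : (r / m) *: w - (r / m') *: w' = (r / m) *: (w - w') + (r / m * ((m' - m) / m')) *: w'.
  rewrite scalerBr -addrA; congr (_ + _); rewrite -!scaleNr -scalerDl; congr (_ *: _).
  by rewrite /GRing.scale/=; field; rewrite !lt0r_neq0.
rewrite (le_trans (ler_normD _ _))// [2 * _]mulrDl mul1r.
rewrite [`|_ *: (w - w')|]normrZ [`|_ *: w'|]normrZ.
have rm1 : `|r / m| <= 1 by rewrite (ger0_norm (divr_ge0 (ltW r0) (ltW m0))) ler_pdivrMr// mul1r.
rewrite lerD ?ler_piMl// [`|_ * (_ / m')|]normrM -mulrA.
rewrite (le_trans (ler_piMl _ rm1)) ?mulr_ge0//.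
have h1 : m'^-1 * `|w'| <= 1 by rewrite ler_pdivrMl// mulr1.
have h0 : 0 <= m'^-1 * `|w'| by rewrite mulr_ge0// invr_ge0 ltW.
by rewrite normrM normfV (gtr0_norm m'0) -mulrA -[leRHS]mulr1 ler_pM.
Qed.

Lemma compact_convex_nbhs (cV : coordinates V) (U : set V) (zs : V) : open U -> U zs ->
  exists2 r : R, 0 < r & [/\ compact [set z : V | `|z - zs| <= r],
    is_convex [set z : V | `|z - zs| <= r] & forall z, `|z - zs| <= r -> U z].
Proof.
move=> oU Uz.
have [r r0 hr] : exists2 r : R, 0 < r & forall z, `|z - zs| <= r -> U z.
  have : nbhs zs U by exact: open_nbhs_nbhs.
  move=> /nbhs_ballP[e /= e0 he]; exists (e / 2); first by rewrite divr_gt0.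
  move=> z hz; apply: he; rewrite -ball_normE/= distrC (le_lt_trans hz)//.
  by rewrite ltr_pdivrMr// ltr_pMr// ltr1n.
pose K := [set z : V | `|z - zs| <= r].
have cK : compact K.
  rewrite (_ : K = (fun w => w + zs) @` [set w : V | `|w| <= r]).
    apply: continuous_compact; last exact: cball_compact.
    by apply: continuous_subspaceT => x; apply: cvgD; [exact: cvg_id|exact: cvg_cst].
  apply/seteqP; split=> [z Kz|_ [w /= wr <-]]; last by rewrite /K/= addrK.
  by exists (z - zs) => //; rewrite subrK.
have vK : is_convex K.
  move=> z z' s Kz Kz' /andP[s0 s1]; rewrite /K/=.
  rewrite (_ : _ - zs = (1 - s) *: (z - zs) + s *: (z' - zs)); last first.
    rewrite scalerBl scale1r -[in RHS]addrA [- (_ *: _) + _]addrC -scalerBr.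
    by rewrite opprB subrKA addrAC.
  rewrite (le_trans (ler_normD _ _))// !normrZ (ger0_norm s0) ger0_norm ?subr_ge0//.
  have := ler_wpM2l s0 Kz'; have : (1 - s) * `|z - zs| <= (1 - s) * r.
    by rewrite ler_wpM2l ?subr_ge0.
  lra.
by exists r.
Qed.

(** Starting points range over the half ball so that a trajectory still has r / 2 to move. [lf_dist]
    is what allows flows to be chained with control of the drift, and [lf_continuous] holds at all
    times because flow families demand it. *)
Record is_local_flow (U : set V) (X : V -> V) (zs : V) (r delta M : R)
    (Phi : V -> R -> V) : Prop := IsLocalFlow {
  lf_compact : compact [set z : V | `|z - zs| <= r];
  lf_convex : is_convex [set z : V | `|z - zs| <= r];
  lf_dom : forall z, `|z - zs| <= r -> U z;
  lf_start : forall z, `|z - zs| <= r / 2 -> Phi z 0 = z;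
  lf_continuous : forall z, `|z - zs| <= r / 2 -> continuous (Phi z);
  lf_derive : forall z (s : R), `|z - zs| <= r / 2 -> `|s| <= delta ->
    is_derive s 1 (Phi z) (X (Phi z s));
  lf_ball : forall z s, `|z - zs| <= r / 2 -> `|s| <= delta -> `|Phi z s - zs| <= r;
  lf_dist : forall z s, `|z - zs| <= r / 2 -> `|s| <= delta ->
    `|Phi z s - z| <= M * `|s|
}.

Lemma local_flow (cV : coordinates V) (U : set V) (X : V -> V) (zs : V) :
  open U -> Ck_on 1 U X -> U zs ->
  exists (r delta M : R) (Phi : V -> R -> V),
    [/\ 0 < r, 0 < delta, 0 < M & is_local_flow U X zs r delta M Phi].
Proof.
move=> oU kX Uz.
have [r r0 [cK vK hr]] := compact_convex_nbhs cV oU Uz.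
set K := [set z : V | `|z - zs| <= r] in cK vK.
have KU : K `<=` U by move=> z /hr.
have [L L0 hL] := lipschitz_on_compact cV cV cK vK KU kX.
have [M M0 hM] : exists2 B : R, 0 < B & forall z, K z -> `|X z| <= B.
  apply: continuous_bounded => // z Kz; exact: (Ck_onW kX) z (KU _ Kz).
have [C C0 hC] := le_increment_vec cV.
(* Y is globally Lipschitz and coincides with X on K. *)
pose Y z := X (zs + retract r (z - zs)).
have Kret z : K (zs + retract r (z - zs)) by rewrite /K/= [zs + _]addrC addrK norm_retract.
have YL z z' : `|Y z - Y z'| <= L * 2 * `|z - z'|.
  rewrite (le_trans (hL _ _ (Kret _) (Kret _)))// -mulrA ler_pM2l//.
  rewrite opprD addrACA subrr add0r (le_trans (retract_lipschitz _ _ r0))//.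
  by rewrite opprB addrA subrK.
have sol z : exists Z : R -> V, Z 0 = z /\ forall s : R, is_derive s 1 Z (Y (Z s)).
  apply: (picard cV (f := fun=> Y) (L := L * 2) (M := M)) => [w s|s w w'|s].
  - exact: cvg_cst.
  - exact: YL.
  - exact: hM.
have [Phi hPhi] := choice sol.
(* The displacement in time s is at most C M |s|, hence at most r / 2 within this [delta]: the
   trajectory stays where [Y] is [X]. *)
exists r, (r / (2 * (C * M))), (C * M), Phi.
split; rewrite ?divr_gt0 ?mulr_gt0//.
have bound z s : `|Phi z s - z| <= C * M * `|s|.
  have [P0 DP] := hPhi z.
  have Dh (x : R) : is_derive x 1 (fun t : R => 0 + t *: M) M by exact: is_derive_segment.
  have cP a b : {within `[a, b], continuous (Phi z)}.
    by apply: continuous_subspaceT => x; exact: is_derive_continuous (DP x).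
  have ch (a b : R) : {within `[a, b], continuous (fun t : R => 0 + t *: M)}.
    by apply: continuous_subspaceT => x; exact: is_derive_continuous (Dh x).
  have key a b : a <= b -> `|Phi z b - Phi z a| <= C * M * (b - a).
    move=> ab; have := hC _ _ _ _ a b ab (cP a b) (ch a b) (fun x _ => DP x) (fun x _ => Dh x).
    rewrite !add0r -scalerBl -mulrA [M * _]mulrC; apply => x _; exact: hM.
  rewrite -[X in _ - X]P0; case: (lerP 0 s) => [s0|/ltW s0].
    by rewrite (ger0_norm s0) (le_trans (key _ _ s0))// subr0.
  by rewrite distrC (ler0_norm s0) (le_trans (key _ _ s0))// sub0r.
have ball z s : `|z - zs| <= r / 2 -> `|s| <= r / (2 * (C * M)) -> `|Phi z s - zs| <= r.
  move=> hz hs; rewrite -(subrKA z) (le_trans (ler_normD _ _))// [leRHS]splitr lerD//.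
  rewrite (le_trans (bound z s))// (le_trans (ler_wpM2l (ltW (mulr_gt0 C0 M0)) hs))//.
  by apply: le_of_eq; field; rewrite !lt0r_neq0.
split=> // [z hz|z hz s|z s hz hs].
- by have [] := hPhi z.
- by have [_ DP] := hPhi z; exact: is_derive_continuous (DP s).
- have [_ DP] := hPhi z; have := DP s; rewrite /Y retract_id//; last exact: ball.
  by rewrite addrC subrK.
Qed.

End LocalFlow.

Section SmoothAt.
Context {R : realType}.
Implicit Types (V W E : normedModType R).

Lemma smooth_at_near_eq V W (f g : V -> W) x : (\forall y \near x, f y = g y) ->
  smooth_at x f -> smooth_at x g.
Proof.
move=> fg [U [oU Ux] kU].
have : nbhs x [set y | f y = g y] by exact: fg.
rewrite nbhsE => -[B [oB Bx] Bfg].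
exists (U `&` B); first by split; [exact: openI|].
move=> k; apply: (@Ck_on_eq _ _ _ k _ f); [exact: openI|by move=> y [_ /Bfg]|].
by apply: Ck_on_sub (kU k) => y [].
Qed.

Lemma smooth_at_comp V W E (cW : coordinates W) (f : V -> W) (g : W -> E) x :
  smooth_at x f -> smooth_at (f x) g -> smooth_at x (g \o f).
Proof.
move=> [U [oU Ux] kU] [B [oB Bx] kB].
have oUB : open (U `&` f @^-1` B).
  rewrite openE => y [Uy By]; rewrite /interior.
  apply: filterI; first exact: open_nbhs_nbhs.
  by apply: (kU 0%N y Uy); exact: open_nbhs_nbhs.
exists (U `&` f @^-1` B) => // k.
apply: (@Ck_on_comp _ _ _ _ cW k _ B) => //; first by move=> y [].
by apply: Ck_on_sub (kU k) => y [].
Qed.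

Lemma smooth_at_derive V W (f : V -> W) x v : smooth_at x f -> smooth_at x ('D_v f).
Proof. by move=> [U oU kU]; exists U => // k; exact: (kU k.+1).2. Qed.

Lemma smooth_at_cst V W (a : W) (x : V) : smooth_at x (cst a).
Proof.
exists setT; first by split; [exact: openT|].
by move=> k; exact: Ck_on_cst.
Qed.

Lemma smooth_at_postlin V W E (f : V -> W) x (l : {linear W -> E}) :
  continuous l -> smooth_at x f -> smooth_at x (fun y => l (f y)).
Proof. by move=> cl [U [oU Ux] kU]; exists U => // k; exact: Ck_on_postlin. Qed.

Lemma smooth_at_lin V W x (l : {linear V -> W}) : continuous l -> smooth_at x l.
Proof.
move=> cl; exists setT; first by split; [exact: openT|].
by move=> k; exact: Ck_on_lin.
Qed.

Lemma smooth_at2 V W E (f : V -> W) (g : V -> E) x : smooth_at x f -> smooth_at x g ->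
  exists2 U : set V, open_nbhs x U & smooth_on U f /\ smooth_on U g.
Proof.
move=> [U [oU Ux] kU] [B [oB Bx] kB]; exists (U `&` B).
  by split; [exact: openI|].
by split=> k; [apply: Ck_on_sub (kU k)|apply: Ck_on_sub (kB k)] => y [].
Qed.

Lemma smooth_atD V W (f g : V -> W) x : smooth_at x f -> smooth_at x g ->
  smooth_at x (fun y => f y + g y).
Proof.
move=> sf sg; have [U [oU Ux] [kf kg]] := smooth_at2 sf sg.
by exists U => // k; apply: Ck_onD oU (kf k) (kg k).
Qed.

Lemma smooth_at_scale V W (f : V -> R) (g : V -> W) x : smooth_at x f -> smooth_at x g ->
  smooth_at x (fun y => f y *: g y).
Proof.
move=> sf sg; have [U [oU Ux] [kf kg]] := smooth_at2 sf sg.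
by exists U => // k; apply: Ck_on_scale oU (kf k) (kg k).
Qed.

Lemma smooth_at_pair V W E (f : V -> W) (g : V -> E) x : smooth_at x f -> smooth_at x g ->
  smooth_at x (fun y => (f y, g y)).
Proof.
move=> sf sg; have [U [oU Ux] [kf kg]] := smooth_at2 sf sg.
by exists U => // k; apply: Ck_on_pair oU (kf k) (kg k).
Qed.

Lemma smooth_at_sum V W (I : Type) (r : seq I) (f : I -> V -> W) x :
  (forall i, smooth_at x (f i)) -> smooth_at x (fun y => \sum_(i <- r) f i y).
Proof.
move=> sf; elim: r => [|i r IH].
  by rewrite (_ : (fun y => _) = cst 0); [exact: smooth_at_cst|
    rewrite funeqE => y; rewrite big_nil].
rewrite (_ : (fun y => _) = (fun y => f i y + \sum_(i <- r) f i y)).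
  exact: smooth_atD.
by rewrite funeqE => y; rewrite big_cons.
Qed.

Lemma smooth_at_coord V n (f : V -> 'rV[R]_n) x (k : 'I_n) : smooth_at x f ->
  smooth_at x (fun y => f y 0 k : R).
Proof.
exact: (smooth_at_postlin (l := linear_map (@row_coord_linear R n k)) (@coord_continuous _ _ _ _ _)).
Qed.

Lemma smooth_at_rowP V n (f : V -> 'rV[R]_n) x :
  (forall k, smooth_at x (fun y => f y 0 k : R)) -> smooth_at x f.
Proof.
move=> sf; apply: (@smooth_at_near_eq _ _ (fun y => \sum_k (f y 0 k : R) *: delta_mx 0 k)).
  by near=> y; rewrite -row_sum_delta.
by apply: smooth_at_sum => k; apply: smooth_at_scale; [exact: sf|exact: smooth_at_cst].
Unshelve. all: by end_near. Qed.

Lemma smooth_at_continuous V W (f : V -> W) x : smooth_at x f -> {for x, continuous f}.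
Proof. by case=> U [_ Ux] /(_ 0%N); apply. Qed.

Lemma smooth_on_at V W (U : set V) (f : V -> W) x : open U -> U x -> smooth_on U f ->
  smooth_at x f.
Proof. by move=> oU Ux sf; exists U. Qed.

Lemma smooth_at_derive_joint V W (cV : coordinates V) (f : V -> W) (z : V * V) :
  smooth_at z.1 f -> smooth_at z (fun z => 'D_(z.2) f z.1).
Proof.
move=> [U [oU Ux] kU]; exists (U `*` setT); first by split; [exact: open_setXT|].
move=> k; have := Ck_on_tangent_map cV oU (kU k.+1).
exact: (Ck_on_postlin (l := snd) (@continuous_snd _ _ _) (open_setXT oU)).
Qed.

End SmoothAt.

(** * Tangent vectors and covariant derivatives *)

Section TangentVectors.
Context {R : realType} {n : nat} {M : manifold R n}.
Implicit Types (i j l : cidx M) (p q : M) (a b c k : 'I_n).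

Lemma tangent_out p (v : tangent p) i : ~ cdom i p -> v i = 0.
Proof. by case: v => v /=/asboolP[h _]; exact: h. Qed.

Lemma tangent_transition p (v : tangent p) i j : cdom i p -> cdom j p ->
  v j = 'd (transition i j) (chart i p) (v i).
Proof. by case: v => v /=/asboolP[_ h]; exact: h. Qed.

Lemma tangent_ext p (u v : tangent p) i : cdom i p -> u i = v i -> u = v.
Proof.
move=> ip uv; apply: val_inj; apply/funext => j /=.
have [jp|jp] := pselect (cdom j p); last by rewrite !tangent_out.
by rewrite (tangent_transition _ ip jp) (tangent_transition v ip jp) uv.
Qed.

Lemma tangent_sumE p (I : Type) (r : seq I) (f : I -> tangent p) i :
  (\sum_(x <- r) f x) i = \sum_(x <- r) f x i.
Proof. by elim: r => [|x r IH]; rewrite ?big_nil ?big_cons// -IH. Qed.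

Lemma near_chart i p : cdom i p -> \forall x \near chart i p,
  cdom i (ichart i x) /\ chart i (ichart i x) = x.
Proof.
move=> ip; have := @open_near _ _ _ _ (@chart_open _ _ M i) (ex_intro2 _ _ p ip erefl).
by apply: filterS => x [q iq <-]; rewrite chartK.
Qed.

Lemma near_cdom i j p : cdom i p -> cdom j p -> \forall x \near chart i p, cdom j (ichart i x).
Proof.
move=> ip jp.
have ic : ichart i @ chart i p --> p.
  by rewrite -[X in _ --> X](chartK ip); exact: (ichart_continuous ip).
by apply: ic; apply: open_nbhs_nbhs; split => //; exact: cdom_open.
Qed.

Lemma diff_transition_id i p : cdom i p -> 'd (transition i i) (chart i p) = id :> ('rV[R]_n -> 'rV[R]_n).
Proof.
move=> ip; apply/funext => u.
have dt := smooth_at_differentiable (transition_smooth ip ip).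
rewrite -(deriveE _ dt) (near_eq_derive (g := id)) ?derive_id//.
by apply: filterS (near_chart ip) => x [_ h]; exact: h.
Qed.

Lemma chart_vectorE i j p u : cdom i p -> cdom j p ->
  chart_vector i p u j = 'd (transition i j) (chart i p) u.
Proof. by move=> ip jp; rewrite /= /chart_vector_comp; case: asboolP => // -[]. Qed.

Lemma chart_vector_id i p u : cdom i p -> chart_vector i p u i = u.
Proof. by move=> ip; rewrite chart_vectorE// diff_transition_id. Qed.

Lemma chart_vectorK i p (v : tangent p) : cdom i p -> chart_vector i p (v i) = v.
Proof. by move=> ip; apply: (tangent_ext ip); rewrite chart_vector_id. Qed.

Lemma tangent_coord i p (v : tangent p) : cdom i p ->
  v = \sum_a v i 0 a *: coord_field i a p.
Proof.
move=> ip; apply: (tangent_ext ip); rewrite tangent_sumE.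
rewrite {1}(row_sum_delta (v i)); apply: eq_bigr => a _.
by rewrite -[RHS]/(_ *: (coord_field i a p) i) chart_vector_id.
Qed.

Lemma coord_field_smooth i l m a p : cdom i p -> cdom l p -> cdom m p ->
  smooth_at (chart l p) (fun x => coord_field i a (ichart l x) m).
Proof.
move=> ip lp mp.
(* Read from chart [l] to chart [m], the field is a partial derivative of the transition from [i] to
   [m], evaluated after the transition from [l] to [i]. *)
apply: (@smooth_at_near_eq _ _ _ (fun x => 'D_(delta_mx 0 a) (transition i m) (transition l i x))).
  near=> x.
  have ix : cdom i (ichart l x) by near: x; exact: near_cdom.
  have mx : cdom m (ichart l x) by near: x; exact: near_cdom.
  rewrite /coord_field chart_vectorE// deriveE//.
  exact: smooth_at_differentiable (transition_smooth ix mx).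
apply: (smooth_at_comp (row_coordinates n) (f := transition l i)
  (g := 'D_(delta_mx 0 a) (transition i m))); first exact: transition_smooth.
by rewrite /transition /= chartK//; apply: smooth_at_derive; exact: transition_smooth.
Unshelve. all: by end_near. Qed.

Lemma section_smooth_coord_field i a p : cdom i p -> section_smooth_at p (coord_field i a).
Proof. by move=> ip l lp; exact: coord_field_smooth. Qed.

Lemma fun_smooth_coord_field i j a b p : cdom i p -> cdom j p ->
  fun_smooth_at p (fun q => coord_field i a q j 0 b).
Proof.
by move=> ip jp l lp; apply: smooth_at_coord; exact: coord_field_smooth.
Qed.

Lemma section_smooth_scale p (f : M -> R) (Y : forall q, tangent q) :
  fun_smooth_at p f -> section_smooth_at p Y -> section_smooth_at p (fun q => f q *: Y q).
Proof. by move=> sf sY l lp; apply: smooth_at_scale; [exact: sf|exact: sY]. Qed.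

Lemma section_smooth_sum p (I : Type) (r : seq I) (Y : I -> forall q, tangent q) :
  (forall x, section_smooth_at p (Y x)) -> section_smooth_at p (fun q => \sum_(x <- r) Y x q).
Proof.
move=> sY l lp.
rewrite (_ : (fun x => _) = (fun x => \sum_(y <- r) Y y (ichart l x) l)); last first.
  by apply/funext => x; rewrite tangent_sumE.
by apply: smooth_at_sum => y; exact: sY.
Qed.

(** Meant for the indicator of an open set, which is smooth with zero differential at the points of
    that set. *)
Lemma fun_smooth_near_cst p (O : set M) (f : M -> R) (r : R) : open O -> O p ->
  (forall q, O q -> f q = r) -> fun_smooth_at p f /\
  forall i, cdom i p -> forall u, 'd (f \o ichart i) (chart i p) u = 0.
Proof.
move=> oO Op fr.
have key i : cdom i p -> \forall x \near chart i p, (cst r : 'rV[R]_n -> R) x = (f \o ichart i) x.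
  move=> ip; have ic : ichart i @ chart i p --> p.
    by rewrite -[X in _ --> X](chartK ip); exact: (ichart_continuous ip).
  have nO : nbhs p O by exact: open_nbhs_nbhs.
  have : \forall x \near chart i p, O (ichart i x) := ic O nO.
  by apply: filterS => x /fr /= ->.
split=> i ip; first exact: smooth_at_near_eq (key i ip) (smooth_at_cst _ _).
move=> u; have [_ ->] := near_eq_diff (key i ip) (differentiable_cst _ _).
by rewrite diff_cst.
Qed.

Lemma nabla_local (N : td_connection M) t p (X : tangent p) (O : set M)
   (Y Z : forall q, tangent q) : open O -> O p -> (forall q, O q -> Y q = Z q) ->
  section_smooth_at p Y -> section_smooth_at p Z -> N t p X Y = N t p X Z.
Proof.
move=> oO Op YZ sY sZ; have [i ip] := cdom_cover p.
pose f q : R := if `[< O q >] then 1 else 0.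
have f1 q : O q -> f q = 1 by rewrite /f => /asboolP ->.
have [sf df] := fun_smooth_near_cst oO Op f1.
have fYZ : (fun q => f q *: Y q) = (fun q => f q *: Z q).
  apply: functional_extensionality_dep => q; rewrite /f; case: asboolP => [/YZ -> //|_].
  by rewrite !scale0r.
have hY := nabla_leibniz N t X sf sY ip; have hZ := nabla_leibniz N t X sf sZ ip.
by move: hY; rewrite fYZ hZ df// !scale0r !add0r f1// !scale1r.
Qed.

Lemma nabla_sum (N : td_connection M) t p (X : tangent p) (I : Type) (r : seq I)
   (Y : I -> forall q, tangent q) : (forall x, section_smooth_at p (Y x)) ->
  N t p X (fun q => \sum_(x <- r) Y x q) = \sum_(x <- r) N t p X (Y x).
Proof.
move=> sY; elim: r => [|x r IH].
  rewrite big_nil; have [i ip] := cdom_cover p.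
  have s0 : section_smooth_at p (fun q => \sum_(x <- [::]) Y x q) by exact: section_smooth_sum.
  (* The zero section is the sum of itself with itself, so additivity makes its covariant derivative
     vanish. *)
  have := nabla_add N t X s0 s0.
  rewrite (_ : (fun q => _ + _) = (fun q => \sum_(x <- [::]) Y x q)).
    by move/esym/eqP; rewrite -subr_eq0 addrK => /eqP.
  by apply: functional_extensionality_dep => q; rewrite !big_nil addr0.
rewrite big_cons -IH -nabla_add//; last exact: section_smooth_sum.
by congr (N t p X _); apply: functional_extensionality_dep => q; rewrite big_cons.
Qed.

End TangentVectors.

(** * The derivative along a path and its independence of the chart *)

Section CovariantDerivative.
Context {R : realType} {n : nat} {M : manifold R n}.
Implicit Types (i j l : cidx M) (p q : M) (a b c k : 'I_n).

Lemma path_near_cdom (g : R -> M) (s : R) i : {for s, continuous g} -> cdom i (g s) ->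
  \forall r \near s, cdom i (g r).
Proof.
move=> cg ip; have nO : nbhs (g s) (cdom i).
  by apply: open_nbhs_nbhs; split => //; exact: cdom_open.
exact: cg (cdom i) nO.
Qed.

Lemma velocityE (g : R -> M) s i : cdom i (g s) -> velocity g s i = 'D_1 (chart i \o g) s.
Proof. by move=> ip; rewrite /velocity (asboolT ip) derive1E. Qed.

Lemma is_derive_velocity (g : R -> M) (s : R) i : path_smooth_at s g -> cdom i (g s) ->
  is_derive s 1 (chart i \o g) (velocity g s i).
Proof.
move=> [_ sg] ip; rewrite (velocityE ip); apply: DeriveDef => //.
exact/derivable1_diffP/smooth_at_differentiable/sg.
Qed.

Lemma velocity_tangent (g : R -> M) s : path_smooth_at s g -> velocity g s \in tangent_at (g s).
Proof.
move=> pg; apply/asboolP; split=> [i ip|i j ip jp].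
  by rewrite /velocity; case: asboolP.
have dt := smooth_at_differentiable (transition_smooth ip jp).
have Dg := is_derive_velocity pg ip.
have D1 := is_derive_comp (X := transition i j) dt Dg.
rewrite -(deriveE _ dt); have [_ <-] := D1.
rewrite (velocityE jp); apply: near_eq_derive.
have := path_near_cdom pg.1 ip; apply: filterS => r ir.
by rewrite /transition /= chartK.
Qed.

Definition velocity_at (g : R -> M) s (pg : path_smooth_at s g) : tangent (g s) :=
  Tangent (velocity_tangent pg).

(** The algebra behind chart independence: [e] and [e'] are frames related by the matrix [F], and
    [f] and [f'] their covariant derivatives. The terms in [dF] from the frame and from the
    components are the same sum. *)
Lemma change_frame (V : lmodType R) (dw dw' u u' : 'I_n -> R) (F dF : 'I_n -> 'I_n -> R)
    (e e' f f' : 'I_n -> V) :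
  (forall b, e b = \sum_c F c b *: e' c) ->
  (forall b, f b = \sum_c (dF c b *: e' c + F c b *: f' c)) ->
  (forall c, u' c = \sum_b u b * F c b) ->
  (forall c, dw' c = \sum_b (dw b * F c b + u b * dF c b)) ->
  \sum_b dw b *: e b + \sum_b u b *: f b = \sum_c dw' c *: e' c + \sum_c u' c *: f' c.
Proof.
move=> h1 h2 h3 h4; rewrite -!big_split/=.
under eq_bigr do rewrite h1 h2 !scaler_sumr -big_split/=.
rewrite exchange_big/=; apply: eq_bigr => c _.
rewrite h3 h4 !scaler_suml -big_split/=; apply: eq_bigr => b _.
by rewrite scalerDr scalerDl !scalerA addrA.
Qed.

Variable D : derivation_operator M.

(* The vector D_t w at p, computed in the chart i: v is the velocity, u the
   value of w and dw the derivative of the components of w. *)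
Definition covariant i s p (v u : tangent p) (dw : 'I_n -> R) : tangent p :=
  \sum_c dw c *: coord_field i c p + \sum_c u i 0 c *: opN D s p v (coord_field i c)
  + opC D s p + opA D s p v + opB D s p u.

Lemma tangentDE p (u v : tangent p) i : (u + v) i = u i + v i.
Proof. by []. Qed.

Lemma tangentZE p (r : R) (u : tangent p) i : (r *: u) i = r *: u i.
Proof. by []. Qed.

Lemma linear_components i p (f : {linear tangent p -> tangent p}) (v : tangent p) k :
  cdom i p -> f v i 0 k = \sum_a f (coord_field i a p) i 0 k * v i 0 a.
Proof.
move=> ip; rewrite {1}(tangent_coord v ip) linear_sum tangent_sumE summxE.
by apply: eq_bigr => a _; rewrite linearZ tangentZE mxE mulrC.
Qed.

Lemma covariantE i s p (v u : tangent p) dw k : cdom i p ->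
  covariant i s v u dw i 0 k = dw k +
    (\sum_a \sum_b Gamma D i a b k s p * v i 0 a * u i 0 b) + Ccomp D i k s p
    + (\sum_a Acomp D i a k s p * v i 0 a) + \sum_a Bcomp D i a k s p * u i 0 a.
Proof.
move=> ip; rewrite /covariant !tangentDE !mxE !tangent_sumE !summxE.
rewrite (linear_components (opA D s p))// (linear_components (opB D s p))//.
congr (_ + _ + _ + _ + _).
  transitivity ((\sum_c dw c *: delta_mx 0 c : 'rV[R]_n) 0 k).
    by rewrite summxE; apply: eq_bigr => c _; rewrite tangentZE chart_vector_id.
  by rewrite (_ : \sum_c _ = \row_c dw c) ?mxE// [RHS]row_sum_delta; apply: eq_bigr => c _; rewrite mxE.
rewrite [RHS]exchange_big; apply: eq_bigr => b _; rewrite tangentZE mxE.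
have sc := section_smooth_coord_field b ip.
pose f : {linear tangent p -> tangent p} := linear_map (nabla_linear (opN D) s sc).
rewrite -[opN D s p v _]/(f v) (linear_components f)// mulrC mulr_suml.
by apply: eq_bigr => a _.
Qed.

(** The numbers [Dt] are hereby the components of an actual tangent vector, which can be compared
    between charts. *)
Lemma DtE (g : R -> M) (w : R -> cidx M -> 'rV[R]_n) i k s (pg : path_smooth_at s g)
    (wP : w s \in tangent_at (g s)) : cdom i (g s) ->
  Dt D g w i k s = covariant i s (velocity_at pg) (Tangent wP)
    (fun c => derive1 (fun r => w r i 0 c) s) i 0 k.
Proof. by move=> ip; rewrite covariantE. Qed.

(** The Leibniz rule for [nabla] and the product rule along the path produce the same derivative
    [dF] of the change of frame, so [change_frame] applies. *)
Lemma covariant_chart (J : set R) (g : R -> M) (w : R -> cidx M -> 'rV[R]_n) i j s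
    (pg : path_smooth_at s g) (wP : w s \in tangent_at (g s)) :
  open J -> field_along J g w -> J s -> cdom i (g s) -> cdom j (g s) ->
  covariant j s (velocity_at pg) (Tangent wP) (fun c => derive1 (fun r => w r j 0 c) s) =
  covariant i s (velocity_at pg) (Tangent wP) (fun c => derive1 (fun r => w r i 0 c) s).
Proof.
move=> oJ fw Js ip jp; set p := g s; set v := velocity_at pg; set u := Tangent wP.
pose F c b q : R := coord_field j b q i 0 c.
have sF c b : fun_smooth_at p (F c b) by exact: fun_smooth_coord_field.
pose dF c b : R := 'd (F c b \o ichart i) (chart i p) (v i).
have h1 b : coord_field j b p = \sum_c F c b p *: coord_field i c p by exact: tangent_coord.
have h2 b : opN D s p v (coord_field j b) =
    \sum_c (dF c b *: coord_field i c p + F c b p *: opN D s p v (coord_field i c)).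
  have sc c : section_smooth_at p (coord_field i c) by exact: section_smooth_coord_field.
  have sFc c : section_smooth_at p (fun q => F c b q *: coord_field i c q).
    exact: section_smooth_scale.
  (* The expansion of the field of chart [j] in the frame of chart [i] holds on [cdom i] only, hence
     the appeal to locality. *)
  rewrite (@nabla_local _ _ _ (opN D) s p v (cdom i) _ (fun q => \sum_c F c b q *: coord_field i c q)).
  - rewrite nabla_sum//; apply: eq_bigr => c _.
    by rewrite (nabla_leibniz (opN D) s v (sF c b) (sc c) ip).
  - exact: cdom_open.
  - exact: ip.
  - by move=> q iq; exact: tangent_coord.
  - exact: section_smooth_coord_field.
  - exact: section_smooth_sum.
have comp r c (z : tangent (g r)) : cdom i (g r) -> cdom j (g r) ->
    z i 0 c = \sum_b z j 0 b * F c b (g r).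
  move=> ir jr; rewrite {1}(tangent_coord z jr) tangent_sumE summxE.
  by apply: eq_bigr => b _; rewrite tangentZE mxE.
have h3 c : u i 0 c = \sum_b u j 0 b * F c b p by exact: comp.
have h4 c : derive1 (fun r => w r i 0 c) s =
    \sum_b (derive1 (fun r => w r j 0 b) s * F c b p + u j 0 b * dF c b).
  have Dw l b : cdom l p -> is_derive s 1 (fun r => w r l 0 b) (derive1 (fun r => w r l 0 b) s).
    move=> lp; rewrite derive1E; apply: DeriveDef => //.
    apply/derivable1_diffP/smooth_at_differentiable/smooth_at_coord.
    exact: (fw s Js).2.
  have DF b : is_derive s 1 (fun r => F c b (g r)) (dF c b).
    have dFi : differentiable (F c b \o ichart i) ((chart i \o g) s).
      exact: smooth_at_differentiable (sF c b i ip).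
    have := is_derive_comp dFi (is_derive_velocity pg ip).
    rewrite (deriveE _ dFi); apply: near_eq_is_derive.
    have := path_near_cdom pg.1 ip; apply: filterS => r ir.
    by rewrite /= chartK.
  rewrite derive1E.
  have Ds (t : seq 'I_n) : is_derive s 1 (fun r => \sum_(b <- t) w r j 0 b * F c b (g r))
     (\sum_(b <- t) (derive1 (fun r => w r j 0 b) s * F c b p + u j 0 b * dF c b)).
    elim: t => [|b t IH].
      rewrite big_nil (_ : (fun _ => _) = cst 0); first exact: is_derive_cst.
      by apply/funext => r; rewrite big_nil.
    rewrite big_cons (_ : (fun _ => _) = (fun r => w r j 0 b * F c b (g r)) \+
      (fun r => \sum_(b <- t) w r j 0 b * F c b (g r))); last first.
      by apply/funext => r; rewrite big_cons.
    apply: is_deriveD; have := is_deriveM (Dw j b jp) (DF b).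
    by congr is_derive; rewrite addrC /GRing.scale/= [F c b _ * _]mulrC.
  have [_ <-] := Ds (index_enum 'I_n); apply: near_eq_derive.
  near=> r; have Jr : J r by near: r; exact: open_nbhs_nbhs.
  have [wr _] := fw r Jr.
  by apply: (comp r c (Tangent wr)); near: r; exact: path_near_cdom pg.1 _.
by rewrite /covariant (change_frame h1 h2 h3 h4).
Unshelve. all: by end_near. Qed.

(** A tangent vector with zero components in one chart is zero. A solution found in one chart thus
    satisfies the equation in every chart over which [Dt_zero] quantifies. *)
Lemma Dt_zero_chart (J : set R) (g : R -> M) (w : R -> cidx M -> 'rV[R]_n) i s :
  open J -> (forall r, J r -> path_smooth_at r g) -> field_along J g w -> J s ->
  cdom i (g s) -> (forall k, Dt D g w i k s = 0) ->
  forall j k, cdom j (g s) -> Dt D g w j k s = 0.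
Proof.
move=> oJ pJ fw Js ip H j k jp.
have [wP _] := fw s Js; have pg := pJ s Js.
rewrite (DtE k pg wP jp) (covariant_chart pg wP oJ fw Js ip jp).
set z := covariant _ _ _ _ _; suff -> : z = 0 by rewrite mxE.
apply: (tangent_ext ip); apply/rowP => c; rewrite -(DtE c pg wP ip) H.
by rewrite mxE.
Qed.

End CovariantDerivative.

(** * Geodesics and parallel fields in a chart *)

Section GeodesicField.
Context {R : realType} {n : nat} {M : manifold R n} (D : derivation_operator M).
Variable i : cidx M.
Implicit Types (p q : M) (a b c k : 'I_n).

(** The data are smooth in the sense of [smooth_at], with a neighbourhood depending on the point;
    this assembles them into smoothness on one open set. *)
Lemma Ck_on_local (V W : normedModType R) (k : nat) (U : set V) (f : V -> W) :
  (forall x, U x -> exists2 B, open_nbhs x B & Ck_on k B f) -> Ck_on k U f.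
Proof.
elim: k f => [|k IH] f h; first by move=> x /h[B [_ Bx]]; apply.
split=> [x /h[B [_ Bx] [d _]]|v]; first exact: d.
by apply: IH => x /h[B nB [_ kB]]; exists B => //; exact: kB.
Qed.

(** The equation [Dt] = 0 solved for the derivative of [u], with velocity [y]. The geodesic equation
    is the case [u] = [y], where the contributions of [A] and [B] add up. *)
Definition acceleration (q : R * 'rV[R]_n) (y u : 'rV[R]_n) : 'rV[R]_n :=
  \row_k - ((\sum_a \sum_b Gamma D i a b k q.1 (ichart i q.2) * y 0 a * u 0 b)
    + Ccomp D i k q.1 (ichart i q.2)
    + (\sum_a Acomp D i a k q.1 (ichart i q.2) * y 0 a)
    + \sum_a Bcomp D i a k q.1 (ichart i q.2) * u 0 a).

(* The state (s, x, y, u) consists of the time, the position, the velocity of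
   the geodesic, and a vector parallel along it. *)
Definition state : normedModType R := (R * 'rV[R]_n * 'rV[R]_n * 'rV[R]_n)%type.

Definition geo_field (z : state) : state :=
  (1, z.1.2, acceleration z.1.1 z.1.2 z.1.2, acceleration z.1.1 z.1.2 z.2).

Definition state_coordinates : coordinates state :=
  prod_coordinates (prod_coordinates (prod_coordinates real_coordinates
    (row_coordinates n)) (row_coordinates n)) (row_coordinates n).

Definition state_dom : set state := [set z | (chart i @` cdom i) z.1.1.2].

Lemma open_state_dom : open state_dom.
Proof.
apply: (open_comp (f := fun z : state => z.1.1.2) (D := chart i @` cdom i)).
  move=> z _; apply: (continuous_comp (f := fun z : state => z.1.1) (g := snd)).
    apply: (continuous_comp (f := fst) (g := fst)); exact: continuous_fst.
  exact: continuous_snd.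
exact: chart_open.
Qed.

Lemma smooth_at_acceleration (V : normedModType R) (q : V -> R * 'rV[R]_n)
    (y u : V -> 'rV[R]_n) (z : V) p : cdom i p -> (q z).2 = chart i p ->
  smooth_at z q -> smooth_at z y -> smooth_at z u ->
  smooth_at z (fun z => acceleration (q z) (y z) (u z)).
Proof.
move=> ip qz sq sy su; pose t := (q z).1.
have qE : q z = (t, chart i p) by rewrite -qz /t; case: (q z).
have sqc (W : normedModType R) (F : R -> M -> W) : td_smooth_at i t p F ->
    smooth_at z (fun z => F (q z).1 (ichart i (q z).2)).
  move=> sF; have H := smooth_at_comp
    (prod_coordinates real_coordinates (row_coordinates n)) (f := q)
    (g := fun x : R * 'rV[R]_n => F x.1 (ichart i x.2)) sq.
  by rewrite qE in H; exact: (H sF).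
apply: smooth_at_rowP => k.
rewrite (_ : (fun _ => _) = (fun z => (-1 : R) *: ((\sum_a \sum_b
    (Gamma D i a b k (q z).1 (ichart i (q z).2) *: y z 0 a) *: u z 0 b)
    + Ccomp D i k (q z).1 (ichart i (q z).2)
    + (\sum_a Acomp D i a k (q z).1 (ichart i (q z).2) *: y z 0 a)
    + \sum_a Bcomp D i a k (q z).1 (ichart i (q z).2) *: u z 0 a))); last first.
  by apply/funext => x; rewrite mxE scaleN1r.
apply: smooth_at_scale; first exact: smooth_at_cst.
apply: smooth_atD; first apply: smooth_atD; first apply: smooth_atD.
- apply: smooth_at_sum => a; apply: smooth_at_sum => b.
  apply: smooth_at_scale; last exact: smooth_at_coord.
  apply: smooth_at_scale; last exact: smooth_at_coord.
  exact: sqc (nabla_smooth (opN D) t a b k ip).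
- by apply: smooth_at_coord; exact: sqc (tdv_smooth (opC D) t ip).
- apply: smooth_at_sum => a; apply: smooth_at_scale; last exact: smooth_at_coord.
  by apply: smooth_at_coord; exact: sqc (tde_smooth (opA D) t a ip).
- apply: smooth_at_sum => a; apply: smooth_at_scale; last exact: smooth_at_coord.
  by apply: smooth_at_coord; exact: sqc (tde_smooth (opB D) t a ip).
Qed.

Lemma smooth_on_geo_field : smooth_on state_dom geo_field.
Proof.
move=> k; apply: Ck_on_local => z [p ip pz].
have s1 : smooth_at z (fun z : state => z.1).
  exact: (@smooth_at_lin _ _ _ z fst (@continuous_fst _ _ _)).
have s11 : smooth_at z (fun z : state => z.1.1).
  exact: (smooth_at_postlin (l := fst) (@continuous_fst _ _ _) s1).
have s12 : smooth_at z (fun z : state => z.1.2).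
  exact: (smooth_at_postlin (l := snd) (@continuous_snd _ _ _) s1).
have s2 : smooth_at z (fun z : state => z.2).
  exact: (@smooth_at_lin _ _ _ z snd (@continuous_snd _ _ _)).
suff [B nB kB] : smooth_at z geo_field by exists B.
apply: smooth_at_pair; first apply: smooth_at_pair; first apply: smooth_at_pair => //.
- exact: smooth_at_cst.
- exact: (smooth_at_acceleration ip).
- exact: (smooth_at_acceleration ip).
Qed.

End GeodesicField.

(** * Uniqueness of solutions *)

Section Uniqueness.
Context {R : realType}.

(** Near the common value both curves stay in a compact ball where [X] is Lipschitz, and Gronwall
    without forcing keeps their difference 0. *)
Lemma ode_local_unique (V : normedModType R) (cV : coordinates V) (U : set V)
    (X : V -> V) (f g : R -> V) (r : R) :
  open U -> Ck_on 1 U X -> U (f r) -> f r = g r ->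
  (\forall s \near r, is_derive (s : R) 1 f (X (f s))) ->
  (\forall s \near r, is_derive (s : R) 1 g (X (g s))) -> \forall s \near r, f s = g s.
Proof.
move=> oU kX Uf fg Df Dg.
have [e e0 [cK vK hK]] := compact_convex_nbhs cV oU Uf.
set K := [set z : V | `|z - f r| <= e] in cK vK.
have [L L0 hL] := lipschitz_on_compact cV cV cK vK hK kX.
have [G G0 hG] := gronwall cV (ltW L0).
have cf : {for r, continuous f} by exact: is_derive_continuous (nbhs_singleton Df).
have cg : {for r, continuous g} by exact: is_derive_continuous (nbhs_singleton Dg).
have Kf : \forall s \near r, K (f s).
  by have /cvgrPdist_le/(_ _ e0) := cf; apply: filterS => s; rewrite /K/= distrC.
have Kg : \forall s \near r, K (g s).
  by have /cvgrPdist_le/(_ _ e0) := cg; apply: filterS => s; rewrite /K/= -fg distrC fg.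
have : \forall s \near r, [/\ is_derive (s : R) 1 f (X (f s)), is_derive s 1 g (X (g s)), K (f s) & K (g s)].
  by near=> s; split; near: s.
move=> /nbhs_ballP[d /= d0 hd].
(* Gronwall runs forward in time only; the sign [sg] reverses time to reach the points on the left
   of [r]. *)
have key (sg t : R) : sg = 1 \/ sg = -1 -> 0 <= t -> t < d -> t <= 1 ->
    f (sg * t + r) = g (sg * t + r).
  move=> sg1 t0 td t1.
  have near_r x : 0 <= x -> x <= t -> ball r d (sg * x + r).
    move=> x0 xt; rewrite -ball_normE/= opprD addrCA subrr addr0 normrN.
    by case: sg1 => ->; rewrite ?mul1r ?mulN1r ?normrN ger0_norm// (le_lt_trans xt).
  have D1 (x : R) : 0 <= x -> x <= t -> is_derive x 1 (fun s => f (sg * s + r) - g (sg * s + r))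
     (sg *: X (f (sg * x + r)) - sg *: X (g (sg * x + r))).
    move=> x0 xt; have [D1 D2 _ _] := hd _ (near_r x x0 xt).
    by apply: is_deriveB; exact: is_derive_affine.
  have t1' : t <= 0 + 1 by rewrite add0r.
  have c1 : {within `[0, t], continuous (fun s => f (sg * s + r) - g (sg * s + r))}.
    apply: continuous_in_subspaceT => s; rewrite inE/= in_itv/= => /andP[s0 st].
    exact: is_derive_continuous (D1 s s0 st).
  have := hG _ _ 0 t 0 t0 t1' (lexx 0) c1 _ _.
  rewrite mulr0 add0r fg subrr normr0 addr0 mulr0 => H.
  apply/subr0_eq/eqP; rewrite -normr_le0; apply: (H (fun x => sg *: X (f (sg * x + r)) - sg *: X (g (sg * x + r)))).
    by move=> x /andP[x0 xt]; apply: D1; exact: ltW.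
  move=> x /andP[x0 xt]; have [_ _ Kfx Kgx] := hd _ (near_r x (ltW x0) (ltW xt)).
  rewrite addr0 -scalerBr normrZ (_ : `|sg| = 1) ?mul1r; first exact: hL.
  by case: sg1 => ->; rewrite ?normrN normr1.
have n1 : \forall s \near r, `|s - r| < d.
  by apply/nbhs_ballP; exists d => //= s; rewrite -ball_normE/= distrC.
have n2 : \forall s \near r, `|s - r| < 1.
  by apply/nbhs_ballP; exists 1 => //= s; rewrite -ball_normE/= distrC.
near=> s.
have h1 : `|s - r| < d by near: s.
have h2 : `|s - r| <= 1 by apply: ltW; near: s.
case: (lerP r s) => [rs|/ltW rs].
  have := key 1 (s - r) (or_introl erefl); rewrite mul1r subrK; apply.
  - by rewrite subr_ge0.
  - by rewrite (le_lt_trans (ler_norm _)).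
  - by rewrite (le_trans (ler_norm _)).
have := key (-1) (r - s) (or_intror erefl); rewrite mulN1r opprB subrK; apply.
- by rewrite subr_ge0.
- by rewrite (le_lt_trans (ler_norm _))// distrC.
- by rewrite (le_trans (ler_norm _))// distrC.
Unshelve. all: by end_near. Qed.

Lemma closure_eq (T : topologicalType) (f h : R -> T) (B : set R) r :
  hausdorff_space T -> {for r, continuous f} -> {for r, continuous h} ->
  closure B r -> (forall s, B s -> f s = h s) -> f r = h r.
Proof.
move=> hT cf ch Br fh; apply: hT => P Q nP nQ.
have [s [Bs [Ps Qs]]] : B `&` (f @^-1` P `&` h @^-1` Q) !=set0.
  by apply: Br; apply: filterI; [exact: cf|exact: ch].
by exists (f s); split => //; rewrite fh.
Qed.

End Uniqueness.

Section GeodesicExistence.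
Context {R : realType} {n : nat} {M : manifold R n} (D : derivation_operator M).
Variable i : cidx M.
Implicit Types (p q : M) (a b c k : 'I_n) (j : cidx M).
Local Notation rv := 'rV[R]_n.

(** A field along a path is a family of components in all charts; this one is generated by its
    components in chart [i]. *)
Definition lift_field (x u : R -> rv) : R -> cidx M -> rv :=
  fun r => chart_vector i (ichart i (x r)) (u r).

Section Curve.
Variables (J : set R) (x : R -> rv).
Hypotheses (oJ : open J) (sx : forall r, J r -> smooth_at r x)
  (xU : forall r, J r -> (chart i @` cdom i) (x r)).
Let g r := ichart i (x r).

Lemma ichart_dom r : J r -> cdom i (g r) /\ chart i (g r) = x r.
Proof. by move=> /xU[p ip xp]; rewrite /g -xp chartK. Qed.

Lemma path_smooth_ichart r : J r -> path_smooth_at r g.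
Proof.
move=> Jr; have [ip cp] := ichart_dom Jr.
split.
  apply: (continuous_comp (f := x) (g := ichart i)).
    exact: smooth_at_continuous (sx Jr).
  by rewrite -cp; exact: ichart_continuous.
move=> j jp; apply: (smooth_at_comp (row_coordinates n) (f := x) (g := transition i j)).
  exact: sx.
by rewrite -cp; exact: transition_smooth.
Qed.

Lemma velocity_ichart r : J r -> velocity g r = chart_vector i (g r) ('D_1 x r).
Proof.
move=> Jr; have [ip cp] := ichart_dom Jr; have pg := path_smooth_ichart Jr.
have -> : velocity g r = velocity_at pg by [].
congr tcomp; apply: (tangent_ext ip); rewrite chart_vector_id//.
rewrite [LHS]velocityE//; apply: near_eq_derive.
by apply: filterS (open_near oJ Jr) => s /ichart_dom[_ h]; exact: h.
Qed.

Lemma field_along_lift (u : R -> rv) : (forall r, J r -> smooth_at r u) ->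
  field_along J g (lift_field x u).
Proof.
move=> su r Jr; split; first exact: tcompP.
move=> j jp; have [ip cp] := ichart_dom Jr.
(* In chart [j] the components are a derivative of the transition map in which the point and the
   direction both vary, so joint smoothness is used. *)
have H := smooth_at_comp (prod_coordinates (row_coordinates n) (row_coordinates n))
  (f := fun r => (x r, u r)) (g := fun z => 'D_(z.2) (transition i j) z.1)
  (smooth_at_pair (sx Jr) (su _ Jr)).
apply: smooth_at_near_eq (H _).
  near=> s; have Js : J s by near: s; exact: open_nbhs_nbhs.
  have [iS cs] := ichart_dom Js.
  have js : cdom j (g s) by near: s; exact: path_near_cdom (path_smooth_ichart Jr).1 jp.
  rewrite /lift_field chart_vectorE// -/(g s) cs /= deriveE//.
  by rewrite -cs; exact: smooth_at_differentiable (transition_smooth iS js).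
apply: smooth_at_derive_joint; first exact: row_coordinates.
by rewrite /= -cp; exact: transition_smooth.
Unshelve. all: by end_near. Qed.

Lemma Dt_zero_lift (y u : R -> rv) : (forall r, J r -> smooth_at r u) ->
  (forall r : R, J r -> is_derive r 1 x (y r)) ->
  (forall r : R, J r -> is_derive r 1 u (acceleration D i (r, x r) (y r) (u r))) ->
  Dt_zero D J g (lift_field x u).
Proof.
move=> su Dx Du r j k Jr jp.
have [ip cp] := ichart_dom Jr.
apply: (Dt_zero_chart oJ path_smooth_ichart (field_along_lift su) Jr ip _ k jp) => c.
have vE : velocity g r i = y r.
  by rewrite velocity_ichart// chart_vector_id//; have [_ ->] := Dx r Jr.
have uE : lift_field x u r i = u r by rewrite /lift_field chart_vector_id.
rewrite /Dt /nablat vE uE derive1E.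
rewrite (_ : 'D_1 _ r = acceleration D i (r, x r) (y r) (u r) 0 c).
  by rewrite mxE/=; ring.
have D1 := is_derive_postlin (l := linear_map (@row_coord_linear R n c)) (@coord_continuous _ _ _ _ _) (Du r Jr).
have [_ /= <-] := D1; apply: near_eq_derive.
by apply: filterS (open_near oJ Jr) => s /ichart_dom[iS _]; rewrite /lift_field chart_vector_id.
Qed.

End Curve.

Lemma Dt_congr (J : set R) (g : R -> M) (w w' : R -> cidx M -> rv) j k r :
  open J -> J r -> (forall s, J s -> w s = w' s) -> Dt D g w j k r = Dt D g w' j k r.
Proof.
move=> oJ Jr ww; rewrite /Dt /nablat (ww r Jr) !derive1E.
suff -> : 'D_1 (fun s => w s j 0 k) r = 'D_1 (fun s => w' s j 0 k) r by [].
apply: near_eq_derive; by apply: filterS (open_near oJ Jr) => s /ww ->.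
Qed.

Lemma smooth_solution (J : set R) (S : R -> @state R n) : open J ->
  (forall r : R, J r -> is_derive r 1 S (geo_field D i (S r))) ->
  (forall r, J r -> state_dom i (S r)) -> smooth_on J S.
Proof.
move=> oJ DS SU; elim=> [|k IH].
  by move=> r Jr; exact: is_derive_continuous (DS r Jr).
apply: (Ck_on_curve oJ DS).
have kX : Ck_on k (state_dom i) (geo_field D i) by exact: smooth_on_geo_field.
have := Ck_on_comp (@state_coordinates R n) oJ (@open_state_dom _ _ _ i) SU IH kX.
exact.
Qed.

(** The coefficients are read at the time stored in the state, so the first component has to be the
    true parameter for the autonomous system to give the time-dependent equations. *)
Lemma geodesic_of_solution (J : set R) (S : R -> @state R n) : open J ->
  (forall r : R, J r -> is_derive r 1 S (geo_field D i (S r))) ->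
  (forall r, J r -> (S r).1.1.1 = r) ->
  (forall r, J r -> state_dom i (S r)) ->
  let g := fun r => ichart i (S r).1.1.2 in
  let lift := fun u => lift_field (fun r => (S r).1.1.2) u in
  [/\ geodesic D J g, parallel D J g (lift (fun r => (S r).1.2)),
      parallel D J g (lift (fun r => (S r).2)) &
      forall r, J r -> cdom i (g r) /\ velocity g r = chart_vector i (g r) (S r).1.2].
Proof.
move=> oJ DS ST SU g lift; have sS := smooth_solution oJ DS SU.
pose x r := (S r).1.1.2; pose y r := (S r).1.2; pose u r := (S r).2.
have sS' r : J r -> smooth_at r S by move=> Jr; exact: smooth_on_at oJ Jr sS.
have s1 r : J r -> smooth_at r (fun r => (S r).1).
  by move=> Jr; exact: (smooth_at_postlin (l := fst) (@continuous_fst _ _ _) (sS' r Jr)).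
have s11 r : J r -> smooth_at r (fun r => (S r).1.1).
  by move=> Jr; exact: (smooth_at_postlin (l := fst) (@continuous_fst _ _ _) (s1 r Jr)).
have sx r : J r -> smooth_at r x.
  by move=> Jr; exact: (smooth_at_postlin (l := snd) (@continuous_snd _ _ _) (s11 r Jr)).
have sy r : J r -> smooth_at r y.
  by move=> Jr; exact: (smooth_at_postlin (l := snd) (@continuous_snd _ _ _) (s1 r Jr)).
have su r : J r -> smooth_at r u.
  by move=> Jr; exact: (smooth_at_postlin (l := snd) (@continuous_snd _ _ _) (sS' r Jr)).
have D1 (r : R) : J r -> is_derive r 1 (fun r => (S r).1) (geo_field D i (S r)).1.
  by move=> Jr; exact: (is_derive_postlin (l := fst) (@continuous_fst _ _ _) (DS r Jr)).
have D11 (r : R) : J r -> is_derive r 1 (fun r => (S r).1.1) (geo_field D i (S r)).1.1.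
  by move=> Jr; exact: (is_derive_postlin (l := fst) (@continuous_fst _ _ _) (D1 r Jr)).
have Dx (r : R) : J r -> is_derive r 1 x (y r).
  by move=> Jr; exact: (is_derive_postlin (l := snd) (@continuous_snd _ _ _) (D11 r Jr)).
have qE r : J r -> (S r).1.1 = (r, x r) by move=> Jr; rewrite [LHS]surjective_pairing ST.
have Dy (r : R) : J r -> is_derive r 1 y (acceleration D i (r, x r) (y r) (y r)).
  move=> Jr; rewrite -(qE r Jr).
  exact: (is_derive_postlin (l := snd) (@continuous_snd _ _ _) (D1 r Jr)).
have Du (r : R) : J r -> is_derive r 1 u (acceleration D i (r, x r) (y r) (u r)).
  move=> Jr; rewrite -(qE r Jr).
  exact: (is_derive_postlin (l := snd) (@continuous_snd _ _ _) (DS r Jr)).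
have vE r : J r -> velocity g r = lift y r.
  move=> Jr; rewrite (velocity_ichart oJ sx SU Jr); congr (tcomp (chart_vector _ _ _)).
  by have [_ ->] := Dx r Jr.
have parY := Dt_zero_lift oJ sx SU sy Dx Dy.
split.
- split=> [r Jr|r j k Jr jp]; first exact: (path_smooth_ichart sx SU Jr).
  by rewrite (Dt_congr _ _ _ oJ Jr vE); exact: parY.
- by split; [exact: (field_along_lift oJ sx SU sy)|exact: parY].
- by split; [exact: (field_along_lift oJ sx SU su)|exact: (Dt_zero_lift oJ sx SU su Dx Du)].
- by move=> r Jr; split; [exact: (ichart_dom SU Jr).1|exact: vE].
Qed.

End GeodesicExistence.

Section GeodesicUniqueness.
Context {R : realType} {n : nat} {M : manifold R n} (D : derivation_operator M).
Variable i : cidx M.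
Local Notation rv := 'rV[R]_n.

(** The passage from the manifold to the chart, converse to [Dt_zero_lift], used for uniqueness. *)
Lemma is_derive_of_Dt (g : R -> M) (w : R -> cidx M -> rv) (r : R) :
  path_smooth_at r g -> cdom i (g r) -> smooth_at r (fun s => w s i) ->
  (forall k, Dt D g w i k r = 0) ->
  is_derive r 1 (fun s => w s i)
    (acceleration D i (r, chart i (g r)) (velocity g r i) (w r i)).
Proof.
move=> pg ip sw Dt0.
have Dw : is_derive r 1 (fun s => w s i) ('D_1 (fun s => w s i) r).
  by apply: DeriveDef => //; exact/derivable1_diffP/smooth_at_differentiable.
suff <- : 'D_1 (fun s => w s i) r =
  acceleration D i (r, chart i (g r)) (velocity g r i) (w r i) by [].
apply/rowP => k; rewrite mxE/= chartK//.
have D1 := is_derive_postlin (l := linear_map (@row_coord_linear R n k)) (@coord_continuous _ _ _ _ _) Dw.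
have [_ /= <-] := D1.
have := Dt0 k; rewrite /Dt /nablat derive1E /comp/= => /eqP.
by rewrite -!addrA addr_eq0 => /eqP ->; rewrite !addrA.
Qed.

Definition path_state (g : R -> M) (w : R -> cidx M -> rv) (r : R) : @state R n :=
  (r, chart i (g r), velocity g r i, w r i).

Lemma is_derive_path_state (J : set R) (g : R -> M) (w : R -> cidx M -> rv) (r : R) :
  geodesic D J g -> parallel D J g w -> J r -> cdom i (g r) ->
  is_derive r 1 (path_state g w) (geo_field D i (path_state g w r)).
Proof.
move=> [pg gg] [fw pw] Jr ip.
have pgr := pg r Jr.
apply: is_derive_pair; first apply: is_derive_pair; first apply: is_derive_pair.
- exact: (is_derive_velocity pgr ip).
- apply: is_derive_of_Dt => // [|k]; last exact: gg.
  apply: (@smooth_at_near_eq _ _ _ ('D_1 (chart i \o g))).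
    by apply: filterS (path_near_cdom pgr.1 ip) => s iS; rewrite velocityE.
  by apply: smooth_at_derive; exact: pgr.2.
- by apply: is_derive_of_Dt => // [|k]; [exact: (fw r Jr).2|exact: pw].
Qed.

Lemma geodesic_unique (J O : set R) (g : R -> M) (w : R -> cidx M -> rv) (S : R -> @state R n) (s0 : R) :
  open J -> is_interval J -> open O -> is_interval O -> J s0 -> O s0 ->
  geodesic D J g -> parallel D J g w ->
  (forall r : R, O r -> is_derive r 1 S (geo_field D i (S r))) ->
  (forall r, O r -> state_dom i (S r)) ->
  cdom i (g s0) -> path_state g w s0 = S s0 ->
  forall r, J r -> O r -> cdom i (g r) /\ path_state g w r = S r.
Proof.
move=> oJ iJ oO iO J0 O0 gg pw DS SU i0 e0.
pose I := J `&` O; have oI : open I by exact: openI.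
have iI : is_interval I.
  by move=> x y [Jx Ox] [Jy Oy] z xyz; split; [exact: iJ Jx Jy _ xyz|exact: iO Ox Oy _ xyz].
have cI : connected I by apply/connected_intervalP.
(* B is open and closed in I. A limit of points of B stays in the domain of the
   chart because M is Hausdorff. *)
pose B := [set r | I r /\ (cdom i (g r) /\ path_state g w r = S r)].
suff BI : B = I.
  move=> r Jr Or; have : B r by rewrite BI.
  by case.
have pcont r : J r -> cdom i (g r) -> {for r, continuous (path_state g w)}.
  by move=> Jr ir; exact: is_derive_continuous (is_derive_path_state gg pw Jr ir).
have Scont r : O r -> {for r, continuous S}.
  by move=> Or; exact: is_derive_continuous (DS r Or).
apply: cI; first by exists s0.
- exists B; last by apply/seteqP; split=> [r Br|r []//]; split => //; exact: Br.1.
  rewrite openE => r [[Jr Or] [ir er]]; rewrite /interior/=.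
  have near1 : \forall s \near r, is_derive (s : R) 1 (path_state g w) (geo_field D i (path_state g w s)).
    near=> s; apply: (is_derive_path_state gg pw).
      by near: s; exact: open_nbhs_nbhs.
    by near: s; exact: path_near_cdom (gg.1 r Jr).1 ir.
  have near2 : \forall s \near r, is_derive (s : R) 1 S (geo_field D i (S s)).
    near=> s; apply: DS; by near: s; exact: open_nbhs_nbhs.
  have domr : state_dom i (path_state g w r) by rewrite er; exact: SU.
  have U := ode_local_unique (@state_coordinates R n) (@open_state_dom _ _ _ i)
    (@smooth_on_geo_field _ _ _ D i 1%N) domr er near1 near2.
  near=> s; split; first by split; near: s; exact: open_nbhs_nbhs.
  split; last by near: s.
  by near: s; exact: path_near_cdom (gg.1 r Jr).1 ir.
- exists (closure B); first exact: closed_closure.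
  apply/seteqP; split=> [r Br|r [[Jr Or] cB]].
    by split; [exact: Br.1|exact: subset_closure].
  have [p ip px] := SU r Or.
  have gr : g r = ichart i (S r).1.1.2.
    apply: (@closure_eq _ _ g (fun s => ichart i (S s).1.1.2) B r).
    + exact: mfd_hausdorff.
    + exact: (gg.1 r Jr).1.
    + apply: (continuous_comp (f := fun s => (S s).1.1.2) (g := ichart i)); last first.
        by rewrite -px; exact: ichart_continuous.
      have DS' := is_derive_postlin (l := fst) (@continuous_fst _ _ _) (DS r Or).
      have DS'' := is_derive_postlin (l := fst) (@continuous_fst _ _ _) DS'.
      exact: is_derive_continuous (is_derive_postlin (l := snd) (@continuous_snd _ _ _) DS'').
    + exact: cB.
    + by move=> s [_ [iS <-]]; rewrite /= chartK.
  have ir : cdom i (g r) by rewrite gr -px chartK.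
  split => //; split => //; apply: (closure_eq _ (pcont r Jr ir) (Scont r Or) cB).
    exact: norm_hausdorff.
  by move=> s [_ []].
Unshelve. all: by end_near. Qed.

End GeodesicUniqueness.

(** * Comparison of geodesic arcs with the local flow *)

Section Arcs.
Context {R : realType} {n : nat} {M : manifold R n} (D : derivation_operator M).
Variable i : cidx M.
Local Notation rv := 'rV[R]_n.
Local Notation state := (@state R n).

Definition state_pos (z : state) : M := ichart i z.1.1.2.

Lemma solution_time (S : R -> state) (delta s : R) :
  (forall r : R, `|r| < delta -> is_derive r 1 S (geo_field D i (S r))) ->
  `|s| < delta -> (S s).1.1.1 = (S 0).1.1.1 + s.
Proof.
move=> DS sd.
have D1 (r : R) : `|r| < delta -> is_derive r 1 (fun r => (S r).1.1.1) 1.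
  move=> rd; have D1 := is_derive_postlin (l := fst) (@continuous_fst _ _ _) (DS r rd).
  have D2 := is_derive_postlin (l := fst) (@continuous_fst _ _ _) D1.
  exact: (is_derive_postlin (l := fst) (@continuous_fst _ _ _) D2).
have D2 (r : R) : `|r| < delta -> is_derive r 1 (fun r => (S 0).1.1.1 + r) 1.
  move=> _; rewrite -[X in is_derive _ _ _ X]add0r.
  exact: is_deriveD.
apply: (eq_of_is_derive D1 D2) => //.
by rewrite addr0.
Qed.

Lemma velocity_parallel (J : set R) (g : R -> M) : geodesic D J g -> parallel D J g (velocity g).
Proof.
move=> [pg gg]; split => // r Jr; split; first exact: velocity_tangent (pg r Jr).
move=> j jp; apply: (@smooth_at_near_eq _ _ _ ('D_1 (chart j \o g))).
  by apply: filterS (path_near_cdom (pg r Jr).1 jp) => s iS; rewrite velocityE.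
by apply: smooth_at_derive; exact: (pg r Jr).2.
Qed.

(* The velocity of a geodesic is parallel along it, hence a possible last
   component of the state. *)
Lemma is_derive_velocity_state (S : R -> state) (s : R) :
  is_derive s 1 S (geo_field D i (S s)) ->
  is_derive s 1 (fun r => ((S r).1, (S r).1.2) : state)
    (geo_field D i ((S s).1, (S s).1.2)).
Proof.
move=> DS; have D1 := is_derive_postlin (l := fst) (@continuous_fst _ _ _) DS.
have D2 := is_derive_postlin (l := snd) (@continuous_snd _ _ _) D1.
exact: (is_derive_pair D1 D2).
Qed.

Variables (zs : state) (rad delta M0 : R) (Phi : state -> R -> state).
Hypothesis lf : is_local_flow (state_dom i) (geo_field D i) zs rad delta M0 Phi.

Let near_zs (z : state) := `|z - zs| <= rad / 2.

Lemma flow_time z s : near_zs z -> `|s| < delta -> (Phi z s).1.1.1 = z.1.1.1 + s.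
Proof.
move=> nz sd; rewrite (solution_time _ sd) ?(lf_start lf nz)// => r rd.
exact: (lf_derive lf nz (ltW rd)).
Qed.

Lemma flow_dom z s : near_zs z -> `|s| < delta -> state_dom i (Phi z s).
Proof. by move=> nz sd; apply: (lf_dom lf); exact: (lf_ball lf nz (ltW sd)). Qed.

Lemma is_derive_flow z s0 (r : R) : near_zs z -> `|r - s0| < delta ->
  is_derive r 1 (fun r => Phi z (r - s0)) (geo_field D i (Phi z (r - s0))).
Proof.
move=> nz rd; have := @is_derive_affine _ _ 1 (- s0) r (Phi z) (geo_field D i (Phi z (r - s0))).
rewrite mul1r scale1r (_ : (fun s => _) = (fun r => Phi z (r - s0))).
  by apply; exact: (lf_derive lf nz (ltW rd)).
by apply/funext => s; rewrite mul1r.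
Qed.

Lemma interval_ball (s0 d : R) : is_interval [set r : R | `|r - s0| < d].
Proof.
move=> x y /=; rewrite !ltr_norml => /andP[? ?] /andP[? ?] z /andP[? ?].
by rewrite ltr_norml; apply/andP; split; lra.
Qed.

Lemma open_ball (s0 d : R) : open [set r : R | `|r - s0| < d].
Proof.
rewrite (_ : [set _ | _] = (fun r : R => `|r - s0|) @^-1` [set x | x < d]) //.
apply: open_comp; last exact: open_lt.
move=> x _; apply: (continuous_comp (f := fun r : R => r - s0) (g := fun r => `|r|)); last exact: norm_continuous.
by apply: cvgB; [exact: cvg_id|exact: cvg_cst].
Qed.

Lemma open_ball0 (d : R) : open [set r : R | `|r| < d].
Proof.
rewrite (_ : [set _ | _] = [set r | `|r - 0| < d]); first exact: open_ball.
by apply/seteqP; split=> r; rewrite /= subr0.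
Qed.

Lemma arc_exists z s0 s1 : near_zs z -> z.1.1.1 = s0 -> 0 < delta -> `|s1 - s0| < delta ->
  let z1 := Phi z (s1 - s0) in
  exists (J : set R) (g : R -> M),
  [/\ geodesic_arc D s0 s1 (state_pos z) (chart_vector i (state_pos z) z.1.2) J g,
      g s1 = state_pos z1,
      parallel_transport D J g s0 s1 (chart_vector i (state_pos z) z.1.2)
        (chart_vector i (state_pos z1) z1.1.2) &
      parallel_transport D J g s0 s1 (chart_vector i (state_pos z) z.2)
        (chart_vector i (state_pos z1) z1.2)].
Proof.
move=> nz zt d0 s1d z1.
pose J := [set r : R | `|r - s0| < delta]; pose S r := Phi z (r - s0).
have S0 : S s0 = z by rewrite /S subrr (lf_start lf nz).
have J0 : J s0 by rewrite /J/= subrr normr0.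
have oJ : open J by exact: open_ball.
have DS (r : R) : J r -> is_derive r 1 S (geo_field D i (S r)) by exact: is_derive_flow.
have ST r : J r -> (S r).1.1.1 = r by move=> Jr; rewrite /S flow_time// zt addrC subrK.
have SU r : J r -> state_dom i (S r) by exact: flow_dom.
have [gg py pu cd] := geodesic_of_solution oJ DS ST SU.
exists J, (fun r => state_pos (S r)); split.
- split => //; first exact: interval_ball.
    by rewrite S0.
  by rewrite (cd s0 J0).2 S0.
- by [].
- by eexists; split; [exact: py|rewrite /lift_field S0|].
- by eexists; split; [exact: pu|rewrite /lift_field S0|].
Qed.

(** The arc and its transports come with an arbitrary interval [J], but [s1] lies both in [J] and in
    the interval of the flow, where [geodesic_unique] applies. The hypotheses and conclusions are in
    components in chart [i], so that they feed directly into the next stage. *)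
Lemma arc_unique z s0 s1 p (u : cidx M -> rv) (J : set R) (g : R -> M) :
  near_zs z -> z.1.1.1 = s0 -> 0 < delta -> `|s1 - s0| < delta ->
  cdom i p -> chart i p = z.1.1.2 -> u i = z.1.2 -> geodesic_arc D s0 s1 p u J g ->
  let z1 := Phi z (s1 - s0) in
  [/\ cdom i (g s1), chart i (g s1) = z1.1.1.2,
      (forall w w1, parallel_transport D J g s0 s1 w w1 -> w i = z.1.2 -> w1 i = z1.1.2) &
      (forall w w1, parallel_transport D J g s0 s1 w w1 -> w i = z.2 -> w1 i = z1.2)].
Proof.
move=> nz zt d0 s1d ip cp ui [oJ iJ J0 J1 gg gp gu] z1.
pose O := [set r : R | `|r - s0| < delta]; pose S r := Phi z (r - s0).
have S0 : S s0 = z by rewrite /S subrr (lf_start lf nz).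
have O0 : O s0 by rewrite /O/= subrr normr0.
have oO : open O by exact: open_ball.
have iO : is_interval O by exact: interval_ball.
have DS (r : R) : O r -> is_derive r 1 S (geo_field D i (S r)) by exact: is_derive_flow.
have SU r : O r -> state_dom i (S r) by exact: flow_dom.
have i0 : cdom i (g s0) by rewrite gp.
have q0 : (s0, chart i (g s0)) = z.1.1 by rewrite gp cp -zt -surjective_pairing.
have U1 w : parallel D J g w -> w s0 i = z.2 -> w s1 i = z1.2 /\
    cdom i (g s1) /\ chart i (g s1) = z1.1.1.2.
  move=> pw w0; have e0 : path_state i g w s0 = S s0.
    by rewrite /path_state S0 q0 gu ui w0 -!surjective_pairing.
  have [i1 e1] := geodesic_unique oJ iJ oO iO J0 O0 gg pw DS SU i0 e0 J1 s1d.
  by rewrite /z1 -/(S s1) -e1.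
have U2 w : parallel D J g w -> w s0 i = z.1.2 -> w s1 i = z1.1.2 /\
    cdom i (g s1) /\ chart i (g s1) = z1.1.1.2.
  move=> pw w0; pose S' r : state := ((S r).1, (S r).1.2).
  have e0 : path_state i g w s0 = S' s0.
    by rewrite /path_state /S' S0 q0 gu ui w0 -!surjective_pairing.
  have DS' (r : R) : O r -> is_derive r 1 S' (geo_field D i (S' r)).
    by move=> Or; apply: is_derive_velocity_state; exact: DS.
  have [i1 e1] := geodesic_unique oJ iJ oO iO J0 O0 gg pw DS' SU i0 e0 J1 s1d.
  by move: e1; rewrite /path_state /S' -/z1 => -[<- <-].
(* The position at [s1] is obtained from the velocity field itself, so it is available even when no
   transport is given, as for the last geodesic. *)
have [_ [i1 c1]] := U2 _ (velocity_parallel gg) (etrans (congr1 (@^~ i) gu) ui).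
split => //.
- by move=> w w1 [v [pv <- <-]] /(U2 _ pv)[].
- by move=> w w1 [v [pv <- <-]] /(U1 _ pv)[].
Qed.

End Arcs.

(** * The commutator of flows *)

Section Stages.
Context {R : realType} {n : nat} {M : manifold R n} (D : derivation_operator M).
Variable i : cidx M.
Local Notation rv := 'rV[R]_n.
Local Notation state := (@state R n).

Lemma derive_postlin (V W E : normedModType R) (f : V -> W) (l : {linear W -> E}) x h :
  continuous l -> differentiable f x -> 'D_h (fun y => l (f y)) x = l ('D_h f x).
Proof.
move=> cl df; have dl := linear_differentiable (f x) cl.
rewrite (deriveE _ (differentiable_comp df dl)) (deriveE _ df).
by rewrite (diff_comp df dl)/= (diff_lin _ cl).
Qed.

Lemma derive_lin (V W : normedModType R) (l : {linear V -> W}) x h :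
  continuous l -> 'D_h l x = l h.
Proof. by move=> cl; rewrite (deriveE _ (linear_differentiable x cl)) (diff_lin _ cl). Qed.

Lemma is_derive_differentiable (V W : normedModType R) (f : V -> W) (x h : V) :
  differentiable f x -> is_derive x h f ('D_h f x).
Proof. by move=> df; apply: DeriveDef => //; exact: diff_derivable. Qed.

Definition swap (z : state) : state := (z.1.1, z.2, z.1.2).

Lemma swap_linear : linear swap.
Proof. by move=> a [[? ?] ?] [[? ?] ?]. Qed.

Definition swap_map : {linear state -> state} := linear_map swap_linear.

Lemma norm_swap z : `|swap z| = `|z|.
Proof.
have E (q : R * rv) (y u : rv) : `|(q, y, u) : state| = Num.max (Num.max `|q| `|y|) `|u| by [].
by case: z => [[q y] u]; rewrite /swap/= !E maxAC.
Qed.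

Lemma continuous_swap : continuous swap_map.
Proof.
move=> z; apply/cvgrPdist_le => /= e e0; near=> y.
rewrite -[swap z - swap y]/(swap (z - y)) norm_swap.
by near: y; move: e e0; apply/cvgrPdist_le.
Unshelve. all: by end_near. Qed.

Definition pos_map : {linear state -> rv} := snd \o fst \o fst.

Definition vel_map : {linear state -> rv} := snd \o fst.

Lemma continuous_vel : continuous vel_map.
Proof.
move=> z; apply: (continuous_comp (f := fst) (g := snd)); first exact: continuous_fst.
exact: continuous_snd.
Qed.

Lemma continuous_pos : continuous pos_map.
Proof.
move=> z; apply: (continuous_comp (f := fst) (g := fun q => q.1.2)); first exact: continuous_fst.
apply: (continuous_comp (f := fst) (g := snd)); first exact: continuous_fst.
exact: continuous_snd.
Qed.

Section Jets.
Variables (J : set R) (zeta : R -> state).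
Hypotheses (oJ : open J) (J0 : J 0) (sz : smooth_on J zeta).

Lemma swap_jets : [/\ smooth_on J (swap \o zeta),
   'D_1 (swap \o zeta) 0 = swap ('D_1 zeta 0) &
   'D_1 ('D_1 (swap \o zeta)) 0 = swap ('D_1 ('D_1 zeta) 0)].
Proof.
have e1 e : J e -> 'D_1 (swap \o zeta) e = swap ('D_1 zeta e).
  by move=> Je; exact: (derive_postlin (l := swap_map) _ continuous_swap ((sz 1).1 e Je)).
split; last first.
- transitivity ('D_1 (swap \o 'D_1 zeta) 0).
    by apply: near_eq_derive; apply: filterS (open_near oJ J0) => e /e1.
  exact: (derive_postlin (l := swap_map) _ continuous_swap (((sz 2).2 1).1 0 J0)).
- exact: e1.
- by move=> k; exact: (Ck_on_postlin (l := swap_map) continuous_swap oJ (sz k)).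
Qed.

End Jets.

Variables (zs : state) (rad delta M0 : R) (Phi : state -> R -> state).
Hypothesis lf : is_local_flow (state_dom i) (geo_field D i) zs rad delta M0 Phi.

(** With X = sg times the geodesic field, zeta' = X(zeta) + om. The position component of X is [sg]
    times the velocity, a linear function, so the second derivative of the position involves no
    derivative of [acceleration]. The factor 2 counts one term from X(zeta) and one from om, and X_y
    has coefficient sg^2 = 1. *)
Lemma stage_jets (sg d : R) (eta : R -> state) : sg = 1 \/ sg = -1 ->
  0 < d -> d <= delta -> 0 <= rad ->
  let J := [set e : R | `|e| < d] in smooth_on J eta ->
  (forall e, J e -> `|eta e - zs| <= rad / 2) ->
  let zeta := fun e => Phi (eta e) (sg * e) in
  [/\ smooth_on J zeta, zeta 0 = eta 0,
    'D_1 zeta 0 = sg *: geo_field D i (eta 0) + 'D_1 eta 0 &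
    ('D_1 ('D_1 zeta) 0).1.1.2 = ('D_1 ('D_1 eta) 0).1.1.2 +
       (sg * 2) *: ('D_1 eta 0).1.2 + (geo_field D i (eta 0)).1.2].
Proof.
move=> sg1 d0 dd rad0 J se hJ zeta.
have oJ : open J by exact: open_ball0.
have J0 : J 0 by rewrite /J/= normr0.
have sgn : `|sg| = 1 by case: sg1 => ->; rewrite ?normrN normr1.
have bnd e s : J e -> 0 <= s <= 1 -> `|sg * e * s| <= delta.
  move=> Je /andP[s0 s1]; rewrite !normrM sgn mul1r (ger0_norm s0).
  by rewrite (le_trans _ dd)// (le_trans _ (ltW Je))// ler_piMr.
pose X z := sg *: geo_field D i z.
have sX : smooth_on (state_dom i) X.
  move=> k; apply: Ck_on_scale; first exact: open_state_dom.
    exact: Ck_on_cst.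
  exact: smooth_on_geo_field.
(* The parameter s in [0, 1] runs through the flow times from 0 to [sg * e], so that [Z e] is an
   integral curve of [e *: X]. *)
pose Z e s := Phi (eta e) (sg * e * s).
have fZ : flow_family (state_dom i) X J eta Z.
  split.
  - by move=> e Je; rewrite /Z mulr0 (lf_start lf (hJ e Je)).
  - move=> e Je s; apply: (continuous_comp (f := fun s => sg * e * s) (g := Phi (eta e))).
      by apply: cvgMr; exact: cvg_id.
    exact: (lf_continuous lf (hJ e Je)).
  - move=> e s Je /andP[s0 s1]; have s01 : 0 <= s <= 1 by rewrite !ltW.
    have := @is_derive_affine _ _ (sg * e) 0 s (Phi (eta e)) (geo_field D i (Z e s)).
    rewrite addr0 (_ : (fun s => _) = Z e).
      move=> H; have := H (lf_derive lf (hJ e Je) (bnd e s Je s01)).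
      by rewrite [sg * e]mulrC -scalerA.
    by apply/funext => r; rewrite addr0.
  - move=> e Je; exists [set z : state | `|z - zs| <= rad]; split.
    + exact: (lf_compact lf).
    + exact: (lf_convex lf).
    + by move=> z /(lf_dom lf).
    + near=> h; have Jh : J h by near: h; exact: open_nbhs_nbhs.
      by move=> s s01; exact: (lf_ball lf (hJ h Jh) (bnd h s Jh s01)).
have zE : zeta = (fun e => Z e 1) by apply/funext => e; rewrite /Z mulr1.
have oU := @open_state_dom _ _ _ i.
have cS := @state_coordinates R n.
have szeta : smooth_on J zeta by rewrite zE; exact: (flow_family_smooth cS oU sX oJ se fZ).
have [om [D1 z0 om0 D2]] := flow_family_second_order cS oU sX oJ se fZ J0.
have z00 : zeta 0 = eta 0 by rewrite zE.
have d1 e : J e -> 'D_1 zeta e = X (zeta e) + om e.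
  by move=> Je; have := D1 e Je; rewrite -zE => -[_ ->]; rewrite zE.
have dz0 : 'D_1 zeta 0 = X (eta 0) + 'D_1 eta 0 by rewrite d1// z00 om0.
split => //.
have dzz : differentiable ('D_1 zeta) 0 := ((szeta 2).2 1).1 0 J0.
transitivity ('D_1 (fun e => sg *: vel_map (zeta e) + pos_map (om e)) 0).
  rewrite -[LHS]/(pos_map _) -(derive_postlin (l := pos_map) (1 : R) continuous_pos dzz).
  by apply: near_eq_derive; apply: filterS (open_near oJ J0) => e /d1 ->.
have Dv : is_derive (0 : R) 1 (fun e => sg *: vel_map (zeta e))
    (sg *: (sg *: (geo_field D i (eta 0)).1.2 + ('D_1 eta 0).1.2)).
  rewrite -[X in sg *: X]/(vel_map (X (eta 0) + 'D_1 eta 0)) -dz0.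
  apply: is_deriveZ; apply: (is_derive_postlin (l := vel_map)); first exact: continuous_vel.
  have dz1 : differentiable zeta 0 := (szeta 1%N).1 0 J0.
  exact: is_derive_differentiable.
have Dp := is_derive_postlin (l := pos_map) continuous_pos D2.
have [_ ->] := is_deriveD Dv Dp.
have dX : differentiable X (eta 0).
  by apply: (sX 1).1; rewrite -z00; apply: (lf_dom lf); apply: (lf_ball lf (hJ 0 J0)); rewrite mulr0 normr0 (le_trans (ltW d0)).
have -> : pos_map ('D_('D_1 eta 0) X (eta 0) + 'D_1 ('D_1 eta) 0) =
    sg *: vel_map ('D_1 eta 0) + pos_map ('D_1 ('D_1 eta) 0).
  apply: etrans (linearD pos_map _ _) _.
  apply: (congr1 (fun q => q + pos_map ('D_1 ('D_1 eta) 0))).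
  apply: etrans (esym (derive_postlin (l := pos_map) _ continuous_pos dX)) _.
  apply: etrans (deriveZ _ (f := vel_map) _) _.
    exact: diff_derivable (linear_differentiable _ continuous_vel).
  exact: (congr1 (fun q => sg *: q) (derive_lin _ _ continuous_vel)).
rewrite -[pos_map _]/(('D_1 ('D_1 eta) 0).1.1.2) -[vel_map _]/(('D_1 eta 0).1.2).
rewrite scalerDr scalerA (_ : sg * sg = 1) ?scale1r; last by case: sg1 => ->; rewrite ?mulrNN mulr1.
rewrite mulr_natr mulr2n scalerDl -!addrA addrC -!addrA addrCA.
by do 2 rewrite (addrCA _ ('D_1 ('D_1 eta) 0).1.1.2).
Unshelve. all: by end_near. Qed.

Lemma start_jets (d : R) (z : state) : 0 < d -> d <= delta -> 0 <= rad -> `|z - zs| <= rad / 2 ->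
  let J := [set e : R | `|e| < d] in
  [/\ smooth_on J (Phi z), Phi z 0 = z, 'D_1 (Phi z) 0 = geo_field D i z &
    ('D_1 ('D_1 (Phi z)) 0).1.1.2 = (geo_field D i z).1.2].
Proof.
move=> d0 dd rad0 nz J.
pose eta : R -> state := fun=> z.
have [q y dz ddz] := stage_jets (eta := eta) (or_introl erefl) d0 dd rad0
  (fun k => Ck_on_cst k J z) (fun _ _ => nz).
have E : (fun e => Phi (eta e) (1 * e)) = Phi z by apply/funext => e; rewrite mul1r.
rewrite E in q y dz ddz.
have dc (e : R) : 'D_1 eta e = 0 by exact: derive_cst.
have ddc : 'D_1 ('D_1 eta) 0 = 0.
  rewrite (_ : 'D_1 eta = cst 0); last exact/funext.
  exact: derive_cst.
split => //.
- exact: (lf_start lf nz).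
- by rewrite dz dc scale1r addr0.
- by rewrite ddz dc ddc /= scaler0 !add0r.
Qed.

End Stages.

Section Commutator.
Context {R : realType} {n : nat} {M : manifold R n} (D : derivation_operator M).
Variables (t : R) (p0 : M) (v0 w0 : tangent p0) (i : cidx M) (ip : cdom i p0).
Local Notation rv := 'rV[R]_n.
Local Notation state := (@state R n).

(** The first and third stages start near [A], the second and fourth near [B]; the isometry [swap]
    exchanges the two. *)
Let A : state := (t, chart i p0, v0 i, w0 i).
Let B : state := (t, chart i p0, w0 i, v0 i).
Let a (y u : rv) := acceleration D i (t, chart i p0) y u.

Lemma state_scaleD (s : R) (x y : state) :
  s *: x + y = (s * x.1.1.1 + y.1.1.1, s *: x.1.1.2 + y.1.1.2, s *: x.1.2 + y.1.2, s *: x.2 + y.2).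
Proof. by case: x y => [[[? ?] ?] ?] [[[? ?] ?] ?]. Qed.

(** The successive drifts before the four stages, [x] and [y] bounding the displacements by the
    flows near [A] and [B]; the largest is 2 x + y. *)
Lemma sum_bounds (x y X : R) : 0 <= x -> 0 <= y -> 2 * (x + y) <= X ->
  [/\ 0 <= X, x <= X, y + x <= X & x + (y + x) <= X].
Proof. by move=> *; split; lra. Qed.

Variables (rA dA mA : R) (PA : state -> R -> state).
Variables (rB dB mB : R) (PB : state -> R -> state).
Hypothesis lA : is_local_flow (state_dom i) (geo_field D i) A rA dA mA PA.
Hypothesis lB : is_local_flow (state_dom i) (geo_field D i) B rB dB mB PB.
Variable d : R.
Hypotheses (d0 : 0 < d) (ddA : d <= dA) (ddB : d <= dB) (mA0 : 0 < mA) (mB0 : 0 < mB)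
  (drA : 2 * (mA + mB) * d <= rA / 2) (drB : 2 * (mA + mB) * d <= rB / 2).

Let J := [set e : R | `|e| < d].
Let z1 e := PA A e.
Let z2 e := PB (swap (z1 e)) e.
Let z3 e := PA (swap (z2 e)) (- e).
Let z4 e := PB (swap (z3 e)) (- e).

(** Each stage displaces the state by at most [mA * |e|] or [mB * |e|] and [swap] preserves
    distances, so every stage starts in the half ball of its flow. *)
Lemma quadrilateral_near e : J e -> [/\ `|A - A| <= rA / 2, `|swap (z1 e) - B| <= rB / 2,
  `|swap (z2 e) - A| <= rA / 2 & `|swap (z3 e) - B| <= rB / 2].
Proof.
move=> Je; have eA : `|e| <= dA by rewrite (le_trans (ltW Je)).
have eB : `|e| <= dB by rewrite (le_trans (ltW Je)).
have e0 : 0 <= `|e| by [].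
have mA_ : 0 <= mA * `|e| by rewrite mulr_ge0// ltW.
have mB_ : 0 <= mB * `|e| by rewrite mulr_ge0// ltW.
have small : 2 * (mA * `|e| + mB * `|e|) <= 2 * (mA + mB) * d.
  by rewrite -mulrDl mulrA ler_wpM2l ?(ltW Je)// mulr_ge0// addr_ge0// ltW.
have [kA1 kA2 kA3 kA4] := sum_bounds mA_ mB_ (le_trans small drA).
have [kB1 kB2 kB3 kB4] := sum_bounds mA_ mB_ (le_trans small drB).
have n1 : `|A - A| <= rA / 2 by rewrite subrr normr0.
have h1 : `|swap (z1 e) - B| <= mA * `|e|.
  by rewrite -[swap _ - B]/(swap (z1 e - A)) norm_swap; exact: (lf_dist lA n1 eA).
have n2 : `|swap (z1 e) - B| <= rB / 2 := le_trans h1 kB2.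
have h2 : `|swap (z2 e) - A| <= mB * `|e| + mA * `|e|.
  rewrite -[swap _ - A]/(swap (z2 e - B)) norm_swap.
  by rewrite (le_trans (ler_distD (swap (z1 e)) _ _))// lerD//; exact: (lf_dist lB n2 eB).
have n3 : `|swap (z2 e) - A| <= rA / 2 := le_trans h2 kA3.
have h3 : `|swap (z3 e) - B| <= mA * `|e| + (mB * `|e| + mA * `|e|).
  rewrite -[swap _ - B]/(swap (z3 e - A)) norm_swap.
  rewrite (le_trans (ler_distD (swap (z2 e)) _ _))// lerD//.
  by rewrite -[X in _ <= _ * X](normrN e); apply: (lf_dist lA n3); rewrite normrN.
exact: (And4 n1 n2 n3 (le_trans h3 kB4)).
Qed.

Lemma quadrilateral_times e : J e ->
  [/\ (z1 e).1.1.1 = t + e, (z2 e).1.1.1 = t + 2 * e & (z3 e).1.1.1 = t + e].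
Proof.
move=> Je; have eA : `|e| < dA by rewrite (lt_le_trans Je).
have eB : `|e| < dB by rewrite (lt_le_trans Je).
have [n1 n2 n3 _] := quadrilateral_near Je.
have h1 : (z1 e).1.1.1 = t + e by rewrite /z1 (flow_time lA).
have h2 : (z2 e).1.1.1 = t + 2 * e.
  by rewrite /z2 (flow_time lB)// -[(swap _).1.1.1]/((z1 e).1.1.1) h1; ring.
split => //; rewrite /z3 (flow_time lA) ?normrN// -[(swap _).1.1.1]/((z2 e).1.1.1) h2; ring.
Qed.

(** Uniqueness of each arc gives one direction and the arcs cut from the flows give the other.
    Exchanging the last two components between stages makes the transported vector the next initial
    velocity. *)
Lemma quadrilateral_flow e p4 : J e ->
  quadrilateral D t v0 w0 e p4 <-> p4 = state_pos i (z4 e).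
Proof.
move=> Je; have eA : `|e| < dA by rewrite (lt_le_trans Je).
have eB : `|e| < dB by rewrite (lt_le_trans Je).
have dA0 : 0 < dA by rewrite (lt_le_trans d0).
have dB0 : 0 < dB by rewrite (lt_le_trans d0).
have [n1 n2 n3 n4] := quadrilateral_near Je; have [t1 t2 t3] := quadrilateral_times Je.
have s1 : t + e - t = e by ring.
have s2 : t + 2 * e - (t + e) = e by ring.
have s3 : t + e - (t + 2 * e) = - e by ring.
have s4 : t - (t + e) = - e by ring.
have b1 : `|t + e - t| < dA by rewrite s1.
have b2 : `|t + 2 * e - (t + e)| < dB by rewrite s2.
have b3 : `|t + e - (t + 2 * e)| < dA by rewrite s3 normrN.
have b4 : `|t - (t + e)| < dB by rewrite s4 normrN.
split.
  case=> J1 [J2 [J3 [J4 [g1 [g2 [g3 [g4 [v1 [w1 [v2 [w2 [w3]]]]]]]]]]]].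
  case=> -[a1 tv1 tw1] [a2 tv2 tw2] [a3 tw3] a4 g4t.
  have [i1 c1 V1 W1] := arc_unique (u := v0) lA n1 erefl dA0 b1 ip erefl erefl a1.
  rewrite s1 in c1 V1 W1.
  have v1i := V1 _ _ tv1 erefl; have w1i := W1 _ _ tw1 erefl.
  have [i2 c2 V2 W2] := arc_unique lB n2 t1 dB0 b2 i1 c1 w1i a2.
  rewrite s2 in c2 V2 W2.
  have w2i := V2 _ _ tw2 w1i; have v2i := W2 _ _ tv2 v1i.
  have [i3 c3 V3 W3] := arc_unique lA n3 t2 dA0 b3 i2 c2 v2i a3.
  rewrite s3 in c3 V3 W3; have w3i := W3 _ _ tw3 w2i.
  have [i4 c4 _ _] := arc_unique lB n4 t3 dB0 b4 i3 c3 w3i a4.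
  by rewrite s4 g4t in c4; rewrite /state_pos /z4 -c4 -g4t chartK.
move=> ->.
have [J1 [g1 []]] := arc_exists lA n1 erefl dA0 b1.
rewrite s1 (chartK ip : state_pos i A = p0) !(chart_vectorK _ ip) => a1 e1 tv1 tw1.
have [J2 [g2 []]] := arc_exists lB n2 t1 dB0 b2.
rewrite s2 => a2 e2 tw2 tv2.
have [J3 [g3 []]] := arc_exists lA n3 t2 dA0 b3.
rewrite s3 => a3 e3 _ tw3.
have [J4 [g4 []]] := arc_exists lB n4 t3 dB0 b4.
rewrite s4 => a4 e4 _ _.
exists J1, J2, J3, J4, g1, g2, g3, g4; do 5 eexists; split; first 1 last.
- by rewrite e1; split; [exact: a2|exact: tv2|exact: tw2].
- by rewrite e2; split; [exact: a3|exact: tw3].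
- by rewrite e3; exact: a4.
- exact: e4.
- by split; [exact: a1|exact: tv1|exact: tw1].
Qed.

(** The first derivatives are carried in full through the stages, since the second derivative of a
    position uses the velocity component of the preceding first derivative; of the second
    derivatives only the positions are needed. *)
Lemma quadrilateral_jets :
  [/\ smooth_on J z4, z4 0 = B, ('D_1 z4 0).1.1.2 = 0 &
      ('D_1 ('D_1 z4) 0).1.1.2 = (2 : R) *: (a (v0 i) (w0 i) - a (w0 i) (v0 i))].
Proof.
have oJ : open J by exact: open_ball0.
have J0 : J 0 by rewrite /J/= normr0.
have rA0 : 0 <= rA.
  by have [n1 _ _ _] := quadrilateral_near J0; have := le_trans (normr_ge0 _) n1; lra.
have rB0 : 0 <= rB.
  by have [_ n1 _ _] := quadrilateral_near J0; have := le_trans (normr_ge0 _) n1; lra.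
pose v := v0 i; pose w := w0 i.
have [n1 _ _ _] := quadrilateral_near J0.
have [q1 e1 d1 x1] := start_jets lA d0 ddA rA0 n1.
have [sq1 sd1 sx1] := swap_jets oJ J0 q1.
have [q2 y2 d2 x2] := stage_jets lB (or_introl erefl) d0 ddB rB0
  sq1 (fun e Je => let: And4 _ n2 _ _ := quadrilateral_near Je in n2).
rewrite (_ : (fun e => PB _ _) = z2) in q2 y2 d2 x2; last by apply/funext => e; rewrite mul1r.
have [sq2 sd2 sx2] := swap_jets oJ J0 q2.
have [q3 y3 d3 x3] := stage_jets lA (or_intror erefl) d0 ddA rA0
  sq2 (fun e Je => let: And4 _ _ n3 _ := quadrilateral_near Je in n3).
rewrite (_ : (fun e => PA _ _) = z3) in q3 y3 d3 x3; last by apply/funext => e; rewrite mulN1r.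
have [sq3 sd3 sx3] := swap_jets oJ J0 q3.
have [q4 y4 d4 x4] := stage_jets lB (or_intror erefl) d0 ddB rB0
  sq3 (fun e Je => let: And4 _ _ _ n4 := quadrilateral_near Je in n4).
rewrite (_ : (fun e => PB _ _) = z4) in q4 y4 d4 x4; last by apply/funext => e; rewrite mulN1r.
have e1' : swap (z1 0) = B by rewrite /z1 e1.
have e2 : swap (z2 0) = A.
  by rewrite -[A]/(swap B) -e1'; congr swap; exact: etrans (congr1 _ (esym (mul1r 0))) y2.
have e3 : swap (z3 0) = B.
  by rewrite -[B]/(swap A) -e2; congr swap; exact: etrans (congr1 _ (esym (mulN1r 0))) y3.
have e4 : z4 0 = B.
  by rewrite -e3; exact: etrans (congr1 _ (esym (mulN1r 0))) y4.
have D1 : 'D_1 z1 0 = (1, v, a v v, a v w) by exact: d1.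
have X1 : ('D_1 ('D_1 z1) 0).1.1.2 = a v v by exact: x1.
have D2 : 'D_1 z2 0 = (2, w + v, a w w + a v w, a w v + a v v).
  by rewrite d2 sd1 D1 -[(swap \o z1) 0]/(swap (z1 0)) e1' state_scaleD /= mul1r !scale1r.
have X2 : ('D_1 ('D_1 z2) 0).1.1.2 = a v v + (2 : R) *: a v w + a w w.
  by rewrite x2 sx1 sd1 D1 -[(swap \o z1) 0]/(swap (z1 0)) e1' /= mul1r X1.
have D3 : 'D_1 z3 0 = (1, w, a w v, a w w).
  rewrite d3 sd2 D2 -[(swap \o z2) 0]/(swap (z2 0)) e2 state_scaleD /= !scaleN1r.
  rewrite [w + v]addrC [a w w + _]addrC [a w v + _]addrC !addKr.
  suff -> : -1 * 1 + 2 = 1 :> R by []; ring.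
have X3 : ('D_1 ('D_1 z3) 0).1.1.2 = (2 : R) *: a v w - (2 : R) *: a w v + a w w.
  rewrite x3 sx2 sd2 D2 -[(swap \o z2) 0]/(swap (z2 0)) e2 /= X2.
  rewrite -[acceleration D i _ _ _]/(a v v).
  by apply/rowP => k; rewrite !mxE; ring.
split => //.
- by rewrite d4 sd3 D3 -[(swap \o z3) 0]/(swap (z3 0)) e3 state_scaleD /= scaleN1r addNr.
- rewrite x4 sx3 sd3 D3 -[(swap \o z3) 0]/(swap (z3 0)) e3 /= X3.
  rewrite -[acceleration D i _ _ _]/(a w w) -/v -/w.
  by apply/rowP => k; rewrite !mxE; ring.
Qed.

Lemma quadrilateral_endpoint : exists zeta : R -> state,
  [/\ smooth_on [set e : R | `|e| < d] zeta,
      forall e : R, `|e| < d -> state_dom i (zeta e) /\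
        forall p4, quadrilateral D t v0 w0 e p4 <-> p4 = state_pos i (zeta e),
      (zeta 0).1.1.2 = chart i p0, ('D_1 zeta 0).1.1.2 = 0 &
      ('D_1 ('D_1 zeta) 0).1.1.2 = (2 : R) *: (acceleration D i (t, chart i p0) (v0 i) (w0 i)
        - acceleration D i (t, chart i p0) (w0 i) (v0 i))].
Proof.
have [q e0 D1 D2] := quadrilateral_jets; exists z4; split => //; last by rewrite e0.
move=> e Je; split; last by move=> p4; exact: quadrilateral_flow.
have [_ _ _ n4] := quadrilateral_near Je.
by apply: (flow_dom lB n4); rewrite normrN (lt_le_trans Je).
Qed.

End Commutator.

Section CommutatorChart.
Context {R : realType} {n : nat} {M : manifold R n} (D : derivation_operator M).
Variables (t : R) (p0 : M) (v0 w0 : tangent p0).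
Local Notation rv := 'rV[R]_n.

(** The term in [C] cancels, and A(v) + B(w) - A(w) - B(v) is (A - B)(v - w); exchanging the indices
    in one double sum gives the torsion term. *)
Lemma acceleration_antisym (i : cidx M) (v w : rv) (k : 'I_n) : cdom i p0 ->
  (acceleration D i (t, chart i p0) v w - acceleration D i (t, chart i p0) w v) 0 k =
  - (\sum_a \sum_b (Gamma D i a b k t p0 - Gamma D i b a k t p0) * v 0 a * w 0 b)
  - (\sum_a (Acomp D i a k t p0 - Bcomp D i a k t p0) * (v 0 a - w 0 a)).
Proof.
move=> ip; rewrite !mxE /= (chartK ip).
have -> : \sum_a \sum_b (Gamma D i a b k t p0 - Gamma D i b a k t p0) * v 0 a * w 0 b =
    (\sum_a \sum_b Gamma D i a b k t p0 * v 0 a * w 0 b) -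
    \sum_a \sum_b Gamma D i a b k t p0 * w 0 a * v 0 b.
  rewrite [X in _ = _ - X]exchange_big -sumrB; apply: eq_bigr => x _.
  by rewrite -sumrB; apply: eq_bigr => y _; ring.
have -> : \sum_a (Acomp D i a k t p0 - Bcomp D i a k t p0) * (v 0 a - w 0 a) =
    (\sum_a Acomp D i a k t p0 * v 0 a) - (\sum_a Acomp D i a k t p0 * w 0 a) -
    ((\sum_a Bcomp D i a k t p0 * v 0 a) - \sum_a Bcomp D i a k t p0 * w 0 a).
  by rewrite -!sumrB; apply: eq_bigr => x _; ring.
ring.
Qed.

Lemma chart_vector0 (i : cidx M) (p : M) : (chart_vector i p 0 : cidx M -> rv) = 0.
Proof.
apply/funext => j; rewrite /= /chart_vector_comp; case: asboolP => // _.
exact: linear0.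
Qed.

Lemma commutator_chart (i : cidx M) : cdom i p0 ->
  exists (delta : R) (c : R -> M), [/\ 0 < delta,
    forall e : R, `|e| < delta -> forall p4, quadrilateral D t v0 w0 e p4 <-> p4 = c e,
    forall e : R, `|e| < delta -> path_smooth_at e c,
    c 0 = p0 /\ velocity c 0 = 0 &
    forall k : 'I_n, 2^-1 * derive1n 2 (fun e => chart i (c e) 0 k) 0 =
       - (\sum_a \sum_b (Gamma D i a b k t p0 - Gamma D i b a k t p0)
                        * v0 i 0 a * w0 i 0 b)
       - (\sum_a (Acomp D i a k t p0 - Bcomp D i a k t p0)
                 * (v0 i 0 a - w0 i 0 a))].
Proof.
move=> ip.
have sX : Ck_on 1 (state_dom i) (geo_field D i) by exact: smooth_on_geo_field.
pose A : @state R n := (t, chart i p0, v0 i, w0 i).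
pose B : @state R n := (t, chart i p0, w0 i, v0 i).
have UA : state_dom i A by exists p0.
have UB : state_dom i B by exists p0.
have [rA [dA [mA [PA [rA0 dA0 mA0 lA]]]]] :=
  local_flow (@state_coordinates R n) (@open_state_dom _ _ _ i) sX UA.
have [rB [dB [mB [PB [rB0 dB0 mB0 lB]]]]] :=
  local_flow (@state_coordinates R n) (@open_state_dom _ _ _ i) sX UB.
(* The factor 4 makes [2 * (mA + mB) * d] at most half of each radius, which bounds the total drift
   by the half balls. *)
pose d := Num.min (Num.min dA dB) (Num.min rA rB / (4 * (mA + mB))).
have m0 : 0 < mA + mB by rewrite addr_gt0.
have d0 : 0 < d by rewrite !lt_min dA0 dB0 divr_gt0// ?mulr_gt0// lt_min rA0.
have ddA : d <= dA by rewrite !ge_min lexx.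
have ddB : d <= dB by rewrite !ge_min lexx orbT.
have dr : 2 * (mA + mB) * d <= Num.min rA rB / 2.
  have : d <= Num.min rA rB / (4 * (mA + mB)) by rewrite ge_min lexx orbT.
  rewrite ler_pdivlMr ?mulr_gt0// => h; rewrite ler_pdivlMr//; apply: le_trans h.
  by apply: le_of_eq; ring.
have drA : 2 * (mA + mB) * d <= rA / 2.
  by rewrite (le_trans dr)// ler_pM2r ?invr_gt0// ge_min lexx.
have drB : 2 * (mA + mB) * d <= rB / 2.
  by rewrite (le_trans dr)// ler_pM2r ?invr_gt0// ge_min lexx orbT.
have [zeta [sz fz z0 dz ddz]] := quadrilateral_endpoint ip lA lB d0 ddA ddB mA0 mB0 drA drB.
pose J := [set e : R | `|e| < d].
have oJ : open J by exact: open_ball0.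
have J0 : J 0 by rewrite /J/= normr0.
pose x : R -> rv := fun e => (zeta e).1.1.2.
have sx e : J e -> smooth_at e x.
  move=> Je; have sze := smooth_on_at oJ Je sz.
  exact: (smooth_at_postlin (l := @pos_map R n) (@continuous_pos R n) sze).
have xU e : J e -> (chart i @` cdom i) (x e) by move=> /fz[].
have x0 : ichart i (x 0) = p0 by rewrite /x z0 chartK.
have dx e : J e -> 'D_1 x e = ('D_1 zeta e).1.1.2.
  move=> Je; have dze : differentiable zeta e := (sz 1%N).1 e Je.
  exact: (derive_postlin (l := @pos_map R n) (1 : R) (@continuous_pos R n) dze).
have ddx : 'D_1 ('D_1 x) 0 = ('D_1 ('D_1 zeta) 0).1.1.2.
  transitivity ('D_1 (fun e => pos_map ('D_1 zeta e)) 0).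
    by apply: near_eq_derive; apply: filterS (open_near oJ J0) => e /dx.
  have dze : differentiable ('D_1 zeta) 0 := ((sz 2%N).2 1).1 0 J0.
  exact: (derive_postlin (l := @pos_map R n) (1 : R) (@continuous_pos R n) dze).
exists d, (fun e => ichart i (x e)); split => //.
- by move=> e /fz[].
- by move=> e Je; exact: (path_smooth_ichart sx xU Je).
- split => //; rewrite (velocity_ichart oJ sx xU J0) (dx 0 J0) dz; exact: chart_vector0.
- move=> k; rewrite -acceleration_antisym//.
  pose l := linear_map (@row_coord_linear R n k).
  have cl : continuous l by exact: coord_continuous.
  have f1 e : J e -> derive1 (fun e => chart i (ichart i (x e)) 0 k) e = l ('D_1 x e).
    move=> Je; rewrite derive1E; transitivity ('D_1 (fun e => l (x e)) e).
      apply: near_eq_derive; apply: filterS (open_near oJ Je) => r Jr.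
      by rewrite (ichart_dom xU Jr).2.
    have dxe := smooth_at_differentiable (sx e Je).
    exact: (derive_postlin (l := l) (1 : R) cl dxe).
  have -> : derive1n 2 (fun e => chart i (ichart i (x e)) 0 k) 0 = l ('D_1 ('D_1 x) 0).
    rewrite -[LHS]/(derive1 (derive1 _) 0) derive1E.
    transitivity ('D_1 (fun e => l ('D_1 x e)) 0).
      by apply: near_eq_derive; apply: filterS (open_near oJ J0) => e /f1.
    have dxe := smooth_at_differentiable (smooth_at_derive (1 : R) (sx 0 J0)).
    exact: (derive_postlin (l := l) (1 : R) cl dxe).
  rewrite ddx ddz /l /= mxE mulrA mulVf ?mul1r//.
Qed.

End CommutatorChart.

Theorem theorem8p1 (R : realType) (n : nat) (M : manifold R n)
    (D : derivation_operator M) (t : R) (p0 : M) (v0 w0 : tangent p0) :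
  exists (delta : R) (c : R -> M),
    0 < delta /\
    (forall e : R, `|e| < delta ->
       forall p4, quadrilateral D t v0 w0 e p4 <-> p4 = c e) /\
    (forall e : R, `|e| < delta -> path_smooth_at e c) /\
    c 0 = p0 /\
    velocity c 0 = 0 /\
    (forall (i : cidx M), cdom i p0 -> forall k : 'I_n,
       2^-1 * derive1n 2 (fun e => chart i (c e) 0 k) 0 =
       - (\sum_a \sum_b (Gamma D i a b k t p0 - Gamma D i b a k t p0)
                        * v0 i 0 a * w0 i 0 b)
       - (\sum_a (Acomp D i a k t p0 - Bcomp D i a k t p0)
                 * (v0 i 0 a - w0 i 0 a))).
Proof.
have [i0 i0p] := cdom_cover p0.
have [d [c [d0 qc sc [c0 vc] hc]]] := commutator_chart D t v0 w0 i0p.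
exists d, c; do 5 split => //.
move=> i ip k.
(* The curve [c'] is constructed in chart [i]. Both [c e] and [c' e] are the only endpoint for step
   [e], so the curves agree near 0 and the formula in chart [i] passes to [c]. *)
have [d' [c' [d0' qc' _ _ hc']]] := commutator_chart D t v0 w0 ip.
apply: etrans _ (hc' k); apply: (congr1 (fun r => 2^-1 * r)).
pose m := Num.min d d'.
have m0 : 0 < m by rewrite lt_min d0.
pose J := [set e : R | `|e| < m].
have oJ : open J by exact: open_ball0.
have cc e : J e -> c e = c' e.
  rewrite /J/= lt_min => /andP[ed ed'].
  by apply/(qc' e ed')/(qc e ed).
have f1 e : J e -> derive1 (fun e => chart i (c e) 0 k) e = derive1 (fun e => chart i (c' e) 0 k) e.
  move=> Je; rewrite !derive1E; apply: near_eq_derive.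
  by apply: filterS (open_near oJ Je) => r /cc ->.
rewrite -[LHS]/(derive1 (derive1 _) 0) -[RHS]/(derive1 (derive1 _) 0) !derive1E.
apply: near_eq_derive.
have J0 : J 0 by rewrite /J/= normr0.
by apply: filterS (open_near oJ J0) => r /f1.
Qed.
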